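(* Let $\lambda\in\mathbb R$ be fixed. For each $n$ (large enough that $p\in[0,1]$) let $p=\frac12-\frac{\lambda}{2\sqrt n}$ and let $\omega\in\{0,1,2\}^n$ be sampled according to the Bernoulli initial condition of parameter $p$ with a second class particle in uniform position. Let $E_n=E_n(\omega)=T_n(\omega)-T_n^{(2)}(\Pi_1\omega)$ be the excess. Then, as $n\to\infty$, $E_n$ converges in distribution to a random variable $X^{(\lambda)}$ whose distribution is given by $$\mathbf P(X^{(\lambda)}=0)=1-\mathbf P(X^{(\lambda)}=1)=\mathbf E\Big(\operatorname*{argmax}_{s\in[0,1]}B_s^{(\lambda)}\Big),$$ where $B_s^{(\lambda)}$ is a Brownian motion with drift $\lambda$.
   Context: Two types: $\Omega_n^{(2)}=\{0,2\}^n$. The map $Z^{(2)}:\Omega_n^{(2)}\to\Omega_n^{(2)}$ simultaneously replaces every occurrence of two consecutive letters $02$ by $20$ (such occurrences never overlap). $T_n^{(2)}(\eta)=\min\{k\ge0:(Z^{(2)})^k(\eta)=(Z^{(2)})^{k+1}(\eta)\}$. Three types: $\Omega_n=\{0,1,2\}^n$. The map $Z:\Omega_n\to\Omega_n$ simultaneously swaps neighbouring pairs in increasing order ($01\to10$, $02\to20$, $12\to21$), where in a substring $012$ the pair $12$ has priority, i.e. $012\to021$. Formally: if $\omega_i=0,\omega_{i+1}=1,\omega_{i+2}=2$ for some $1\le i\le n-2$, then $(Z\omega)_i=0,(Z\omega)_{i+1}=2,(Z\omega)_{i+2}=1$; if $\omega_{i-1}\ge\omega_i<\omega_{i+1}\ge\omega_{i+2}$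 for some $1\le i\le n-1$ (inequalities involving the nonexistent $\omega_0$ or $\omega_{n+1}$ are considered satisfied), then $(Z\omega)_i=\omega_{i+1}$ and $(Z\omega)_{i+1}=\omega_i$; all other entries are unchanged. $T_n(\omega)=\min\{k\ge0:Z^k(\omega)=Z^{k+1}(\omega)\}$. Projection: $\Pi_1:\Omega_n\to\Omega_n^{(2)}$ acts letterwise by $0\mapsto0$, $1\mapsto0$, $2\mapsto2$. Bernoulli initial condition of parameter $p$ with a second class particle in uniform position: first sample $\omega'\in\{0,2\}^n$ with independent letters, each equal to $2$ with probability $p$ and to $0$ with probability $1-p$. Let $A(\omega')$ be the set of positions of $0$s in $\omega'$. Given $\omega'$, choose $U$ uniformly from $A(\omega')$ and change the letter at position $U$ into $1$ to obtain $\omega$. If $A(\omega')=\emptyset$, set $\omega_1=1$ (so $U=1$), keeping the other letters. Brownian motion with drift $\lambda$: $B_s^{(\lambda)}=W_s+\lambda s$ with $W$ a standard Brownian motion started at $0$; its maximizer over $[0,1]$ is almost surely unique. *)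

(* Defs.v *)
From HB Require Import structures.
From mathcomp Require Import all_boot all_order all_algebra.
From mathcomp Require Import all_classical all_reals all_analysis.

Set Implicit Arguments.
Unset Strict Implicit.
Unset Printing Implicit Defensive.

Import Order.TTheory GRing.Theory Num.Theory.
Import numFieldNormedType.Exports.

Local Open Scope classical_set_scope.

(* Words over {0,1,2}; position i of the mathematical text (counted from 1) is *)
(* index i - 1 here.                                                           *)
Definition word3 (n : nat) := (n.-tuple 'I_3)%type.

(* Words over {0,2}: [true] encodes the letter 2 and [false] the letter 0. *)
Definition word2 (n : nat) := (n.-tuple bool)%type.

Definition let3 (n : nat) (w : word3 n) (i : nat) : 'I_3 := nth ord0 w i.

Definition let2 (n : nat) (w : word2 n) (i : nat) : bool := nth false w i.

Definition pair02 (n : nat) (w : word2 n) (i : nat) : bool :=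
  [&& i.+1 < n, ~~ let2 w i & let2 w i.+1].

Definition Z2 (n : nat) (w : word2 n) : word2 n :=
  [tuple if pair02 w i then true
         else if (0 < i) && pair02 w i.-1 then false
         else let2 w i | i < n].

Definition triple012 (n : nat) (w : word3 n) (i : nat) : bool :=
  [&& i.+2 < n, let3 w i == 0 :> nat, let3 w i.+1 == 1 :> nat
    & let3 w i.+2 == 2 :> nat].

(* The inequalities involving a position outside the word count as true. *)
Definition swap_at (n : nat) (w : word3 n) (i : nat) : bool :=
  [&& i.+1 < n,
      (i == 0) || (let3 w i <= let3 w i.-1),
      let3 w i < let3 w i.+1
    & (n <= i.+2) || (let3 w i.+2 <= let3 w i.+1)].

Definition Z3 (n : nat) (w : word3 n) : word3 n :=
  [tuple if triple012 w i then inord 0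
         else if (0 < i) && triple012 w i.-1 then inord 2
         else if (1 < i) && triple012 w i.-2 then inord 1
         else if swap_at w i then let3 w i.+1
         else if (0 < i) && swap_at w i.-1 then let3 w i.-1
         else let3 w i | i < n].

Definition Pi1 (n : nat) (w : word3 n) : word2 n :=
  [tuple (tnth w i == 2 :> nat) | i < n].

(* Termination of both dynamics, by the weight counting each letter once for  *)
(* every position at or to the right of its own.                              *)

Lemma iter_stabilizes (T : eqType) (f : T -> T) (phi : T -> nat) (M : nat) :
  (forall x, phi x <= M) -> (forall x, f x != x -> phi x < phi (f x)) ->
  forall x, exists k, iter k f x == iter k.+1 f x.
Proof.
move=> phiM phif x; have [m] := ubnP (M - phi x).
elim: m x => // m IHm x; rewrite ltnS => le_m.
have [fx|fx] := eqVneq (f x) x; first by exists 0; rewrite /= fx.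
have [|k Hk] := IHm (f x).
  apply: leq_trans le_m; have := phif _ fx; have := phiM (f x) => h1 h2.
  by rewrite ltn_sub2l // (leq_trans h2).
by exists k.+1; rewrite iterSr (iterSr k.+1).
Qed.

Lemma flux_weight (n : nat) (a b g : nat -> nat) :
  (forall j, j < n -> b j + (if j is i.+1 then g i else 0) = a j + g j) ->
  (exists2 j, j < n & b j != a j) ->
  \sum_(k < n) \sum_(j < k.+1) a j < \sum_(k < n) \sum_(j < k.+1) b j.
Proof.
move=> flux [j0 j0n bj0].
have partial k : k < n -> \sum_(j < k.+1) b j = \sum_(j < k.+1) a j + g k.
  elim: k => [|k IHk] kn.
    by have := flux 0 kn; rewrite !big_ord1 addn0.
  rewrite big_ord_recr /= IHk ?(ltnW kn) // [in RHS]big_ord_recr /=.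
  by rewrite -!addnA; congr addn; rewrite addnC; exact: (flux k.+1).
rewrite [X in _ < X](eq_bigr (fun k : 'I_n => \sum_(j < k.+1) a j + g k));
  last by move=> k _; rewrite partial.
rewrite big_split /= -[X in X < _]addn0 ltn_add2l lt0n; apply: contra bj0.
rewrite sum_nat_eq0 => /forallP g0.
have {}g0 k : k < n -> g k = 0 by move=> kn; exact/eqP/(g0 (Ordinal kn)).
apply/eqP; have := flux _ j0n; rewrite g0 // addn0.
by case: (j0) j0n => [|i] ?; rewrite ?addn0 // g0 ?addn0 // ltnW.
Qed.

Lemma letter_bound (n m : nat) (a : nat -> nat) : (forall j, a j <= m) ->
  \sum_(k < n) \sum_(j < k.+1) a j <= \sum_(k < n) \sum_(j < k.+1) m.
Proof. by move=> am; do 2 apply: leq_sum => ? _. Qed.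

Lemma let2_Z2 (n : nat) (w : word2 n) (i : nat) : i < n ->
  let2 (Z2 w) i = if pair02 w i then true
         else if (0 < i) && pair02 w i.-1 then false else let2 w i.
Proof. by move=> lin; rewrite /let2 (nth_mktuple _ _ (Ordinal lin)). Qed.

Lemma let3_Z3 (n : nat) (w : word3 n) (i : nat) : i < n ->
  let3 (Z3 w) i = if triple012 w i then inord 0
         else if (0 < i) && triple012 w i.-1 then inord 2
         else if (1 < i) && triple012 w i.-2 then inord 1
         else if swap_at w i then let3 w i.+1
         else if (0 < i) && swap_at w i.-1 then let3 w i.-1
         else let3 w i.
Proof. by move=> lin; rewrite /let3 (nth_mktuple _ _ (Ordinal lin)). Qed.

Lemma Z2_stabilizes (n : nat) (w : word2 n) :
  exists k, iter k (@Z2 n) w == iter k.+1 (@Z2 n) w.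
Proof.
apply: (@iter_stabilizes _ _
  (fun v => \sum_(k < n) \sum_(j < k.+1) let2 v j) _ _ _ w) => [v|v Zv].
  by apply: (@letter_bound _ 1 (let2 v)) => j; case: (let2 v j).
apply: (@flux_weight _ (let2 v) (let2 (Z2 v)) (pair02 v)) => [j jn|].
  rewrite let2_Z2 //; case: j jn => [|j] jn /=; rewrite /pair02 ?jn /=.
    by case: (let2 v 0); case: (1 < n); case: (let2 v 1).
  by case: (let2 v j); case: (let2 v j.+1); case: (let2 v j.+2);
    case: (j.+2 < n).
move/eqP: Zv => Zv; apply/not_exists2P => same; apply: Zv.
apply: val_inj; apply: (@eq_from_nth _ false); rewrite ?size_tuple // => j jn.
case: (same j) => //; rewrite -/(let2 (Z2 v) j) -/(let2 v j).
by move/negP; rewrite negbK; case: (let2 _ _); case: (let2 _ _).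
Qed.

Lemma Z3_stabilizes (n : nat) (w : word3 n) :
  exists k, iter k (@Z3 n) w == iter k.+1 (@Z3 n) w.
Proof.
apply: (@iter_stabilizes _ _
  (fun v => \sum_(k < n) \sum_(j < k.+1) let3 v j) _ _ _ w) => [v|v Zv].
  by apply: (@letter_bound _ 2 (let3 v)) => j; rewrite -ltnS ltn_ord.
pose act i := swap_at v i || (0 < i) && triple012 v i.-1.
apply: (@flux_weight _ (let3 v) (let3 (Z3 v))
  (fun i => if act i then let3 v i.+1 - let3 v i else 0)) => [j jn|].
  rewrite let3_Z3 // !(fun_if (@nat_of_ord 3)) !inordK // /act.
  have bd i : let3 v i < 3 by exact: ltn_ord.
  have b32 : j.+2 < n -> j.+1 < n by exact: ltnW.
  case: j jn b32 => [|[|j]] jn b32 /=; rewrite /swap_at /triple012 /=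
    ?(leqNgt n) ?jn ?(ltnW jn) /=.
  - move: (bd 0) (bd 1) (bd 2) b32.
    case: (val (let3 v 0)) => [|[|[|?]]] // _;
    case: (val (let3 v 1)) => [|[|[|?]]] // _;
    case: (val (let3 v 2)) => [|[|[|?]]] // _;
    by case: (1 < n); case: (2 < n) => // /(_ isT).
  - move: (bd 0) (bd 1) (bd 2) (bd 3) b32.
    case: (val (let3 v 0)) => [|[|[|?]]] // _;
    case: (val (let3 v 1)) => [|[|[|?]]] // _;
    case: (val (let3 v 2)) => [|[|[|?]]] // _;
    case: (val (let3 v 3)) => [|[|[|?]]] // _;
    by case: (2 < n); case: (3 < n) => // /(_ isT).
  - move: (bd j) (bd j.+1) (bd j.+2) (bd j.+3) (bd j.+4) b32.
    case: (val (let3 v j)) => [|[|[|?]]] // _;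
    case: (val (let3 v j.+1)) => [|[|[|?]]] // _;
    case: (val (let3 v j.+2)) => [|[|[|?]]] // _;
    case: (val (let3 v j.+3)) => [|[|[|?]]] // _;
    case: (val (let3 v j.+4)) => [|[|[|?]]] // _;
    by case: (j.+3 < n); case: (j.+4 < n) => // /(_ isT).
move/eqP: Zv => Zv; apply/not_exists2P => same; apply: Zv.
apply: val_inj; apply: (@eq_from_nth _ ord0); rewrite ?size_tuple // => j jn.
case: (same j) => //; rewrite -/(let3 (Z3 v) j) -/(let3 v j).
by move/negP; rewrite negbK => /eqP/val_inj.
Qed.

Definition T2 (n : nat) (w : word2 n) : nat := ex_minn (Z2_stabilizes w).

Definition T3 (n : nat) (w : word3 n) : nat := ex_minn (Z3_stabilizes w).

Local Open Scope ring_scope.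

Definition excess (R : realType) (n : nat) (w : word3 n) : R :=
  (T3 w)%:R - (T2 (Pi1 w))%:R.

Definition zeros (n : nat) (w' : word2 n) : {set 'I_n} :=
  [set i | ~~ tnth w' i]%SET.

(* Conditional law of U given w'. *)
Definition position_pmf (R : realType) (n : nat) (w' : word2 n) (u : 'I_n) : R :=
  if zeros w' == finset.set0 then (u == 0%N :> nat)%:R
  else (u \in zeros w')%:R / #|zeros w'|%:R.

Definition put1 (n : nat) (w' : word2 n) (u : 'I_n) : word3 n :=
  [tuple if i == u then inord 1 else if tnth w' i then inord 2 else inord 0
    | i < n].

Definition initial_pmf (R : realType) (n : nat) (p : R) (w : word3 n) : R :=
  \sum_(w' : word2 n) \sum_(u < n | put1 w' u == w)
    (\prod_(i < n) bernoulli_pmf p (tnth w' i)) * position_pmf R w' u.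

Definition bernoulli_initial (R : realType) (n : nat) (p : R) d
    (T : measurableType d) (P : probability T R) (omega : T -> word3 n) : Prop :=
  forall w : word3 n, measurable (omega @^-1` [set w]) /\
    P (omega @^-1` [set w]) = (initial_pmf p w)%:E.

(* Pointwise convergence of the distribution functions at the continuity       *)
(* points of the limit; the n-th variable lives on its own probability space.  *)
Definition cvg_in_distribution (R : realType) (d_ : nat -> measure_display)
    (T_ : forall n, measurableType (d_ n)) (P_ : forall n, probability (T_ n) R)
    (X_ : forall n, T_ n -> R)
    d (T : measurableType d) (P : probability T R) (X : {RV P >-> R}) : Prop :=
  forall x : R, {for x, continuous (cdf X)} ->
    P_ n [set t | X_ n t <= x] @[n --> \oo] --> cdf X x.

(* Taking A i = setT for some of the i gives the product rule for subfamilies. *)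
Definition mutually_independent (R : realType) d (T : measurableType d)
    (P : probability T R) (k : nat) (X : 'I_k -> T -> R) : Prop :=
  forall A : 'I_k -> set R, (forall i, measurable (A i)) ->
    P (\bigcap_i (X i @^-1` A i)) = (\prod_i fine (P (X i @^-1` A i)))%:E.

(* The time set is [0, +oo[; nothing is required of W at negative times. *)
Record standard_brownian (R : realType) d (T : measurableType d)
    (P : probability T R) (W : R -> T -> R) : Prop := StandardBrownian {
  brownian_measurable : forall s, 0 <= s -> measurable_fun [set: T] (W s) ;
  brownian_start : forall t, W 0 t = 0 ;
  brownian_continuous : forall t,
    {within `[0, +oo[, continuous (fun s => W s t)} ;
  brownian_gaussian : forall r s, 0 <= r -> r < s ->
    forall A : set R, measurable A ->
    P ((fun t => W s t - W r t) @^-1` A) = normal_prob 0 (Num.sqrt (s - r)) A ;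
  brownian_independent : forall (k : nat) (s : nat -> R),
    0 <= s 0%N -> (forall i, s i <= s i.+1) ->
    mutually_independent P (fun (i : 'I_k) t => W (s i.+1) t - W (s i) t) }.

Definition with_drift (R : realType) (T : Type) (lambda : R) (W : R -> T -> R)
    (s : R) (t : T) : R := W s t + lambda * s.

(* Leftmost maximizer over [0, 1], which exists when f is continuous there.  *)
Definition argmax01 (R : realType) (f : R -> R) : R :=
  inf [set s | 0 <= s <= 1 /\ forall u, 0 <= u <= 1 -> f u <= f s].

(* Main.v *)
(* Let S be the walk that goes up at each 0 and down at each 2.  If the second *)
(* class particle starts to the right of the first maximum of S, it delays     *)
(* termination by exactly one step.  If it starts to the left of the first     *)
(* place where S is within K of its maximum, a pair of neighbouring zeros met  *)
(* at one of the last K records (which exists unless the word is exceptional)  *)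
(* travels left until it meets the particle, after which there is no delay.    *)
(* The particle being uniform among about n/2 zeros spread evenly, no delay    *)
(* has probability E(argmax S)/n + o(1).  Summing over the cyclic rotations of *)
(* the word gives E(argmax S) = sum_k P(S_k > 0), and P(S_k > 0) is close to   *)
(* Phi(lambda sqrt(k/n)): the binomial tail is a beta integral in p whose      *)
(* rescaled integrand tends to the normal density.                             *)
(* The increments of Brownian motion with drift over a mesh 1/n are            *)
(* exchangeable, so its maximizer on the mesh satisfies the same identity, now *)
(* with P(B_(k/n) > 0) = Phi(lambda sqrt(k/n)) exactly.  Refining the mesh,    *)
(* a maximizer can only jump between places of equal height; comparing with    *)
(* the drifts lambda +- delta bounds this from both sides without knowing that *)
(* the maximizer is unique, and the mesh averages are Lipschitz in the drift.  *)
Require Import Defs.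
From HB Require Import structures.
From mathcomp Require Import all_boot all_order all_algebra all_fingroup.
From mathcomp Require Import all_classical all_reals all_analysis measurable_realfun.
From mathcomp Require Import zify ring lra.
Set Implicit Arguments.
Unset Strict Implicit.
Unset Printing Implicit Defensive.
Import Order.TTheory GRing.Theory Num.Theory.
Import numFieldNormedType.Exports.

(** * One step of the dynamics *)

(** Deterministic part. With the 1 read as a 0, a step of [Z3] acts on the projected word as [Z2]
    and moves the 1 by [hop] ([marked_Z3]), so the excess depends only on how one marked zero moves
    inside the two type dynamics. For the walk [height], up at zeros and down at 2s, a step lowers
    each peak by two. If a highest point lies left of the 1, this persists until the word is
    2...2010...0, whose projection is at rest while the 1 has one hop left ([T3_delayed]). If two
    adjacent zeros, at or right of the 1, sit at a record with a 2 still to come, the pair travels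
    left at speed one until only 2s precede the 1, and from then on both dynamics stop together
    ([T3_frontmost_overtaken]).

    Random part. The 1 is uniform among the zeros, and about j/2 of the roughly n/2 zeros precede
    position j. Hence P(E = 0) is at least, up to o(1), the mean of the first place within K of the
    maximum divided by n ([position_prob_excess0]), and P(E <> 1) is at most the mean of the argmax
    divided by n ([position_prob_excess1]). Summing over cyclic rotations ([rotation_argmax]) turns
    the mean of the argmax into the sum of P(S_k > 0), and bounds the other mean below by the sum of
    P(S_k > K). As a function of p the binomial tail is an incomplete beta integral, and dominated
    convergence for its rescaled integrand gives Phi(lambda sqrt(k/n)) uniformly
    ([mean_total_normal]). So both probabilities have the limit of [normal_average]
    ([outcome_prob_cvg]), and all mass ends up on 0 and 1.

    Brownian part. The increments over a mesh are exchangeable, so the rotation identity holds for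
    them too, and the mean of the mesh argmax is exactly [normal_average]
    ([integral_sampled_argmax]). Comparing the mesh argmax for one drift with the true argmax for a
    nearby drift bounds the limit from both sides ([grid_argmax_limit]), and the Lipschitz
    dependence of [normal_average] on the drift closes the gap ([normal_average_cvg]). *)

Section FixTime.
Variables (T : eqType) (f : T -> T).
Hypothesis stab : forall x, exists k, iter k f x == iter k.+1 f x.

Lemma ex_minn_fixed (x : T) : f x = x -> ex_minn (stab x) = 0.
Proof.
by move=> fx; case: ex_minnP => m _ /(_ 0); rewrite /= fx eqxx leqn0 => /(_ isT)/eqP.
Qed.

Lemma ex_minn_step (x : T) : f x != x -> ex_minn (stab x) = (ex_minn (stab (f x))).+1.
Proof.
move=> fx; case: ex_minnP => m Hm mmin; case: ex_minnP => k Hk kmin.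
apply/eqP; rewrite eqn_leq mmin ?andbT; last by rewrite (iterSr k.+1) iterSr.
case: m Hm mmin => [|m] Hm mmin; first by move: Hm fx; rewrite /= eq_sym => ->.
by rewrite ltnS kmin //; move: Hm; rewrite iterSr (iterSr m.+1).
Qed.

End FixTime.

Section T2T3.
Variable n : nat.

Lemma T2_fixed (w : word2 n) : Z2 w = w -> T2 w = 0.
Proof. exact: ex_minn_fixed. Qed.

Lemma T2_step (w : word2 n) : Z2 w != w -> T2 w = (T2 (Z2 w)).+1.
Proof. exact: ex_minn_step. Qed.

Lemma T3_fixed (w : word3 n) : Z3 w = w -> T3 w = 0.
Proof. exact: ex_minn_fixed. Qed.

Lemma T3_step (w : word3 n) : Z3 w != w -> T3 w = (T3 (Z3 w)).+1.
Proof. exact: ex_minn_step. Qed.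

End T2T3.

(** [Z2] on infinite sequences: a word is continued by zeros on the right, where nothing can ever
    jump in, so no right boundary condition is left. *)
Definition sweep (v : nat -> bool) (i : nat) : bool :=
  (~~ v i && v i.+1) || (v i && ((i == 0) || v i.-1)).

(** New position of a 1 that stands at [u], where [v] has a zero. The test to the right comes first:
    this is the priority of 12 in 012. *)
Definition hop (v : nat -> bool) (u : nat) : nat :=
  if v u.+1 then u.+1 else if (0 < u) && ~~ v u.-1 then u.-1 else u.

Lemma let2_ge (n : nat) (w : word2 n) (i : nat) : n <= i -> let2 w i = false.
Proof. by move=> ni; rewrite /let2 nth_default // size_tuple. Qed.

Lemma let3_ge (n : nat) (w : word3 n) (i : nat) : n <= i -> let3 w i = ord0.
Proof. by move=> ni; rewrite /let3 nth_default // size_tuple. Qed.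

Lemma let2_sweep (n : nat) (w : word2 n) : let2 (Z2 w) =1 sweep (let2 w).
Proof.
move=> i; rewrite /sweep; have [ni|lin] := leqP n i.
  by rewrite !(let2_ge _ ni) (let2_ge w (leqW ni)).
rewrite let2_Z2 // /pair02; have [ni|lin1] := leqP n i.+1.
  rewrite (let2_ge _ ni); case: i lin ni => [|i] lin ni //=; first by case: let2.
  by rewrite lin; case: (let2 w i); case: (let2 w i.+1).
case: i lin lin1 => [|i] lin lin1 /=; first by case: (let2 w 0); case: (let2 w 1).
by rewrite lin; case: (let2 w i); case: (let2 w i.+1); case: (let2 w i.+2).
Qed.

Lemma let2_inj (n : nat) (w1 w2 : word2 n) : let2 w1 =1 let2 w2 -> w1 = w2.
Proof.
move=> E; apply: val_inj; apply: (@eq_from_nth _ false); rewrite ?size_tuple // => i _.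
exact: E.
Qed.

Lemma let3_inj (n : nat) (w1 w2 : word3 n) :
  (forall i, let3 w1 i = let3 w2 i :> nat) -> w1 = w2.
Proof.
move=> E; apply: val_inj; apply: (@eq_from_nth _ ord0); rewrite ?size_tuple // => i _.
exact/val_inj/E.
Qed.

Lemma let2_Pi1 (n : nat) (w : word3 n) (i : nat) : let2 (Pi1 w) i = (let3 w i == 2 :> nat).
Proof.
have [ni|lin] := leqP n i; first by rewrite let2_ge // let3_ge.
by rewrite /let2 (nth_mktuple _ _ (Ordinal lin)) (tnth_nth ord0).
Qed.

Ltac nateqs := repeat match goal with
  | |- context [@eq_op ?T ?a ?b] =>
     first [ rewrite (_ : @eq_op T a b = true); [|by apply/eqP; lia]
           | rewrite (_ : @eq_op T a b = false); [|by apply/negP => /eqP; lia]]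
  | |- context [leq ?a ?b] =>
     first [ rewrite (_ : leq a b = true); [|by lia]
           | rewrite (_ : leq a b = false); [|by lia]]
  end.
Ltac letters v := repeat match goal with |- context [v ?i] => case: (v i) => /= end.

(* The word [w] has exactly one letter 1, at position [u], and its letters 2 are given by [v]. *)
Definition marked (n : nat) (w : word3 n) (v : nat -> bool) (u : nat) : Prop :=
  [/\ u < n, v u = false &
   forall i, let3 w i = (if i == u then 1 else if v i then 2 else 0) :> nat].

Lemma marked_Pi1 (n : nat) (w : word3 n) (v : nat -> bool) (u : nat) :
  marked w v u -> let2 (Pi1 w) =1 v.
Proof.
by case=> _ vu E i; rewrite let2_Pi1 E; case: (i =P u) => [->|_]; rewrite ?vu /=; case: (v i).
Qed.

Lemma marked_Z3 (n : nat) (w : word3 n) (v : nat -> bool) (u : nat) :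
  marked w v u -> marked (Z3 w) (sweep v) (hop v u).
Proof.
move=> [un vu E].
have vn i : n <= i -> v i = false.
  move=> ni; have := E i; rewrite let3_ge //.
  by case: eqP => [->|_] //; case: (v i).
split.
- rewrite /hop; case: ifP => [vu1|_]; last by case: ifP => // _; apply: leq_ltn_trans un; exact: leq_pred.
  by rewrite ltnNge; apply/negP => /vn; rewrite vu1.
- rewrite /hop /sweep; case: (boolP (v u.+1)) => [vu1|vu1] /=; first by rewrite vu vu1.
  case: u un vu vu1 E => [|u] un vu vu1 E /=; first by rewrite vu (negPf vu1).
  by case: (boolP (v u)) => /= vu'; rewrite ?vu ?vu' ?(negPf vu1) // ?(negPf vu').
have vE i : n <= i -> let3 w i = 0 :> nat by move=> ni; rewrite let3_ge.
have tri i : triple012 w i = [&& u == i.+1, ~~ v i & v i.+2].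
  rewrite /triple012 !E; have [ui|ne] := eqVneq u i.+1; last first.
    by case: (v i.+1); rewrite /= ?andbF.
  rewrite ui; nateqs; have [ni|lin] := leqP n i.+2; first by rewrite (vn _ ni) ?andbF.
  by letters v.
(* The letters past the end are 0, so the conditions at the right boundary follow from the
   inequalities themselves. *)
have sw i : swap_at w i = [&& (i == 0) || (let3 w i <= let3 w i.-1),
    let3 w i < let3 w i.+1 & let3 w i.+2 <= let3 w i.+1].
  rewrite /swap_at; have [ni|_] := leqP n i.+1; first by rewrite (vE _ ni) ltn0 !andbF.
  by have [ni|//] := leqP n i.+2; rewrite (vE _ ni) /=.
move=> i; have [ni|lin] := leqP n i.
  rewrite let3_ge // /sweep (vn _ ni) (vn _ (leqW ni)) /=.
  case: eqP => // iu; move: ni un; rewrite iu /hop; case: ifP => [vu1|_].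
    by rewrite ltnNge => ? _; move: vu1; rewrite vn.
  by case: ifP; lia.
rewrite let3_Z3 // !tri !sw !(fun_if (@nat_of_ord 3)) !inordK // !E /sweep /hop.
have F j k : j != k -> (j == k) = false by move/negPf.
case: i lin => [|[|i]] lin /=.
- case: (ltnP u 3) => [|u3]; last first.
    by nateqs; letters v; nateqs.
  by case: u un vu E {tri sw} => [|[|[|u]]] //= un vu E _; rewrite ?vu /=; letters v.
- case: (ltnP u 4) => [|u3]; last first.
    by nateqs; letters v; nateqs.
  by case: u un vu E {tri sw} => [|[|[|[|u]]]] //= un vu E _; rewrite ?vu /=; letters v.
(* The position looked at is [i.+2]; a step reads letters at distance at most two, so a 1 outside
   this window has no influence. *)
have [/andP[]|far] := boolP ((i <= u) && (u <= i.+4)); last first.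
  case: u un vu E {tri sw} far => [|u] un vu E far /=; nateqs; letters v; nateqs => //.
move=> iu ui4; have [ui|ui] := eqVneq u i.
  subst u; rewrite vu /= (_ : (i.+2 == if _ then _ else _) = false); last first.
    by case: ifP => _; [|case: ifP => _]; lia.
  by nateqs; letters v; nateqs.
have [|[|[|]]] : u = i.+1 \/ u = i.+2 \/ u = i.+3 \/ u = i.+4 by lia.
- by move=> ?; subst u; rewrite vu /=; nateqs; letters v; nateqs.
- by move=> ?; subst u; rewrite vu /=; nateqs; letters v; nateqs.
- by move=> ?; subst u; rewrite vu /=; nateqs; letters v; nateqs.
- by move=> ?; subst u; rewrite vu /=; nateqs; letters v; nateqs.
Qed.

(** * When the second class particle delays termination *)

Fixpoint height (v : nat -> bool) (j : nat) : int :=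
  if j is i.+1 then (height v i + (if v i then -1 else 1))%R else 0%R.

Lemma height_sweep (v : nat -> bool) (j : nat) :
  (height (sweep v) j =
   height v j - (if [&& (0 < j)%N, ~~ v j.-1 & v j] then 2 else 0))%R.
Proof.
elim: j => [|j IHj] //=; rewrite IHj /sweep.
by case: j {IHj} => [|j] /=; letters v; lia.
Qed.

(** Excludes the initial block of 2s: it never moves again, and the heights along it would spoil the
    comparison of maxima. *)
Definition live (v : nat -> bool) (j : nat) : Prop := exists2 i, i < j & ~~ v i.

Lemma liveW (v : nat -> bool) (i j : nat) : i <= j -> live v i -> live v j.
Proof. by move=> ij [k ki vk]; exists k => //; exact: leq_trans ij. Qed.

Lemma liveS (v : nat -> bool) (j : nat) : live v j.+1 -> live v j \/ ~~ v j /\ (forall i, i < j -> v i).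
Proof.
move=> [i]; rewrite ltnS leq_eqVlt => /predU1P[-> vj|ij vi]; last by left; exists i.
case: (boolP [forall i : 'I_j, v i]) => [/forallP H|].
  by right; split => // k kj; exact: (H (Ordinal kj)).
by rewrite negb_forall => /existsP[k vk]; left; exists k.
Qed.

Lemma live_sweep_pred (v : nat -> bool) (j : nat) :
  live v j -> ~~ v j -> live (sweep v) j.
Proof.
move=> [i ij vi] vj; have [vi1|vi1] := boolP (v i.+1).
  exists i.+1; last by rewrite /sweep vi1 /= (negPf vi).
  by rewrite ltn_neqAle ij andbT; apply: contraNneq vj => <-.
by exists i => //; rewrite /sweep (negPf vi) (negPf vi1).
Qed.

Lemma live_sweep (v : nat -> bool) (j : nat) : live (sweep v) j -> live v j.
Proof.
move=> [i ij]; rewrite /sweep; case: (boolP (v i)) => vi /=; last by exists i.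
by rewrite negb_or => /andP[i0 vi1]; exists i.-1 => //; apply: leq_ltn_trans ij; exact: leq_pred.
Qed.

Lemma sweep_fixed (v : nat -> bool) (i x : nat) :
  sweep v =1 v -> ~~ v i -> i <= x -> ~~ v x.
Proof.
move=> fx vi; elim: x => [|x IHx]; first by rewrite leqn0 => /eqP <-.
rewrite leq_eqVlt => /predU1P[<- //|/IHx vx].
by have := fx x; rewrite /sweep (negPf vx) /= orbF => ->.
Qed.

Definition frontmost (v : nat -> bool) (u : nat) : Prop := forall i, i < u -> v i.

Lemma frontmost_sweep (v : nat -> bool) (u : nat) : frontmost v u -> frontmost (sweep v) u.
Proof.
move=> Fu i iu; rewrite /sweep Fu //=; case: i iu => //= i iu.
by rewrite Fu // ltnW.
Qed.

Lemma frontmost_step (v : nat -> bool) (u : nat) : v u = false ->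
  frontmost v u -> frontmost (sweep v) (hop v u).
Proof.
move=> vu Fu; have Fs := frontmost_sweep Fu.
rewrite /hop; case: ifP => vu1.
  by move=> i; rewrite ltnS leq_eqVlt => /predU1P[->|/Fs //]; rewrite /sweep vu vu1.
by case: ifP => // /andP[u0]; rewrite Fu // prednK.
Qed.

(* Two consecutive zeros right of the second class particle, entered at a weak record of the   *)
(* height and still to be crossed by some 2: this gap moves left at speed one, catching up    *)
(* with the particle and driving it down to the leftmost hole.                                  *)
Definition overtaken (v : nat -> bool) (u : nat) : Prop :=
  exists q x, [/\ u <= q < x, ~~ v q && ~~ v q.+1, v x, live v q &
    forall i, i <= q -> live v i -> (height v i <= height v q)%R].

(** The record condition forces a third zero just left of the pair, so the pair reappears one place
    to the left. The 1 either already is in the pair and moves with it, or lies left of it and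
    cannot get past it. The process ends when only 2s remain to the left. *)
Lemma overtaken_step (v : nat -> bool) (u : nat) : v u = false -> overtaken v u ->
  overtaken (sweep v) (hop v u) \/ frontmost (sweep v) (hop v u).
Proof.
move=> vu [q [x [/andP[uq qx] /andP[vq vq1] vx lq hq]]].
case: q lq uq qx vq vq1 hq => [[] //|q] lq uq qx vq vq1 hq.
(* A 2 here would make the preceding live point higher than the record. *)
have vq0 : ~~ v q.
  apply/negP => vq0; case: (liveS lq) => [lq0|[]]; last by rewrite vq0.
  by have := hq q (leqnSn q) lq0; rewrite /= vq0; lia.
have x3 : q.+3 <= x.
  rewrite leq_eqVlt in qx; case/predU1P: qx => [xe|//].
  by move: vx; rewrite -xe (negPf vq1).
have hopq : hop v u <= q.
  move: uq; rewrite leq_eqVlt => /predU1P[->|].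
    by rewrite /hop (negPf vq1) /= vq0.
  rewrite ltnS leq_eqVlt => /predU1P[->|uq]; first by rewrite /hop (negPf vq); case: ifP; lia.
  by rewrite /hop; case: ifP => // _; case: ifP; lia.
case: (liveS lq) => [lq0|[_ all2]]; last first.
  by right=> i ihop; apply: (frontmost_sweep all2); exact: leq_trans hopq.
left; exists q, (if v x.-1 then x else x.-1); split.
- by rewrite hopq; case: ifP; lia.
- by rewrite /sweep (negPf vq0) (negPf vq) (negPf vq1).
- case: x vx qx x3 => [//|x] vx qx x3 /=; case: ifP => vx0; rewrite /sweep /= ?vx ?vx0 //.
- exact: live_sweep_pred.
(* The new record level is one below the old one. A live point that was at the old level is a peak,
   since its successor is not higher, so the step lowers it by two. *)
move=> i iq /live_sweep li.
have hi : (height v i <= height v q.+1)%R by apply: hq => //; apply: leqW.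
have hi1 : i < q -> (height v i.+1 <= height v q.+1)%R.
  by move=> iq'; apply: hq; [lia|exact: liveW li].
rewrite !height_sweep (negPf vq0) !andbF /= in hi hi1 *.
case: (ltngtP i q) iq => // [iq _|-> _]; last by rewrite (negPf vq0) !andbF; lia.
have := hi1 iq; case: i li iq hi {hi1} => [[] //|i] li iq /=.
have {}vi : v i -> (height v i <= height v q.+1)%R.
  by move=> vi; apply: hq; [lia|]; case: (liveS li) => // -[]; rewrite vi.
by move: vi; rewrite /= (negPf vq0); case: (v i) => /= [/(_ isT)|_]; case: (v i.+1) => /=; lia.
Qed.

(* A highest point left of the second class particle, the maximum being taken over the places *)
(* that a 2 or the particle has still to cross.                                                *)
Definition delayed (v : nat -> bool) (u : nat) : Prop :=
  exists j, [/\ j < u, live v j &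
    forall i, live v i -> i <= u \/ (exists2 x, i <= x & v x) ->
      (height v i <= height v j)%R].

(* The word 2...2010...0 *)
Definition last_hop (v : nat -> bool) (u : nat) : Prop :=
  exists f, [/\ u = f.+1, frontmost v f & forall x, f <= x -> ~~ v x].

(** The maximum over the live points still to be crossed drops by at least one, and the witnessing
    peak is replaced by its left neighbour. When only 2s precede that peak, its right neighbour is
    taken instead, unless the 1 has just arrived there; in that case no 2 remains on the right. *)
Lemma delayed_step (v : nat -> bool) (u : nat) : v u = false -> delayed v u ->
  delayed (sweep v) (hop v u) \/ last_hop (sweep v) (hop v u).
Proof.
move=> vu [[|j] [ju lj hj]]; first by case: lj.
have vj : ~~ v j.
  apply/negP => vj; case: (liveS lj) => [lj0|[]]; last by rewrite vj.
  have := hj j lj0 (or_introl (ltnW (ltnW ju))); rewrite /= vj; lia.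
have vj1 : v j.+1.
  apply/negP => /negP vj1; have := hj j.+2 (liveW (leqnSn _) lj) (or_introl ju).
  by rewrite /= (negPf vj1); lia.
have uj : j.+1 < u by [].
have hop_ge : u.-1 <= hop v u by rewrite /hop; case: ifP => _; [|case: ifP]; lia.
have hop_le : hop v u <= u.+1 by rewrite /hop; case: ifP => _; [|case: ifP]; lia.
have hops : v u.+1 -> hop v u = u.+1 by rewrite /hop => ->.
(* The old maximum is one above [height v j]. A point reaching it must be entered by a zero and left
   by a 2, since its neighbours obey the same bound; such peaks fall by two. *)
have range i : live (sweep v) i -> i <= hop v u \/ (exists2 x, i <= x & sweep v x) ->
    (height (sweep v) i <= height v j)%R.
  move=> /live_sweep li ri.
  have ri' : i <= u \/ exists2 x, i <= x & v x.
    case: ri => [ih|[x ix]].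
      have [iu|ui] := leqP i u; [by left|right].
      by exists u.+1; [lia|move: ih ui; rewrite /hop; case: ifP => // _; case: ifP; lia].
    rewrite /sweep; case: (boolP (v x)) => vx /=; first by right; exists x.
    by rewrite orbF => vx1; right; exists x.+1 => //; apply: leqW.
  have hi : (height v i <= height v j.+1)%R by apply: hj.
  rewrite height_sweep; have [he|] := eqVneq (height v i) (height v j + 1)%R; last first.
    by move: hi; rewrite /= (negPf vj); case: ifP => _; lia.
  case: i li ri ri' he {hi} => [[] //|i] li ri ri' he.
  have vi : ~~ v i.
    apply/negP => vi; case: (liveS li) => [li0|[]]; last by rewrite vi.
    have /(hj _ li0) : i <= u \/ exists2 x, i <= x & v x.
      by case: ri' => [/ltnW|[x /ltnW ix vx]]; [left|right; exists x].
    by move: he; rewrite /= (negPf vj) vi; lia.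
  have vi1 : v i.+1.
    apply/negP => /negP vi1.
    have /(hj _ (liveW (leqnSn _) li)) : i.+2 <= u \/ exists2 x, i.+2 <= x & v x.
      case: ri => [ih|[x ix]]; last first.
        rewrite /sweep; case: (boolP (v x)) => vx /=.
          right; exists x => //; rewrite ltn_neqAle ix andbT.
          by apply: contraNneq vi1 => ->.
        by rewrite orbF => vx1; right; exists x.+1.
      have [vu1|vu1] := boolP (v u.+1).
        right; exists u.+1 => //; rewrite hops // in ih.
        by rewrite ltn_neqAle ih andbT; apply: contraNneq vi1 => ->.
      left; move: ih; rewrite /hop (negPf vu1); case: (ltngtP u i.+1) => // [ui|->].
      - by case: ifP; lia.
      - by rewrite /= vi; lia.
    by move: he; rewrite /= (negPf vi1) (negPf vj); lia.
  by rewrite he /= vi vi1 /=; lia.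
case: (liveS lj) => [lj0|[_ all2]].
  left; exists j; split; [by lia|exact: live_sweep_pred|].
  by move=> i li ri; rewrite [X in (_ <= X)%R]height_sweep (negPf vj) !andbF subr0 range.
have sj1 : ~~ sweep v j.+1 by rewrite /sweep vj1 /= (negPf vj).
have hop_ge2 : j.+2 <= hop v u.
  move: uj; rewrite leq_eqVlt => /predU1P[<-|]; last by lia.
  by rewrite /hop /= vj1; case: ifP.
move: hop_ge2; rewrite leq_eqVlt => /predU1P[hopj|jhop]; [right|left]; last first.
  exists j.+2; split=> //; first by exists j.+1.
  move=> i li ri; rewrite [X in (_ <= X)%R]height_sweep /= vj1 (negPf vj) /= subr0.
  by have := range i li ri; lia.
have vu1 : ~~ v u.+1 by apply/negP => /hops; lia.
(* A point higher than the maximum cannot be one that a 2 has still to cross. *)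
have nu x : j.+4 <= x -> (height v j.+4 > height v j.+1)%R -> ~~ v x.
  move=> jx; rewrite ltNge => hjj; apply: contra hjj => vx; apply: hj.
    by apply: liveW lj; lia.
  by right; exists x.
have [uj2|uj3] : u = j.+2 \/ u = j.+3 by lia.
  exists j.+1; split=> //.
    move=> i; rewrite ltnS leq_eqVlt => /predU1P[->|]; last exact: frontmost_sweep.
    by rewrite /sweep (negPf vj) vj1.
  have z2 : ~~ v j.+2 by rewrite -uj2 vu.
  have z3 : ~~ v j.+3 by rewrite -uj2.
  have z x : j.+2 <= x -> ~~ v x.
    rewrite leq_eqVlt => /predU1P[<- //|]; rewrite leq_eqVlt => /predU1P[<- //|].
    by move=> jx; apply: nu => //=; rewrite (negPf vj) vj1 (negPf z2) (negPf z3); lia.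
  move=> x; rewrite leq_eqVlt => /predU1P[<- //|jx].
  by rewrite /sweep (negPf (z _ jx)) (negPf (z _ (leqW jx))).
have z2 : ~~ v j.+2.
  apply/negP => vj2; move: hopj vu1; rewrite uj3 /hop /= vj2 => hopj vu1.
  by move: hopj; rewrite (negPf vu1) /=; lia.
have z3 : ~~ v j.+3 by rewrite -uj3 vu.
exists j.+1; split=> //.
  move=> i; rewrite ltnS leq_eqVlt => /predU1P[->|]; last exact: frontmost_sweep.
  by rewrite /sweep (negPf vj) vj1.
have z x : j.+2 <= x -> ~~ v x.
  rewrite leq_eqVlt => /predU1P[<- //|]; rewrite leq_eqVlt => /predU1P[<- //|].
  by move=> jx; apply: nu => //=; rewrite (negPf vj) vj1 (negPf z2) (negPf z3); lia.
move=> x; rewrite leq_eqVlt => /predU1P[<- //|jx].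
by rewrite /sweep (negPf (z _ jx)) (negPf (z _ (leqW jx))).
Qed.

Section Times.
Variable n : nat.
Implicit Types (w : word3 n) (v : nat -> bool) (u : nat).

Lemma marked_unique w1 w2 v u : marked w1 v u -> marked w2 v u -> w1 = w2.
Proof. by move=> [_ _ E1] [_ _ E2]; apply: let3_inj => i; rewrite E1 E2. Qed.

Lemma marked_ext w v v' u : v =1 v' -> marked w v u -> marked w v' u.
Proof. by move=> vv' [un vu E]; split=> // [|i]; rewrite -?vv'. Qed.

Lemma Pi1_Z3 w v u : marked w v u -> Pi1 (Z3 w) = Z2 (Pi1 w).
Proof.
move=> mw; apply: let2_inj => i; rewrite (marked_Pi1 (marked_Z3 mw)) let2_sweep.
by have E := marked_Pi1 mw; rewrite /sweep !E.
Qed.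

Lemma T_step w v u : marked w v u -> Z2 (Pi1 w) != Pi1 w ->
  T3 w = (T3 (Z3 w)).+1 /\ T2 (Pi1 w) = (T2 (Pi1 (Z3 w))).+1.
Proof.
move=> mw Zw; have Z3w : Z3 w != w.
  by apply: contraNneq Zw => Zw; rewrite -(Pi1_Z3 mw) Zw.
by rewrite (Pi1_Z3 mw) -T2_step // -T3_step.
Qed.

Lemma Z2_fixedP w v u : marked w v u -> reflect (sweep v =1 v) (Z2 (Pi1 w) == Pi1 w).
Proof.
move=> mw; have E := marked_Pi1 mw; apply: (iffP eqP) => [Zw i|vv].
  by rewrite -[RHS]E -[in RHS]Zw let2_sweep /sweep !E.
by apply: let2_inj => i; rewrite let2_sweep /sweep !E; exact: vv.
Qed.

(** Induction on [T2]. An overtaken word is not at rest under [Z2], so the projection can stop only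
    once the 1 is the leftmost hole; there the 1 is at rest as well. *)
Lemma T3_frontmost_overtaken w v u : marked w v u ->
  frontmost v u \/ overtaken v u -> T3 w = T2 (Pi1 w).
Proof.
have [m] := ubnP (T2 (Pi1 w)); elim: m w v u => // m IHm w v u ltm mw FD.
have vu : v u = false by case: mw.
have [Zw|Zw] := boolP (Z2 (Pi1 w) == Pi1 w); last first.
  have [T3S T2S] := T_step mw Zw; rewrite T3S T2S; congr S.
  apply: (IHm _ _ _ _ (marked_Z3 mw)); first by rewrite T2S in ltm.
  case: FD => [Fu|Du]; first by left; exact: frontmost_step.
  by have [] := overtaken_step vu Du; [right|left].
rewrite (T2_fixed (eqP Zw)); apply: T3_fixed; move/(Z2_fixedP mw): Zw => fv.
have Fu : frontmost v u.
  case: FD => // -[q [x [/andP[_ qx] /andP[vq _] vx _ _]]].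
  by have := sweep_fixed fv vq (ltnW qx); rewrite vx.
have hu : hop v u = u.
  rewrite /hop (negPf (sweep_fixed fv (negbT vu) (leqnSn u))).
  by case: u Fu {mw FD vu} => //= u Fu; rewrite Fu.
have := marked_Z3 mw; rewrite hu => /(marked_ext fv) /marked_unique; exact.
Qed.

(** A projection at rest continues with zeros after its first zero, so its walk keeps rising and
    cannot have a live maximum left of the 1. The induction therefore leaves [delayed] only through
    2...2010...0, which needs exactly one more step of [Z3]. *)
Lemma T3_delayed w v u : marked w v u -> delayed v u -> T3 w = (T2 (Pi1 w)).+1.
Proof.
have [m] := ubnP (T2 (Pi1 w)); elim: m w v u => // m IHm w v u ltm mw Nu.
have vu : v u = false by case: mw.
have [Zw|Zw] := boolP (Z2 (Pi1 w) == Pi1 w).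
  move/(Z2_fixedP mw): Zw => fv; case: Nu => j [ju lj hj].
  have vj : ~~ v j by case: (lj) => i ij vi; exact: (sweep_fixed fv vi (ltnW ij)).
  have := hj j.+1 (liveW (leqnSn _) lj) (or_introl ju).
  by rewrite /= (negPf vj); lia.
have [T3S T2S] := T_step mw Zw; rewrite T3S T2S; congr S.
have mw1 := marked_Z3 mw; have vu1 : sweep v (hop v u) = false by case: mw1.
case: (delayed_step vu Nu) => [Nu'|[f [uf Ff zf]]].
  by apply: (IHm _ _ _ _ mw1) => //; rewrite T2S in ltm.
have fv : sweep (sweep v) =1 sweep v.
  move=> i; rewrite [LHS]/sweep -!/(sweep v _) -/(sweep v).
  have [fi|iF] := leqP f i.
    by rewrite (negPf (zf _ fi)) (negPf (zf _ (leqW fi))).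
  by rewrite Ff //=; case: i iF => //= i iF; rewrite Ff // ltnW.
have hu : hop (sweep v) (hop v u) = f.
  by rewrite [LHS]/hop uf (negPf (zf f.+2 _)) ?zf //; lia.
have mw2 : marked (Z3 (Z3 w)) (sweep v) f.
  by have := marked_Z3 mw1; rewrite hu => /(marked_ext fv).
have Z3w : Z3 (Z3 w) != Z3 w.
  apply/eqP => Z3w; case: mw2 => _ _ /(_ f); case: mw1 => _ _ /(_ f).
  by rewrite Z3w eqxx uf => ->; rewrite (negPf (zf _ _)) //; case: eqP => //; lia.
rewrite T3_step // (@T3_frontmost_overtaken _ _ _ mw2); last by left.
rewrite (Pi1_Z3 mw1); congr S; apply/esym/eqP.
by move/(Z2_fixedP mw1): fv => /eqP ->.
Qed.

End Times.

(** * Near-maxima of walks and their rotations *)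

Local Open Scope ring_scope.

Section NearMax.
Variable R : realDomainType.
Implicit Types (K : R) (f : nat -> R) (m n i j : nat).

Definition near_max K f n j := [forall i : 'I_n.+1, f i <= f j + K].

Lemma near_maxP K f n j :
  reflect (forall i, (i <= n)%N -> f i <= f j + K) (near_max K f n j).
Proof.
apply: (iffP forallP) => [H i lin|H i]; last by apply: H; rewrite -ltnS.
by have := H (Ordinal (lin : (i < n.+1)%N)).
Qed.

Definition first_near_max K f n := find (near_max K f n) (iota 0 n.+1).

Lemma near_max_exists K f n : 0 <= K -> exists2 j, (j <= n)%N & near_max K f n j.
Proof.
move=> K0; elim: n => [|n [j jn /near_maxP H]].
  by exists 0%N => //; apply/near_maxP => i; rewrite leqn0 => /eqP ->; rewrite lerDl.
have [h|h] := leP (f n.+1) (f j + K).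
  exists j; first exact: leqW.
  by apply/near_maxP => i; rewrite leq_eqVlt => /predU1P[->|/H].
exists n.+1 => //; apply/near_maxP => i; rewrite leq_eqVlt => /predU1P[->|/H]; lra.
Qed.

Lemma first_near_max_spec K f n : 0 <= K ->
  [/\ (first_near_max K f n <= n)%N,
      forall i, (i <= n)%N -> f i <= f (first_near_max K f n) + K &
      forall j, (j < first_near_max K f n)%N ->
        exists2 i, (i <= n)%N & f j + K < f i].
Proof.
move=> K0; have [j0 j0n Hj0] := near_max_exists f n K0.
have hasj : has (near_max K f n) (iota 0 n.+1).
  by apply/hasP; exists j0 => //; rewrite mem_iota add0n ltnS.
have ltn : (first_near_max K f n < n.+1)%N.
  by rewrite -[X in (_ < X)%N](size_iota 0) -has_find.
split=> //.
  by apply/near_maxP; have := nth_find 0%N hasj; rewrite nth_iota.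
move=> j jf; have := before_find 0%N jf; rewrite nth_iota ?(ltn_trans jf) // add0n.
move=> /negbT; rewrite negb_forall => /existsP[i]; rewrite -ltNge => h.
by exists i => //; rewrite -ltnS.
Qed.

Lemma first_near_max_uniq K f n m : 0 <= K -> (m <= n)%N ->
  (forall i, (i <= n)%N -> f i <= f m + K) ->
  (forall j, (j < m)%N -> exists2 i, (i <= n)%N & f j + K < f i) ->
  first_near_max K f n = m.
Proof.
move=> K0 mn Hm minm; have [an Ha mina] := first_near_max_spec f n K0.
case: (ltngtP (first_near_max K f n) m) => // [/minm|/mina] [i lin].
  by rewrite ltNge Ha.
by rewrite ltNge Hm.
Qed.

Lemma first_near_max_shift K f n : 0 <= K -> f 0%N + K < f n.+1 ->
  first_near_max K f n.+1 = (first_near_max K (f \o succn) n).+1.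
Proof.
move=> K0 f0; have [an Ha mina] := first_near_max_spec (f \o succn) n K0.
apply: first_near_max_uniq => //.
  case=> [_|i lin]; last exact: Ha.
  by have /= := Ha n (leqnn n); lra.
case=> [_|j]; first by exists n.+1.
by rewrite ltnS => /mina [i lin h]; exists i.+1.
Qed.

Lemma first_near_max_last K f n : 0 <= K -> f n.+1 <= f 0%N ->
  first_near_max K f n.+1 = first_near_max K f n.
Proof.
move=> K0 f0; have [an Ha mina] := first_near_max_spec f n K0.
apply: first_near_max_uniq => //; first exact: leqW.
  move=> i; rewrite leq_eqVlt => /predU1P[->|/Ha //].
  by apply: le_trans f0 _; exact: Ha.
by move=> j /mina [i lin h]; exists i => //; exact: leqW.
Qed.

Lemma first_near_max_le K f n : 0 <= K ->
  (first_near_max K f n <= first_near_max K f n.+1)%N.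
Proof.
move=> K0; have [an Ha mina] := first_near_max_spec f n K0.
have [bn Hb _] := first_near_max_spec f n.+1 K0.
rewrite leqNgt; apply/negP => /mina[i lin]; rewrite ltNge Hb //; exact: leqW.
Qed.

Lemma eq_first_near_max K f g n : (forall i, (i <= n)%N -> f i = g i) -> 0 <= K ->
  first_near_max K f n = first_near_max K g n.
Proof.
move=> fg K0; have [an Ha mina] := first_near_max_spec g n K0.
apply: first_near_max_uniq => // [i lin|j ja]; first by rewrite !fg // Ha.
by have [i lin h] := mina j ja; exists i => //; rewrite !fg //; lia.
Qed.

Definition maximum f n := f (first_near_max 0 f n).

Lemma maximum_ge f n i : (i <= n)%N -> f i <= maximum f n.
Proof. by move=> lin; have [_ + _] := first_near_max_spec f n (lexx 0); move=> /(_ i lin); rewrite addr0. Qed.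

Lemma maximum_attained f n : exists2 i, (i <= n)%N & maximum f n = f i.
Proof. by have [h _ _] := first_near_max_spec f n (lexx 0); exists (first_near_max 0 f n). Qed.

Lemma first_near_maxDr K f n c : 0 <= K ->
  first_near_max K (fun i => c + f i) n = first_near_max K f n.
Proof.
move=> K0; have [an Ha mina] := first_near_max_spec f n K0.
apply: first_near_max_uniq => // [i lin|j ja].
  by have := Ha i lin; lra.
by have [i lin h] := mina j ja; exists i => //; lra.
Qed.

End NearMax.

(** * Cyclic rotations of a periodic walk *)

Section Rotation.
Variable R : realDomainType.
Implicit Types (K : R) (x : nat -> R) (n r i j : nat).

Definition walk x j : R := \sum_(i < j) x i.
Definition steps_from x r i := x (r + i)%N.

Lemma walk0 x : walk x 0 = 0.
Proof. by rewrite /walk big_ord0. Qed.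

Lemma walkS x j : walk x j.+1 = walk x j + x j.
Proof. by rewrite /walk big_ord_recr. Qed.

Lemma walkSl x j : walk x j.+1 = x 0%N + walk (steps_from x 1) j.
Proof. by rewrite /walk big_ord_recl. Qed.

Lemma eq_walk x y n j : (forall i, (i < n)%N -> x i = y i) -> (j <= n)%N ->
  walk x j = walk y j.
Proof. by move=> xy jn; apply: eq_bigr => i _; apply: xy; apply: leq_trans jn. Qed.

Lemma steps_from_succ x r : steps_from (steps_from x r) 1 =1 steps_from x r.+1.
Proof. by move=> i; rewrite /steps_from add1n addnS addSn. Qed.

Lemma walk_shift_period x n r : (forall i, x (i + n)%N = x i) ->
  walk (steps_from x r) n = walk x n.
Proof.
move=> xn; elim: r => [//|r IHr]; rewrite -[RHS]IHr.
have -> : walk (steps_from x r.+1) n = walk (steps_from (steps_from x r) 1) n.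
  by apply: eq_bigr => i _; rewrite steps_from_succ.
apply: (addrI (steps_from x r 0)); rewrite -walkSl walkS addrC; congr (_ + _).
by rewrite /steps_from xn addn0.
Qed.

Variables (n : nat) (x : nat -> R).
Hypothesis xn : forall i, x (i + n.+1)%N = x i.
Let s := walk x n.+1.
Let a K r m := first_near_max K (walk (steps_from x r)) m.

Let sum_rot (G : nat -> R) : (forall r, G (r + n.+1)%N = G r) ->
  \sum_(r < n.+1) G r.+1 = \sum_(r < n.+1) G r.
Proof.
move=> Gn; rewrite [RHS]big_ord_recl big_ord_recr addrC /=; congr (_ + _).
by rewrite -(Gn 0%N) add0n.
Qed.

Let a_period K m r : 0 <= K -> a K (r + n.+1) m = a K r m.
Proof.
move=> K0; apply: eq_first_near_max => // i _; apply: eq_bigr => k _.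
by rewrite /steps_from -(xn (r + k)); congr x; lia.
Qed.

Let a_shift K r : 0 <= K -> K < s -> a K r n.+1 = (a K r.+1 n).+1.
Proof.
move=> K0 Ks; rewrite /a first_near_max_shift //; last first.
  by rewrite walk0 add0r walk_shift_period.
congr S; rewrite -(first_near_maxDr (walk (steps_from x r.+1)) n (steps_from x r 0) K0).
apply: eq_first_near_max => // i _ /=; rewrite walkSl; congr (_ + _).
by apply: eq_bigr => k _; exact: steps_from_succ.
Qed.

(** If the total over a period exceeds K, the starting point is not a near-maximum, so rotation r
    over n+1 steps gives one more than rotation r+1 over n steps, and the sum over r merely shifts.
    Otherwise lengthening the horizon can only move the first near-maximum to the right. *)
Lemma rotation_near_max K : 0 <= K ->
  \sum_(r < n.+1) (a K r n)%:R + (if K < s then n.+1%:R else 0)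
    <= \sum_(r < n.+1) (a K r n.+1)%:R :> R.
Proof.
move=> K0; case: ifPn => [Ks|_]; last first.
  by rewrite addr0 ler_sum // => r _; rewrite ler_nat first_near_max_le.
rewrite [leRHS](eq_bigr (fun r : 'I_n.+1 => (a K r.+1 n)%:R + 1)); last first.
  by move=> r _; rewrite a_shift // -natr1.
rewrite big_split /= sumr_const card_ord (sum_rot (G := fun r => (a K r n)%:R)) //.
by move=> r; rewrite a_period.
Qed.

(** For K = 0 the inequality becomes an equality: with a nonpositive total, the last point does not
    beat the starting point and leaves the first maximum unchanged. *)
Lemma rotation_argmax :
  \sum_(r < n.+1) (a 0 r n.+1)%:R =
  \sum_(r < n.+1) (a 0 r n)%:R + (if 0 < s then n.+1%:R else 0) :> R.
Proof.
case: ifPn => [s0|]; last first.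
  rewrite -leNgt addr0 => s0; apply: eq_bigr => r _.
  by rewrite /a first_near_max_last // walk0 walk_shift_period.
rewrite [LHS](eq_bigr (fun r : 'I_n.+1 => (a 0 r.+1 n)%:R + 1)); last first.
  by move=> r _; rewrite a_shift // -natr1.
rewrite big_split /= sumr_const card_ord (sum_rot (G := fun r => (a 0 r n)%:R)) //.
by move=> r; rewrite a_period.
Qed.

Let mx r m := maximum (walk (steps_from x r)) m.

Let mx_period r m : mx (r + n.+1) m = mx r m.
Proof.
rewrite /mx /maximum -/(a 0 _ m) a_period //; apply: eq_bigr => k _.
by rewrite /steps_from -(xn (r + k)); congr x; lia.
Qed.

Let mx_last r : s <= 0 -> mx r n.+1 = mx r n.
Proof. by move=> s0; rewrite /mx /maximum first_near_max_last // walk0 walk_shift_period. Qed.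

Let sum_x : \sum_(r < n.+1) steps_from x r 0 = s.
Proof. by apply: eq_bigr => r _; rewrite /steps_from addn0. Qed.

Lemma rotation_maximum :
  \sum_(r < n.+1) mx r n.+1 =
  \sum_(r < n.+1) mx r n + (if 0 < s then s else 0).
Proof.
case: ifPn => [s0|]; last first.
  by rewrite -leNgt addr0 => s0; apply: eq_bigr => r _; exact: mx_last.
rewrite [LHS](eq_bigr (fun r : 'I_n.+1 => mx r.+1 n + steps_from x r 0)); last first.
  move=> r _; rewrite /mx /maximum -/(a 0 _ n.+1) a_shift // walkSl addrC.
  by congr (_ + _); apply: eq_bigr => k _; exact: steps_from_succ.
by rewrite big_split /= sum_x (sum_rot (G := fun r => mx r n)) // => r; rewrite mx_period.
Qed.

(** A form of the cycle lemma. The summand is the maximum over 0..n+1 minus the maximum over 1..n+1: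
    never negative, and at least 1 if the walk stays at or below -1 after time 0. For a negative
    total these differences telescope to minus the total. *)
Lemma rotation_negative (V : pred nat) :
  (forall r, V r -> forall j, (0 < j <= n.+1)%N -> walk (steps_from x r) j <= -1) ->
  \sum_(r < n.+1) (V r)%:R <= (if s < 0 then - s else 0).
Proof.
move=> HV; case: ifPn => [s0|]; last first.
  rewrite -leNgt => s0; rewrite big1 // => r _.
  case: (boolP (V r)) => // /HV /(_ n.+1); rewrite ltnSn walk_shift_period // -/s.
  by move=> /(_ isT); lra.
apply: (@le_trans _ _ (\sum_(r < n.+1) (mx r n.+1 - (mx r.+1 n + steps_from x r 0)))); last first.
  rewrite sumrB big_split /= sum_x (sum_rot (G := fun r => mx r n)); last by move=> r; rewrite mx_period.
  rewrite (eq_bigr (fun r : 'I_n.+1 => mx r n)) ?opprD ?addrA ?subrr ?sub0r //.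
  by move=> r _; rewrite mx_last // ltW.
apply: ler_sum => r _.
have [j jn mj] := maximum_attained (walk (steps_from x r.+1)) n.
have E : mx r.+1 n + steps_from x r 0 = walk (steps_from x r) j.+1.
  rewrite /mx mj walkSl addrC; congr (_ + _).
  by apply: eq_bigr => k _; rewrite steps_from_succ.
case: (boolP (V r)) => /= [/HV /(_ j.+1)|_].
  move=> /(_ jn) h.
  have := @maximum_ge _ (walk (steps_from x r)) n.+1 0 isT; rewrite walk0 -/(mx r n.+1).
  by rewrite E; lra.
by rewrite E subr_ge0; apply: maximum_ge.
Qed.

End Rotation.

(** * Bernoulli words *)

Section Mean.
Variables (R : realType) (p : R).
Hypothesis p01 : 0 <= p <= 1.
Implicit Types (F G : seq bool -> R) (n : nat).

Definition mean n F : R :=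
  \sum_(w : n.-tuple bool) (\prod_(i < n) bernoulli_pmf p (tnth w i)) * F w.

Let wt_ge0 n (w : n.-tuple bool) : 0 <= \prod_(i < n) bernoulli_pmf p (tnth w i).
Proof. by apply: prodr_ge0 => i _; exact: bernoulli_pmf_ge0. Qed.

Lemma le_mean n F G : (forall w : seq bool, size w = n -> F w <= G w) ->
  mean n F <= mean n G.
Proof.
by move=> FG; apply: ler_sum => w _; apply: ler_wpM2l => //; apply: FG; exact: size_tuple.
Qed.

Lemma eq_mean n F G : (forall w : seq bool, size w = n -> F w = G w) ->
  mean n F = mean n G.
Proof. by move=> FG; apply: eq_bigr => w _; rewrite FG // size_tuple. Qed.

Lemma meanD n F G : mean n (fun w => F w + G w) = mean n F + mean n G.
Proof. by rewrite -big_split; apply: eq_bigr => w _; rewrite mulrDr. Qed.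

Lemma meanZ n c F : mean n (fun w => c * F w) = c * mean n F.
Proof. by rewrite /mean mulr_sumr; apply: eq_bigr => w _; rewrite mulrCA. Qed.

Lemma mean_sum n (I : finType) (P : pred I) (F : I -> seq bool -> R) :
  mean n (fun w => \sum_(i | P i) F i w) = \sum_(i | P i) mean n (F i).
Proof. by rewrite /mean exchange_big /=; apply: eq_bigr => w _; rewrite mulr_sumr. Qed.

Lemma mean0 F : mean 0 F = F [::].
Proof.
rewrite /mean (bigD1 [tuple]) //= big_ord0 mul1r big1 ?addr0 // => w /eqP[].
exact: tuple0.
Qed.

Lemma mean_cons n F :
  mean n.+1 F = p * mean n (fun w => F (true :: w)) + (1 - p) * mean n (fun w => F (false :: w)).
Proof.
have -> : mean n.+1 F = \sum_(b : bool) bernoulli_pmf p b * mean n (fun w => F (b :: w)).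
  rewrite /mean (reindex (fun u : bool * n.-tuple bool => [tuple of u.1 :: u.2])); last first.
    exists (fun w : n.+1.-tuple bool => (thead w, [tuple of behead w])) => [[b w] _|w _] /=.
      by congr pair; apply: val_inj.
    by rewrite -tuple_eta.
  pose g (b : bool) (w : n.-tuple bool) :=
    (\prod_(i < n.+1) bernoulli_pmf p (tnth [tuple of b :: w] i)) * F (b :: w).
  rewrite -(pair_bigA _ g); apply: eq_bigr => b _; rewrite mulr_sumr.
  apply: eq_bigr => w _; rewrite /g big_ord_recl mulrA; congr (_ * _ * _).
  by apply: eq_bigr => i _; rewrite tnthS.
by rewrite big_bool.
Qed.

Lemma mean_cst n c : mean n (fun=> c) = c.
Proof. by elim: n => [|n IHn]; rewrite ?mean0 // mean_cons IHn; ring. Qed.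

Lemma mean_ge0 n F : (forall w : seq bool, size w = n -> 0 <= F w) -> 0 <= mean n F.
Proof. by move=> F0; rewrite -(mean_cst n 0); exact: le_mean. Qed.

Lemma mean_drop t n F : mean (t + n) (F \o drop t) = mean n F.
Proof.
elim: t F => [|t IHt] F; first by apply: eq_mean => w _ /=; rewrite drop0.
rewrite addSn mean_cons.
have E b : mean (t + n) (fun w => (F \o drop t.+1) (b :: w)) = mean n F by exact: IHt.
by rewrite !E; ring.
Qed.

Lemma mean_rot n r F : mean n (F \o rot r) = mean n F.
Proof.
rewrite [RHS]/mean (reindex (fun w : n.-tuple bool => [tuple of rot r w])); last first.
  exists (fun w : n.-tuple bool => [tuple of rotr r w]) => w _; apply: val_inj => /=.
    exact: rotK.
  exact: rotrK.
apply: eq_bigr => w _; congr (_ * _).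
rewrite -(big_tuple _ _ w xpredT (bernoulli_pmf p)) -(big_tuple _ _ [tuple of rot r w] xpredT (bernoulli_pmf p)).
by apply: perm_big; rewrite perm_sym perm_rot.
Qed.

Lemma mean_take n F : mean n.+1 (F \o take n) = mean n F.
Proof.
(* Rotation moves the first letter to the end, so dropping the last letter becomes dropping the
   head. *)
rewrite -(mean_rot n.+1 1) -[RHS]mul1r mean_cons.
have E b : mean n (fun w => ((F \o take n) \o rot 1) (b :: w)) = mean n F.
  by apply: eq_mean => w <- /=; rewrite rot1_cons -cats1 take_size_cat.
by rewrite !E; ring.
Qed.

End Mean.

(** * Rotation identities in expectation *)

Section WordWalk.
Variable R : realType.
Implicit Types (w : seq bool).

Definition word_step w i : R := if nth false w i then -1 else 1.
Definition word_walk w := walk (word_step w).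

Lemma word_walkE w j : word_walk w j = (height (nth false w) j)%:~R.
Proof.
elim: j => [|j IHj]; first by rewrite /word_walk walk0.
by rewrite /word_walk walkS -/(word_walk w j) IHj /= rmorphD /word_step; case: nth.
Qed.

Lemma word_walk_lt w w' i j : word_walk w i < word_walk w' j ->
  word_walk w i + 1 <= word_walk w' j.
Proof. by rewrite !word_walkE ltr_int -[1]/(1%:~R) -intrD ler_int; lia. Qed.

Lemma word_walk_take n w j : (j <= n)%N -> word_walk (take n w) j = word_walk w j.
Proof.
move=> jn; apply: (@eq_walk _ _ _ n) => // i lin.
by rewrite /word_step nth_take.
Qed.

Lemma word_walk_cons b w j :
  word_walk (b :: w) j.+1 = (if b then -1 else 1) + word_walk w j.
Proof. by rewrite /word_walk walkSl. Qed.

Definition word_total w := word_walk w (size w).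
Definition argmax w := first_near_max 0 (word_walk w) (size w).
Definition near_argmax K w := first_near_max K (word_walk w) (size w).
Definition word_max w := maximum (word_walk w) (size w).

Let periodic w i := word_step w (i %% size w).

Let shift_periodic w r : (r <= size w)%N ->
  forall i, (i < size w)%N -> steps_from (periodic w) r i = word_step (rot r w) i.
Proof.
move=> rn i lin; rewrite /steps_from /periodic /word_step /rot nth_cat size_drop.
case: ltnP => h.
  by rewrite nth_drop modn_small //; lia.
have E : (r + i)%N = (i - (size w - r) + size w)%N by lia.
by rewrite E modnDr modn_small ?nth_take //; lia.
Qed.

Let periodic_period n w : size w = n.+1 -> forall i, periodic w (i + n.+1) = periodic w i.
Proof. by move=> sw i; rewrite /periodic sw modnDr. Qed.

Let walk_periodic n w : size w = n.+1 -> forall r j, (r < n.+1)%N -> (j <= n.+1)%N ->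
  walk (steps_from (periodic w) r) j = word_walk (rot r w) j.
Proof.
move=> sw r j rn jn; apply: (@eq_walk _ _ _ n.+1) => // i lin.
by apply: shift_periodic; rewrite sw // ltnW.
Qed.

Let walk_periodic0 n w : size w = n.+1 -> walk (periodic w) n.+1 = word_total w.
Proof.
move=> sw; rewrite -[LHS](@walk_shift_period _ _ _ 0); last exact: periodic_period.
by rewrite (walk_periodic sw) // rot0 /word_total sw.
Qed.

Variable p : R.
Hypothesis p01 : 0 <= p <= 1.

Lemma mean_rotations n (F : seq bool -> R) :
  mean p n.+1 F = n.+1%:R^-1 * mean p n.+1 (fun w => \sum_(r < n.+1) F (rot r w)).
Proof.
rewrite mean_sum (eq_bigr (fun=> mean p n.+1 F)); last by move=> r _; exact: mean_rot.
by rewrite sumr_const card_ord -[mean p n.+1 F *+ _]mulr_natl mulKf // pnatr_eq0.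
Qed.

Let near_take K n w : size w = n.+1 -> 0 <= K ->
  first_near_max K (word_walk w) n = near_argmax K (take n w).
Proof.
move=> sw K0; rewrite /near_argmax size_takel ?sw //.
by apply: eq_first_near_max => // i lin; rewrite word_walk_take.
Qed.

(** The letters are exchangeable, so each mean may be averaged over the rotations of the word, where
    [rotation_argmax] holds pointwise. *)
Lemma mean_argmax n :
  mean p n.+1 (fun w => (argmax w)%:R) =
  mean p n (fun w => (argmax w)%:R) + mean p n.+1 (fun w => (0 < word_total w)%R%:R).
Proof.
rewrite -[X in _ = X + _]mean_take -meanD // [LHS]mean_rotations.
rewrite (_ : mean p n.+1 (fun w => _ + _) = n.+1%:R^-1 * mean p n.+1 (fun w =>
  \sum_(r < n.+1) ((first_near_max 0 (word_walk (rot r w)) n)%:R) + (if 0 < word_total w then n.+1%:R else 0))).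
  congr (_ * _); apply: eq_mean => w sw.
  rewrite -(walk_periodic0 sw).
  transitivity (\sum_(r < n.+1) (first_near_max 0 (walk (steps_from (periodic w) r)) n.+1)%:R : R).
    apply: eq_bigr => r _; congr (_%:R); rewrite /argmax size_rot sw.
    by apply: eq_first_near_max => // i lin; rewrite (walk_periodic sw).
  rewrite rotation_argmax; last exact: periodic_period.
  congr (_ + _); apply: eq_bigr => r _; congr (_%:R).
  by apply: eq_first_near_max => // i lin; rewrite (walk_periodic sw) // leqW.
rewrite !meanD mulrDr; congr (_ + _).
  rewrite -(mean_rotations n (fun w => (first_near_max 0 (word_walk w) n)%:R)).
  by apply: eq_mean => w sw /=; rewrite near_take.
rewrite -meanZ; apply: eq_mean => w sw.
by case: ifP => _; rewrite ?mulr0 // mulVf // pnatr_eq0.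
Qed.

Lemma mean_near_argmax K n : 0 <= K ->
  mean p n (fun w => (near_argmax K w)%:R) + mean p n.+1 (fun w => (K < word_total w)%R%:R) <=
  mean p n.+1 (fun w => (near_argmax K w)%:R).
Proof.
move=> K0; rewrite -[X in X + _]mean_take -meanD // [leRHS]mean_rotations.
rewrite (_ : mean p n.+1 (fun w => _ + _) = n.+1%:R^-1 * mean p n.+1 (fun w =>
  \sum_(r < n.+1) ((first_near_max K (word_walk (rot r w)) n)%:R) + (if K < word_total w then n.+1%:R else 0))).
  apply: ler_wpM2l => //; apply: le_mean => // w sw.
  rewrite -(walk_periodic0 sw).
  rewrite (_ : \sum_(r < n.+1) (near_argmax K (rot r w))%:R =
     \sum_(r < n.+1) (first_near_max K (walk (steps_from (periodic w) r)) n.+1)%:R :> R); last first.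
    apply: eq_bigr => r _; congr (_%:R); rewrite /near_argmax size_rot sw.
    by apply: eq_first_near_max => // i lin; rewrite (walk_periodic sw).
  rewrite (_ : \sum_(r < n.+1) (first_near_max K (word_walk (rot r w)) n)%:R =
     \sum_(r < n.+1) (first_near_max K (walk (steps_from (periodic w) r)) n)%:R :> R); last first.
    apply: eq_bigr => r _; congr (_%:R).
    by apply: eq_first_near_max => // i lin; rewrite (walk_periodic sw) // leqW.
  by apply: rotation_near_max => //; exact: periodic_period.
rewrite !meanD mulrDr; congr (_ + _).
  rewrite -(mean_rotations n (fun w => (first_near_max K (word_walk w) n)%:R)).
  by apply: eq_mean => w sw /=; rewrite near_take.
rewrite -meanZ; apply: eq_mean => w sw.
by case: ifP => _; rewrite ?mulr0 // mulVf // pnatr_eq0.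
Qed.

Lemma mean_word_max n :
  mean p n.+1 word_max = mean p n word_max +
   n.+1%:R^-1 * mean p n.+1 (fun w => if 0 < word_total w then word_total w else 0).
Proof.
have word_max_take w : size w = n.+1 -> word_max (take n w) = maximum (word_walk w) n.
  move=> sw; rewrite /word_max /maximum -/(near_argmax 0 (take n w)) -near_take //.
  rewrite word_walk_take //.
  by have [] := first_near_max_spec (word_walk w) n (lexx 0).
rewrite -[X in _ = X + _]mean_take [LHS]mean_rotations [X in _ = X + _]mean_rotations -mulrDr -meanD.
congr (_ * _); apply: eq_mean => w sw; rewrite -(walk_periodic0 sw).
transitivity (\sum_(r < n.+1) maximum (walk (steps_from (periodic w) r)) n.+1).
  apply: eq_bigr => r _; rewrite /word_max size_rot sw /maximum.
  rewrite -(walk_periodic sw) //; last first.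
    by have [] := first_near_max_spec (word_walk (rot r w)) n.+1 (lexx 0).
  congr (walk _ _).
  by apply: eq_first_near_max => // i lin; rewrite (walk_periodic sw).
rewrite rotation_maximum; last exact: periodic_period.
congr (_ + _); apply: eq_bigr => r _ /=; rewrite word_max_take ?size_rot // /maximum.
rewrite -[RHS](walk_periodic sw) //; last first.
  by have [h _ _] := first_near_max_spec (word_walk (rot r w)) n (lexx 0); exact: leqW.
congr (walk _ _).
by apply: eq_first_near_max => // i lin; rewrite (walk_periodic sw) // leqW.
Qed.

Definition stays_negative w := [forall j : 'I_(size w), word_walk w j.+1 < 0].

Lemma mean_stays_negative n :
  mean p n.+1 (fun w => (stays_negative w)%:R) <=
  n.+1%:R^-1 * mean p n.+1 (fun w => if word_total w < 0 then - word_total w else 0).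
Proof.
rewrite [leLHS]mean_rotations; apply: ler_wpM2l => //; apply: le_mean => // w sw.
rewrite -(walk_periodic0 sw).
pose V r := (r < n.+1)%N && stays_negative (rot r w).
apply: le_trans (rotation_negative (periodic_period sw) (V := V) _) => [|r /andP[rn Vr] j /andP[j0 jn]].
  by apply: ler_sum => r _; rewrite /V ltn_ord.
rewrite (walk_periodic sw) //; case: j j0 jn => // j _ jn.
have jr : (j < size (rot r w))%N by rewrite size_rot sw.
have /forallP/(_ (Ordinal jr)) /= := Vr.
by rewrite word_walkE -[0 in X in X -> _]/(0%:~R) -[-1]/((-1)%:~R) ltr_int ler_int; lia.
Qed.

End WordWalk.

(** * Moment bounds and exceptional words *)

Section Moments.
Variables (R : realType) (p : R).
Hypothesis p01 : 0 <= p <= 1.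
Let d := 1 - 2 * p.

Lemma total_cons b w : word_total R (b :: w) = (if b then -1 else 1) + word_total R w.
Proof. exact: word_walk_cons. Qed.

Lemma mean_total n : mean p n (@word_total R) = n%:R * d.
Proof.
elim: n => [|n IHn]; first by rewrite mean0 /word_total /word_walk walk0 mul0r.
rewrite mean_cons (@eq_mean _ _ _ _ (fun w => -1 + word_total R w)); last by move=> w _; rewrite total_cons.
rewrite (@eq_mean _ _ _ (fun w => word_total R (false :: w)) (fun w => 1 + word_total R w)); last by move=> w _; rewrite total_cons.
by rewrite !meanD !mean_cst IHn -natr1 /d; ring.
Qed.

Lemma mean_total_sqr n : mean p n (fun w => word_total R w ^+ 2) <= n%:R + n%:R ^+ 2 * d ^+ 2.
Proof.
elim: n => [|n IHn]; first by rewrite mean0 /word_total /word_walk walk0 expr0n /= !(mul0r, expr0n, addr0).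
rewrite mean_cons.
rewrite (@eq_mean _ _ _ _ (fun w => 1 + ((-2) * word_total R w + word_total R w ^+ 2))); last by move=> w _; rewrite total_cons; ring.
rewrite (@eq_mean _ _ _ (fun w => word_total R (false :: w) ^+ 2) (fun w => 1 + (2 * word_total R w + word_total R w ^+ 2))); last by move=> w _; rewrite total_cons; ring.
rewrite !meanD !meanZ !mean_cst mean_total -natr1.
set q := mean _ _ _ in IHn *.
rewrite (_ : p * _ + _ = 1 + (2 * n%:R * d ^+ 2 + q)); last by rewrite /d; ring.
have := sqr_ge0 d; nra.
Qed.

Lemma mean_abs_total n c : 0 < c ->
  mean p n (fun w => `|word_total R w|) <= (n%:R + n%:R ^+ 2 * d ^+ 2) / (2 * c) + c / 2.
Proof.
move=> c0.
apply: (@le_trans _ _ (mean p n (fun w => (2 * c)^-1 * word_total R w ^+ 2 + c / 2))).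
  apply: le_mean => // w _; rewrite -real_normK ?num_real //; set a := `|_|.
  rewrite -(ler_pM2l (_ : 0 < 2 * c)); last by rewrite mulr_gt0.
  rewrite mulrDr mulrA mulfV ?mul1r; last by rewrite mulf_neq0 ?gt_eqF.
  have -> : 2 * c * (c / 2) = c ^+ 2 by field.
  by have := sqr_ge0 (a - c); nra.
rewrite meanD meanZ mean_cst lerD2r mulrC ler_wpM2r ?mean_total_sqr //.
by rewrite invr_ge0 mulr_ge0 // ltW.
Qed.

(** If the first maximum is at the last point, the last step raised the maximum by at least one. By
    [mean_word_max] the mean increase is the mean of the positive part of the total divided by
    n+1. *)
Lemma mean_argmax_last n :
  mean p n.+1 (fun w => (argmax R w == n.+1)%:R) <= n.+1%:R^-1 * mean p n.+1 (fun w => `|word_total R w|).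
Proof.
have le1 : mean p n.+1 (fun w => if 0 < word_total R w then word_total R w else 0) <=
           mean p n.+1 (fun w => `|word_total R w|).
  by apply: le_mean => // w _; case: ifP => h; rewrite ?ler_norm // ltW.
apply: le_trans (ler_wpM2l _ le1) => //.
rewrite -(lerD2l (mean p n (@word_max R))) -mean_word_max // -[X in X + _]mean_take // -meanD.
apply: le_mean => // w sw /=.
have [Mn Mmax Mmin] := first_near_max_spec (word_walk R w) n.+1 (lexx 0).
have [i lin ->] : exists2 i, (i <= n)%N & word_max R (take n w) = word_walk R w i.
  have [i] := maximum_attained (word_walk R (take n w)) (size (take n w)).
  rewrite -/(word_max R (take n w)) size_takel ?sw // => lin ->.
  by exists i => //; rewrite word_walk_take.
case: eqP => [Me|_]; last by rewrite addr0 /word_max sw; apply: maximum_ge; exact: leqW.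
have : word_walk R w i < word_max R w.
  rewrite /word_max /maximum sw; move: Me; rewrite /argmax sw => Me.
  have [k kn] := Mmin i (leq_trans (lin : (i < n.+1)%N) (eq_leq (esym Me))).
  by rewrite addr0 => /lt_le_trans; apply; have := Mmax k kn; rewrite addr0.
by rewrite /word_max /maximum; exact: word_walk_lt.
Qed.

(** A 2 put in front of a word whose walk never exceeds 0 gives a walk that stays negative after
    time 0. *)
Lemma mean_word_max_le0 n :
  p * mean p n (fun w => (word_max R w <= 0)%R%:R) <=
  n.+1%:R^-1 * mean p n.+1 (fun w => `|word_total R w|).
Proof.
have le1 : mean p n.+1 (fun w => if word_total R w < 0 then - word_total R w else 0) <=
           mean p n.+1 (fun w => `|word_total R w|).
  by apply: le_mean => // w _; case: ifP => h //; rewrite -normrN ler_norm.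
apply: le_trans (ler_wpM2l _ le1) => //; apply: le_trans (mean_stays_negative p01 n).
rewrite mean_cons ler_wpDr //.
  rewrite mulr_ge0 //; first by case/andP: p01 => _; rewrite subr_ge0.
  by apply: mean_ge0.
apply: ler_wpM2l; first by case/andP: p01.
apply: le_mean => // w sw; case: (boolP (word_max R w <= 0)) => // w0.
rewrite ler_nat lt0b; apply/forallP => /= j.
rewrite word_walk_cons; have jn : (j <= size w)%N by rewrite -ltnS.
by have := maximum_ge (word_walk R w) jn; rewrite -/(word_max R w); lra.
Qed.

End Moments.

(** * From words to positions of the particle *)

(* From depth [d] below a record, each of the next [K] record levels is left by a step down. *)
Fixpoint gapless (K d : nat) (w : seq bool) : bool :=
  match K, w with
  | 0%N, _ => true
  | _.+1, [::] => false
  | K'.+1, b :: w' =>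
      if d is d'.+1 then gapless K (if b then d'.+2 else d') w'
      else b && gapless K' 2 w'
  end.

(** At each of the K record levels the next letter is fresh and must be a 2, which costs a factor
    p. *)
Lemma mean_gapless (R : realType) (p : R) (K d n : nat) : 0 <= p <= 1 ->
  mean p n (fun w => (gapless K d w)%:R) <= p ^+ K.
Proof.
move=> p01; have /andP[p0 p1] := p01.
elim: n K d => [|n IHn] [|K] d.
- by rewrite mean0.
- by rewrite mean0 /= exprn_ge0.
- by rewrite (@eq_mean _ _ _ _ (fun=> 1)) ?mean_cst // => -[].
have q0 : 0 <= 1 - p by rewrite subr_ge0.
rewrite mean_cons; case: d => [|d] /=.
  by rewrite mean_cst mulr0 addr0 exprS ler_wpM2l.
have := ler_wpM2l p0 (IHn K.+1 d.+2); have := ler_wpM2l q0 (IHn K.+1 d).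
by rewrite mulrBl mul1r /=; lra.
Qed.

(** Failure of [gapless] can also mean that the word ended too early; reaching height d+K excludes
    this. What remains is a strict record followed by a zero, at one of the next K record levels. *)
Lemma gapN (K d : nat) (w : seq bool) (v := nth false w) : ~~ gapless K d w ->
  (exists2 j, (j <= size w)%N & (d + K)%:Z <= height v j) ->
  exists j i, [/\ (j < size w)%N, (i < K)%N, height v j = (d + i)%:Z, ~~ v j &
    forall k, (k < j)%N -> height v k < height v j].
Proof.
have cons_height b w' j : height (nth false (b :: w')) j.+1 =
    (if b then -1 else 1) + height (nth false w') j.
  elim: j => [|j IHj]; first by rewrite /= add0r addr0.
  have hS f k : height f k.+1 = height f k + (if f k then -1 else 1) by [].
  by rewrite hS IHj hS addrA.
rewrite {}/v; elim: w K d => [|b w IHw] [|K] d // gap [j jw hj].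
  move: jw hj; rewrite leqn0 => /eqP -> /=; lia.
case: j jw hj => [|j] jw; first by case: d gap => [|d] /=; lia.
rewrite cons_height => hj.
have wrap K' d' : (K' <= K.+1)%N -> ~~ gapless K' d' w ->
    (d' + K')%:Z <= height (nth false w) j -> (0 < d + (K.+1 - K'))%N ->
    d'%:Z + (if b then -1 else 1) = (d + (K.+1 - K'))%:Z ->
  exists j0 i, [/\ (j0 < (size w).+1)%N, (i < K.+1)%N,
    height (nth false (b :: w)) j0 = (d + i)%:Z, ~~ nth false (b :: w) j0
    & forall k, (k < j0)%N -> height (nth false (b :: w)) k < height (nth false (b :: w)) j0].
  move=> KK gap' hj' d0 dd; case: (IHw K' d' gap') => [|j0 [i [j0w iK h0 v0 rec]]].
    by exists j.
  exists j0.+1, (K.+1 - K' + i)%N; split=> //; [lia| |].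
    by rewrite cons_height h0; lia.
  case=> [_|k /rec]; rewrite !cons_height /=; last by lia.
  by rewrite h0; move: dd; case: (b); lia.
case: d gap hj wrap => [|d] /= gap hj wrap; last first.
  by apply: (wrap K.+1 _ _ gap); case: (b) hj => hj; lia.
case: b jw gap hj wrap => /= jw gap hj wrap; first by apply: (wrap K _ _ gap); lia.
by exists 0%N, 0%N.
Qed.

Lemma height_live (v : nat -> bool) (j : nat) : 0 < height v j -> live v j.
Proof.
elim: j => [//|j IHj] /=; case: (boolP (v j)) => vj h; last by exists j.
by apply: liveW (leqnSn j) (IHj _); lia.
Qed.

Section Classification.
Variables (R : realType) (n : nat) (w' : word2 n) (u : 'I_n).
Hypothesis wu : ~~ tnth w' u.
Let v := nth false w'.

Lemma marked_put1 : marked (put1 w' u) v u.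
Proof.
split=> [//||i]; first by apply: negbTE; rewrite /v -tnth_nth.
have [ni|lin] := leqP n i.
  rewrite let3_ge // /v nth_default ?size_tuple //.
  by case: eqP => // iu; move: ni; rewrite iu leqNgt ltn_ord.
rewrite /let3 (nth_mktuple _ _ (Ordinal lin)) (tnth_nth false) /= -val_eqE /=.
by case: eqP => _; [|rewrite -/(v i); case: (v i)]; rewrite inordK.
Qed.

Lemma excess_delayed : (argmax R w' < u)%N -> 0 < word_max R w' ->
  excess R (put1 w' u) = 1.
Proof.
have [Mn Mmax _] := first_near_max_spec (word_walk R w') (size w') (lexx 0).
rewrite /word_max /maximum -/(argmax R w') in Mn Mmax * => Mu M0.
have succB (m : nat) : m.+1%:R - m%:R = 1 :> R by rewrite -natr1 addrAC subrr add0r.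
rewrite /excess (T3_delayed marked_put1) ?succB //.
exists (argmax R w'); split=> //.
  by apply: height_live; move: M0; rewrite word_walkE -[0]/(0%:~R) ltr_int.
move=> i _ ri; have lin : (i <= size w')%N.
  rewrite size_tuple; case: ri => [/leq_trans|[x ix vx]]; first by apply; exact: ltnW.
  rewrite (leq_trans ix) // leqNgt; apply: contraL vx => nx.
  by rewrite /v nth_default // size_tuple ltnW.
by have := Mmax i lin; rewrite addr0 !word_walkE ler_int.
Qed.

(** Among the last K records below the maximum, one is followed by a zero. A strict record is also
    entered by a zero, so this gives the pair required by [overtaken]; the 2 still to cross it is
    the letter after the maximum, which is why the maximum must not be at n. *)
Lemma excess_overtaken (K : nat) : (u < near_argmax (K%:R : R) w')%N ->
  (argmax R w' < n)%N -> ~~ gapless K 0 (drop (near_argmax (K%:R : R) w') w') ->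
  excess R (put1 w' u) = 0.
Proof.
move=> ut Mn gap; set t := near_argmax _ _ in ut gap.
have [tn tmax tmin] := first_near_max_spec (word_walk R w') (size w') (ler0n R K).
rewrite -/(near_argmax _ w') -/t in tn tmax tmin.
have [_ Mmax Mmin] := first_near_max_spec (word_walk R w') (size w') (lexx 0).
rewrite -/(argmax R w') in Mmax Mmin; set M := argmax R w' in Mmax Mmin Mn.
have {}Mmax i : (i <= n)%N -> height v i <= height v M.
  by move=> lin; have := Mmax i; rewrite size_tuple => /(_ lin); rewrite addr0 !word_walkE ler_int.
have {}Mmin j : (j < M)%N -> height v j < height v M.
  move=> /Mmin[i]; rewrite size_tuple addr0 !word_walkE ltr_int => /Mmax h1 h2.
  exact: lt_le_trans h1.
have {}tmax : height v M <= height v t + K%:Z.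
  have := tmax M; rewrite size_tuple => /(_ (ltnW Mn)).
  by rewrite !word_walkE -[K%:R]/((K%:Z)%:~R) -intrD ler_int.
have {}tmin j : (j < t)%N -> height v j + K%:Z < height v M.
  move=> /tmin[i]; rewrite size_tuple -[K%:R]/((K%:Z)%:~R) !word_walkE -intrD ltr_int => /Mmax h1 h2.
  exact: lt_le_trans h1.
(* Since t > 0 and the walk moves by unit steps, the first near-maximum is exactly K below the
   maximum, so the K record levels from there end at the maximum. *)
have htt : height v t = height v M - K%:Z.
  case: t ut tmax tmin {gap tn} => // t ut /= tmax /(_ t (ltnSn t)).
  by move: tmax; case: ifP => _; lia.
have tM : (t <= M)%N.
  by rewrite leqNgt; apply/negP => /tmin; lia.
have drop_height j : height (nth false (drop t w')) j = height v (t + j) - height v t.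
  elim: j => [|j IHj] /=; first by rewrite addn0 subrr.
  by rewrite nth_drop IHj addnS /= -/(v (t + j)%N); lia.
have [|j [i [jn iK]]] := gapN gap.
  exists (M - t)%N; first by rewrite size_drop size_tuple leq_sub2r // ltnW.
  by rewrite drop_height subnKC // htt; lia.
rewrite drop_height nth_drop; set r := (t + j)%N => hr vr rec.
have {}rec k : (k < r)%N -> height v k < height v r.
  move=> kr; have [kt|tk] := ltnP k t; first by have := tmin k kt; lia.
  have := rec (k - t)%N; rewrite !drop_height subnKC // -/r => /(_ _); rewrite ltrD2r; apply.
  by rewrite ltn_subLR.
have hrH : height v r < height v M by lia.
have rM : (r < M)%N.
  by case: (ltngtP r M) => // [/rec|rM]; [lia|move: hrH; rewrite rM ltxx].
have vM : v M.
  apply/negP => /negP vM; have := Mmax M.+1 Mn.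
  by rewrite /= (negPf vM); lia.
have r0 : (0 < r)%N by rewrite /r; lia.
have hq : height v r = height v r.-1 + 1 /\ ~~ v r.-1.
  have := rec r.-1; rewrite prednK // leqnn => /(_ isT).
  by rewrite -{2 3}(prednK r0) /=; case: (v r.-1) => /=; lia.
have [hq1 vq] := hq.
rewrite /excess (@T3_frontmost_overtaken _ _ v u marked_put1) ?subrr //.
case: (boolP [forall i : 'I_u, v i]) => [/forallP Fu|].
  by left=> k ku; exact: (Fu (Ordinal ku)).
rewrite negb_forall => /existsP[z vz]; right; exists r.-1, M; split=> //.
- by rewrite /r; lia.
- by rewrite vq prednK.
- by exists (z : nat) => //; have := ltn_ord z; rewrite /r; lia.
by move=> k kr _; have := rec k; rewrite -ltnS prednK // in kr; move=> /(_ kr); lia.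
Qed.

End Classification.

Section Conditional.
Variables (R : realType) (n : nat).
Implicit Types (w : word2 n) (C : pred (word3 n)).

Definition position_prob C w : R := \sum_(u < n | C (put1 w u)) position_pmf R w u.

(** Zeros minus 2s is the height and zeros plus 2s is j. *)
Lemma zeros_count w j : (j <= n)%N ->
  2 * \sum_(u < n | (u < j)%N) (~~ tnth w u)%:R = j%:R + word_walk R w j.
Proof.
move=> jn; rewrite (eq_bigr (fun u : 'I_n => (~~ nth false w u)%:R)); last first.
  by move=> u _; rewrite (tnth_nth false).
rewrite -(big_ord_widen n (fun u => (~~ nth false w u)%:R : R) jn) mulr_sumr.
have -> : j%:R = \sum_(u < j) 1 :> R by rewrite sumr_const card_ord.
rewrite -big_split; apply: eq_bigr => u _ /=.
by rewrite /word_step; case: (nth false w u) => /=; ring.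
Qed.

Lemma card_zeros w : 2 * #|zeros w|%:R = n%:R + word_total R w.
Proof.
rewrite /word_total size_tuple -zeros_count // -sum1_card natr_sum big_mkcond /=.
congr (_ * _); rewrite [RHS]big_mkcond; apply: eq_bigr => u _.
by rewrite inE ltn_ord; case: (tnth w u).
Qed.

Lemma position_pmf_ge0 w (u : 'I_n) : 0 <= position_pmf R w u.
Proof. by rewrite /position_pmf; case: ifP => // _; exact: divr_ge0. Qed.

Lemma position_pmf_sum w : (0 < n)%N -> \sum_(u < n) position_pmf R w u = 1.
Proof.
move=> n0; rewrite /position_pmf; case: (boolP (zeros w == finset.set0)) => [_|z0].
  rewrite (bigD1 (Ordinal n0)) //= big1 ?addr0 // => u.
  by rewrite -val_eqE /=; case: eqP.
rewrite -mulr_suml (_ : \sum_(i < n) _ = #|zeros w|%:R).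
  by rewrite mulfV // pnatr_eq0 cards_eq0.
by rewrite -sum1_card natr_sum [RHS]big_mkcond; apply: eq_bigr => u _ /=; case: (u \in _).
Qed.

Lemma position_prob_eq w C : zeros w != finset.set0 ->
  position_prob C w = (\sum_(u < n | C (put1 w u)) (~~ tnth w u)%:R) / #|zeros w|%:R.
Proof.
move=> z0; rewrite /position_prob mulr_suml; apply: eq_bigr => u _.
by rewrite /position_pmf (negPf z0) inE.
Qed.

Lemma position_prob_ge0 w C : 0 <= position_prob C w.
Proof. by apply: sumr_ge0 => u _; exact: position_pmf_ge0. Qed.

Lemma position_prob_le1 w C : (0 < n)%N -> position_prob C w <= 1.
Proof.
move=> n0; rewrite -(position_pmf_sum w n0) /position_prob [leRHS](bigID (fun u => C (put1 w u))) /=.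
by rewrite lerDl; apply: sumr_ge0 => u _; exact: position_pmf_ge0.
Qed.

Lemma word_max_ge0 (w : seq bool) : 0 <= word_max R w.
Proof. by have := maximum_ge (word_walk R w) (leq0n (size w)); rewrite /word_walk walk0. Qed.

Lemma zeros_neq0 w j : 0 < word_walk R w j -> (j <= n)%N -> zeros w != finset.set0.
Proof.
rewrite word_walkE ltr0z => h jn; have [i ij vi] := height_live h.
have lin : (i < n)%N by exact: leq_trans jn.
by apply/finset.set0Pn; exists (Ordinal lin); rewrite inE (tnth_nth false).
Qed.

(** The zeros before t make up (t + S_t)/(n + S_n) of all zeros, and S_t > 0 unless t = 0. The last
    two subtracted terms pay for words to which [excess_overtaken] does not apply; since t depends
    on the word, the gapless event is paid for at every possible t. *)
Lemma position_prob_excess0 w (K : nat) : (0 < n)%N ->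
  (near_argmax (K%:R : R) w)%:R / n%:R - `|word_total R w| / n%:R
   - (argmax R w == n)%:R - \sum_(t < n.+1) (gapless K 0 (drop t w))%:R
  <= position_prob (fun x => excess R x == 0) w.
Proof.
move=> n0; have n0R : 0 < n%:R :> R by rewrite ltr0n.
set a := `|_| / _; have a0 : 0 <= a by rewrite divr_ge0.
have [tn tmax tmin] := first_near_max_spec (word_walk R w) (size w) (ler0n R K).
set t := near_argmax _ w in tn tmax tmin *; rewrite -/(near_argmax (K%:R : R) w) -/t in tn tmax tmin.
rewrite size_tuple in tn tmax tmin.
set b := \sum_(_ < _) _; have b0 : 0 <= b by apply: sumr_ge0.
have P0 := position_prob_ge0 w (fun x => excess R x == 0).
have tn1 : t%:R / n%:R <= 1 :> R by rewrite ler_pdivrMr // mul1r ler_nat.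
have [Mn|Mn] := eqVneq (argmax R w) n; first by rewrite /=; lra.
have [tgap|tgap] := boolP (gapless K 0 (drop t w)).
  have : 1 <= b.
    rewrite /b (bigD1 (Ordinal (tn : (t < n.+1)%N))) //= tgap lerDl.
    by apply: sumr_ge0.
  by rewrite /=; lra.
have [t0|t0] := eqVneq t 0%N; first by rewrite t0 mul0r /=; lra.
have Mn' : (argmax R w < n)%N.
  rewrite ltn_neqAle Mn; have [+ _ _] := first_near_max_spec (word_walk R w) (size w) (lexx 0).
  by rewrite -/(argmax R w) [X in (_ <= X)%N -> _]size_tuple.
have wt : 0 < word_walk R w t.
  have [i lin] : exists2 i, (i <= n)%N & word_walk R w 0 + K%:R < word_walk R w i.
    by apply: tmin; rewrite lt0n.
  by rewrite [word_walk _ _ 0]walk0; have := tmax i lin; lra.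
have z0 := zeros_neq0 wt tn.
rewrite (position_prob_eq _ z0).
have zc : 0 < #|zeros w|%:R :> R by rewrite ltr0n card_gt0.
have le1 : \sum_(u < n | (u < t)%N) (~~ tnth w u)%:R <=
    \sum_(u < n | excess R (put1 w u) == 0) (~~ tnth w u)%:R :> R.
  rewrite big_mkcond [leRHS]big_mkcond /=; apply: ler_sum => u _.
  case: (boolP (tnth w u)) => wu; first by rewrite !if_same.
  by case: ltnP => ut; [rewrite (excess_overtaken wu ut) ?eqxx|case: ifP].
apply: (@le_trans _ _ (t%:R / n%:R - a)); first by rewrite /=; lra.
apply: le_trans (ler_wpM2r _ le1); last by rewrite invr_ge0 ltW.
rewrite ler_pdivlMr // -(ler_pM2l (_ : 0 < 2)) // zeros_count // mulrCA card_zeros.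
rewrite /a -mulrBl; set S := word_total R w.
have h1 : n%:R + S <= n%:R + `|S| by rewrite lerD2l ler_norm.
have h2 : 0 <= n%:R + S by rewrite -card_zeros mulr_ge0.
have t0R : 0 <= t%:R :> R by [].
(* When |S| is at least t the left side is not positive; otherwise use t/(n + |S|) >= (t -
   |S|)/n. *)
have [tS|St] := leP (t%:R : R) `|S|.
  by apply: (@le_trans _ _ 0); [rewrite mulr_le0_ge0 // mulr_le0_ge0 ?invr_ge0 // subr_le0|lra].
apply: (@le_trans _ _ ((t%:R - `|S|) / n%:R * (n%:R + `|S|))).
  by rewrite ler_wpM2l // divr_ge0 // subr_ge0 ltW.
rewrite mulrAC ler_pdivrMr //.
have := normr_ge0 S; have : t%:R <= n%:R :> R by rewrite ler_nat.
by nra.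
Qed.

Lemma position_prob_excess1 w : (0 < n)%N ->
  position_prob (fun x => excess R x != 1) w <=
  (argmax R w)%:R / n%:R + word_max R w / n%:R + `|word_total R w| / n%:R
   + (word_max R w <= 0)%R%:R.
Proof.
move=> n0; have n0R : 0 < n%:R :> R by rewrite ltr0n.
have a0 : 0 <= `|word_total R w| / n%:R by rewrite divr_ge0.
have m0 : 0 <= word_max R w / n%:R by rewrite divr_ge0 // word_max_ge0.
have c0 : 0 <= (argmax R w)%:R / n%:R :> R by rewrite divr_ge0.
have P1 := position_prob_le1 w (fun x => excess R x != 1) n0.
have [M0|M0] := leP (word_max R w) 0; first by rewrite /=; lra.
rewrite addr0 -!mulrDl.
have [Mn Mmax _] := first_near_max_spec (word_walk R w) (size w) (lexx 0).
rewrite -/(argmax R w) in Mn Mmax; rewrite size_tuple in Mn Mmax.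
have Mw : word_max R w = word_walk R w (argmax R w) by [].
have z0 : zeros w != finset.set0 by apply: (zeros_neq0 (j := argmax R w)); rewrite -?Mw.
have zc : 0 < #|zeros w|%:R :> R by rewrite ltr0n card_gt0.
rewrite (position_prob_eq _ z0) in P1 *; set r := _ / _ in P1 *.
have le1 : \sum_(u < n | excess R (put1 w u) != 1) (~~ tnth w u)%:R <=
    \sum_(u < n | (u < argmax R w)%N) (~~ tnth w u)%:R :> R.
  rewrite big_mkcond [leRHS]big_mkcond /=; apply: ler_sum => u _.
  case: (boolP (tnth w u)) => wu; first by rewrite !if_same.
  case: (ltngtP u (argmax R w)) => [_|uM|uM]; first by case: ifP.
    by rewrite (excess_delayed wu) ?eqxx.
  (* A zero exactly at the argmax would make the next point higher than the maximum. *)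
  have := Mmax u.+1 (ltn_ord u); rewrite addr0 -uM /word_walk walkS.
  by rewrite /word_step -tnth_nth (negPf wu); lra.
rewrite ler_pdivlMr //; set S := word_total R w.
have rZ : r * (n%:R + S) <= (argmax R w)%:R + word_max R w.
  rewrite -card_zeros Mw -zeros_count // mulrCA ler_pM2l //.
  by rewrite /r divfK // gt_eqF.
have r0 : 0 <= r by rewrite divr_ge0 // sumr_ge0.
by have := ler_norm (- S); rewrite normrN; have := normr_ge0 S; nra.
Qed.

End Conditional.

(** * The binomial tail and the normal distribution *)

Local Open Scope classical_set_scope.
Local Open Scope ring_scope.

Section Binomial.
Variable R : realType.
Implicit Types (x : R) (j k : nat).

(* Probability of at least [j] zeros among [k] letters, each being 0 with probability [x]. *)
Fixpoint binomial_tail k j x : R :=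
  match k, j with
  | _, 0%N => 1
  | 0%N, _.+1 => 0
  | k'.+1, j'.+1 => x * binomial_tail k' j' x + (1 - x) * binomial_tail k' j'.+1 x
  end.

Lemma binomial_tailS k j x : binomial_tail k.+1 j.+1 x =
  x * binomial_tail k j x + (1 - x) * binomial_tail k j.+1 x.
Proof. by []. Qed.

Lemma mean_binomial_tail k j x :
  mean (1 - x) k (fun w => (j <= count_mem false w)%N%:R) = binomial_tail k j x.
Proof.
elim: k j => [|k IHk] j; first by rewrite mean0; case: j.
case: j => [|j]; first by rewrite mean_cst.
by rewrite mean_cons binomial_tailS -!IHk subKr addrC.
Qed.

Lemma binomial_tail_diff k j x : binomial_tail k j x - binomial_tail k j.+1 x =
  'C(k, j)%:R * (x ^+ j * (1 - x) ^+ (k - j)).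
Proof.
elim: k j => [|k IHk] [|j].
- by rewrite /= bin0 !expr0; ring.
- by rewrite /= bin0n mul0r subrr.
- have := IHk 0%N; rewrite /= !bin0 !subn0 !expr0 !mul1r exprS => <-.
  by case: k {IHk} => [|k] /=; ring.
rewrite !binomial_tailS binS natrD [RHS]mulrDl.
have -> : forall a b c : R, x * a + (1 - x) * b - (x * b + (1 - x) * c) = x * (a - b) + (1 - x) * (b - c).
  by move=> a b c; ring.
rewrite !IHk addrC; congr (_ + _); last first.
  by rewrite subSS exprS; ring.
have [jk|kj] := leqP k j; first by rewrite bin_small // !mul0r mulr0.
by rewrite subSS -(subnSK kj) [(1 - x) ^+ _.+1]exprS; ring.
Qed.

(** The tail is the distribution function of a beta law; most terms cancel in the derivative because
    consecutive tails differ by one binomial weight ([binomial_tail_diff]). *)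
Lemma is_derive_binomial_tail k j x :
  is_derive x 1 (binomial_tail k.+1 j.+1)
    ((k.+1 * 'C(k, j))%:R * (x ^+ j * (1 - x) ^+ (k - j))).
Proof.
have E k' j' : binomial_tail k'.+1 j'.+1 =
   id * binomial_tail k' j' + (cst 1 - id) * binomial_tail k' j'.+1.
  by apply/funext => y; rewrite binomial_tailS.
elim: k j => [|k IHk] j.
  rewrite E mul1n.
  have -> : binomial_tail 0 j.+1 = cst 0 by [].
  have -> : binomial_tail 0 j = cst ('C(0, j)%:R) by apply/funext => y; case: j.
  apply: is_derive_eq; rewrite /GRing.scale /= (_ : (cst 1 - id) x = 1 - x) //.
  by case: j => [|j] /=; rewrite ?bin0 ?bin0n ?expr0 /=; ring.
have D j' : is_derive x 1 (binomial_tail k.+1 j') (if j' is i.+1 then (k.+1 * 'C(k, i))%:R * (x ^+ i * (1 - x) ^+ (k - i)) else 0).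
  case: j' => [|i]; last exact: IHk.
  by have -> : binomial_tail k.+1 0 = cst 1 by []; exact: is_derive_cst.
have Dj := D j; have Dj1 := D j.+1.
rewrite E; apply: is_derive_eq; rewrite /GRing.scale /= (_ : (cst 1 - id) x = 1 - x) //.
have diff := binomial_tail_diff k.+1 j x.
rewrite -[k.+2]addn1 mulnDl mul1n natrD [RHS]mulrDl -diff !natrM.
set tj := binomial_tail k.+1 j x in diff *; rewrite -!/(binomial_tail k.+1 j.+1 x).
have rec : x * (if j is i.+1 then (k.+1%:R * ('C(k, i))%:R) * (x ^+ i * (1 - x) ^+ (k - i)) else 0)
  + (1 - x) * (k.+1%:R * 'C(k, j)%:R * (x ^+ j * (1 - x) ^+ (k - j))) =
  k.+1%:R * 'C(k.+1, j)%:R * (x ^+ j * (1 - x) ^+ (k.+1 - j)).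
  case: {Dj Dj1 diff tj} j => [|i]; first by rewrite !bin0 !subn0 !expr0 exprS; ring.
  rewrite binS natrD subSS [x ^+ i.+1]exprS.
  have [ki|ik] := leqP k i; first by rewrite (@bin_small k i.+1) //; ring.
  by rewrite -(subnSK ik) [(1 - x) ^+ _.+1]exprS; ring.
by rewrite -rec /tj; case: j {Dj Dj1 diff rec tj} => [|i]; rewrite ?natrM ?binomial_tailS /=; ring.
Qed.

End Binomial.

(** * The tail as a rescaled beta integral *)

Section BetaDensity.
Variable R : realType.
Local Notation mu := (@lebesgue_measure R).
Implicit Types (z : R) (k a : nat).

Definition beta_fun_scaled k a z : R :=
  (1 + z / Num.sqrt k%:R) ^+ a * (1 - z / Num.sqrt k%:R) ^+ (k.-1 - a).

Definition scaled_tail k a z : R :=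
  binomial_tail k a.+1 ((1 + z / Num.sqrt k%:R) / 2).

(** Not normalised to mass 1: the constant is the one of the normal density, and the mass will be
    shown to tend to 1, so Stirling's formula is avoided. *)
Definition beta_density k a : R -> R :=
  (fun z => normal_peak 1 * beta_fun_scaled k a z) \_ `[- Num.sqrt k%:R, Num.sqrt k%:R].

Lemma is_derive_scaled_tail k a z : (a <= k)%N ->
  is_derive z 1 (scaled_tail k.+1 a)
    ((k.+1 * 'C(k, a))%:R / (2 ^+ k.+1 * Num.sqrt k.+1%:R) * beta_fun_scaled k.+1 a z).
Proof.
move=> ak; set r := Num.sqrt _.
have r0 : r != 0 by rewrite gt_eqF // sqrtr_gt0 ltr0n.
pose g (y : R) := (1 + y / r) / 2.
have dg : is_derive z 1 g ((2 * r)^-1).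
  have -> : g = cst 2^-1 + (cst ((2 * r)^-1) * id).
    by apply/funext => y /=; rewrite /g !fctE; field.
  by apply: is_derive_eq; rewrite /GRing.scale /=; ring.
apply: (is_derive_eq (is_derive1_comp (is_derive_binomial_tail k a (g z)) dg)).
rewrite /beta_fun_scaled /= -/r.
have -> : 1 - g z = (1 - z / r) / 2 by rewrite /g; field.
have -> : g z = (1 + z / r) / 2 by [].
rewrite !exprMn /GRing.scale /= -(subnK ak) addnK -addnS !exprD exprS !exprVn; field.
by rewrite r0 !expf_neq0.
Qed.

Lemma binomial_tail0 k j : binomial_tail k j.+1 (0 : R) = 0.
Proof. by elim: k j => [|k IHk] j //=; rewrite IHk; ring. Qed.

Lemma binomial_tail1 k j : (j <= k)%N -> binomial_tail k j (1 : R) = 1.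
Proof. by elim: k j => [|k IHk] [|j] //= jk; rewrite IHk //; ring. Qed.

Lemma continuous_beta_fun_scaled k a : continuous (beta_fun_scaled k a).
Proof.
move=> z; rewrite /beta_fun_scaled; apply: cvgM.
  apply: (@cvg_comp _ _ _ (fun z => 1 + z / Num.sqrt k%:R) (fun x : R => x ^+ a)); last exact: exprn_continuous.
  by apply: cvgD; [exact: cvg_cst|apply: cvgM; [exact: cvg_id|exact: cvg_cst]].
apply: (@cvg_comp _ _ _ (fun z => 1 - z / Num.sqrt k%:R) (fun x : R => x ^+ (k.-1 - a))); last exact: exprn_continuous.
by apply: cvgB; [exact: cvg_cst|apply: cvgM; [exact: cvg_id|exact: cvg_cst]].
Qed.

Lemma integrable_beta_fun k a x y : mu.-integrable `[x, y] (EFin \o beta_fun_scaled k a).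
Proof.
apply: continuous_compact_integrable; first exact: segment_compact.
by apply: continuous_subspaceT => z; exact: continuous_beta_fun_scaled.
Qed.

Lemma integral_beta_fun k a z : (a <= k)%N -> - Num.sqrt k.+1%:R < z ->
  (k.+1 * 'C(k, a))%:R / (2 ^+ k.+1 * Num.sqrt k.+1%:R) *
   \int[mu]_(x in `[- Num.sqrt k.+1%:R, z]) beta_fun_scaled k.+1 a x = scaled_tail k.+1 a z.
Proof.
move=> ak; set r := Num.sqrt _; set c := _ / _ => rz.
have r0 : r != 0 by rewrite gt_eqF // sqrtr_gt0 ltr0n.
rewrite -RintegralZl //; last exact: integrable_beta_fun.
rewrite /Rintegral (@continuous_FTC2 _ _ (scaled_tail k.+1 a)) //.
- rewrite /= [X in _ - X](_ : _ = 0) ?subr0 //.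
  by rewrite /scaled_tail mulNr mulfV // subrr mul0r binomial_tail0.
- apply: continuous_subspaceT => x; apply: cvgM; first exact: cvg_cst.
  exact: continuous_beta_fun_scaled.
- have dG x : derivable (scaled_tail k.+1 a : R -> R^o) x 1 by have [] := is_derive_scaled_tail x ak.
  have cG x : {for x, continuous (scaled_tail k.+1 a)}.
    by apply/differentiable_continuous/derivable1_diffP.
  split=> //; first by apply: cvg_at_right_filter; exact: cG.
  by apply: cvg_at_left_filter; exact: cG.
by move=> x _; rewrite derive1E; have [_ ->] := is_derive_scaled_tail x ak.
Qed.

Lemma measurable_beta_density k a : measurable_fun setT (beta_density k a).
Proof.
apply: (measurable_restrictT _ _).1 => //; apply: measurable_funTS.
apply: measurable_funM => //.
by apply: continuous_measurable_fun; exact: continuous_beta_fun_scaled.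
Qed.

Lemma integrable_beta_density k a : mu.-integrable setT (EFin \o beta_density k a).
Proof.
rewrite -restrict_EFin; apply: (integrable_restrict _ _ _ _).1 => //; rewrite setTI.
exact: (integrableZl _ _ (integrable_beta_fun k a _ _)).
Qed.

Lemma scaled_tail_density k a z : (a <= k)%N -> `|z| <= Num.sqrt k.+1%:R ->
  scaled_tail k.+1 a z * \int[mu]_x beta_density k.+1 a x =
  \int[mu]_(x in `]-oo, z]) beta_density k.+1 a x.
Proof.
move=> ak; rewrite ler_norml => /andP[]; set r := Num.sqrt _ => rz zr.
have r0 : 0 < r by rewrite sqrtr_gt0 ltr0n.
have Ig y : y <= r -> \int[mu]_(x in `]-oo, y]) beta_density k.+1 a x =
     normal_peak 1 * \int[mu]_(x in `[- r, y]) beta_fun_scaled k.+1 a x.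
  move=> yr; rewrite -Rintegral_mkcondr -RintegralZl //; last exact: integrable_beta_fun.
  congr Rintegral; apply/seteqP; split=> x /=; rewrite !in_itv /=.
    by move=> [xy /andP[-> _]].
  by move=> /andP[-> xy]; rewrite xy (le_trans xy yr).
have Ia : \int[mu]_x beta_density k.+1 a x =
    normal_peak 1 * \int[mu]_(x in `[- r, r]) beta_fun_scaled k.+1 a x.
  by rewrite -Rintegral_mkcond -RintegralZl //; exact: integrable_beta_fun.
set c := (k.+1 * 'C(k, a))%:R / (2 ^+ k.+1 * r) : R.
(* At the right endpoint every letter is a zero, so the tail equals 1; this identifies the
   normalising constant. *)
have Br : c * \int[mu]_(x in `[- r, r]) beta_fun_scaled k.+1 a x = 1.
  rewrite integral_beta_fun //; last by rewrite -/r; lra.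
  rewrite /scaled_tail mulfV ?gt_eqF // (_ : (1 + 1) / 2 = 1 :> R); last by field.
  by rewrite binomial_tail1.
have [zr'|rz'] := eqVneq z (- r).
  rewrite Ig // zr' set_itv1 Rintegral_set1 mulr0 /scaled_tail mulNr mulfV ?gt_eqF //.
  by rewrite subrr mul0r binomial_tail0 mul0r.
rewrite -integral_beta_fun //; last by rewrite lt_neqAle eq_sym rz'.
by rewrite Ia Ig // -/c mulrCA mulrAC Br mul1r.
Qed.

End BetaDensity.

(** * Convergence of the beta density to the normal density *)

Section NormalLimit.
Variable R : realType.
Local Notation mu := (@lebesgue_measure R).
Implicit Types (z : R) (k a : nat).

Definition normal_cdf z : R := \int[mu]_(x in `]-oo, z]) normal_pdf 0 1 x.

Definition density_gap k a : R := \int[mu]_x `|beta_density k a x - normal_pdf 0 1 x|.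

Lemma binomial_tail_itv k j (x : R) : 0 <= x <= 1 -> 0 <= binomial_tail k j x <= 1.
Proof.
move=> /andP[x0 x1]; elim: k j => [|k IHk] [|j] /=; rewrite ?lexx ?ler01 //.
by have /andP[? ?] := IHk j; have /andP[? ?] := IHk j.+1; apply/andP; split; nra.
Qed.

Let integrable_gap k a (D : set R) : measurable D ->
  mu.-integrable D (EFin \o (fun x => beta_density k a x - normal_pdf 0 1 x)).
Proof.
move=> mD; apply: (integrableS measurableT) => //.
have := integrableB measurableT (integrable_beta_density R k a) (integrable_normal_pdf (0 : R) 1).
by apply: eq_integrable => // x _ /=; rewrite EFinB.
Qed.

(** With G the tail, A the mass and F the partial integral, GA = F. The gap is paid once for F
    against Phi and once for A against 1, with a bound that does not depend on z. *)
Lemma scaled_tail_normal k a z : (a <= k)%N -> `|z| <= Num.sqrt k.+1%:R ->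
  `|scaled_tail k.+1 a z - normal_cdf z| <= 2 * density_gap k.+1 a.
Proof.
move=> ak zk; have E := scaled_tail_density ak zk.
have r0 : 0 < Num.sqrt k.+1%:R :> R by rewrite sqrtr_gt0 ltr0n.
set G := scaled_tail _ _ _ in E *; set F := \int[mu]_(x in `]-oo, z]) beta_density k.+1 a x in E.
set A := \int[mu]_x beta_density k.+1 a x in E.
have /andP[G0 G1] : 0 <= G <= 1.
  apply: binomial_tail_itv; move: zk; rewrite ler_norml => /andP[z1 z2].
  have : -1 <= z / Num.sqrt k.+1%:R by rewrite ler_pdivlMr // mulN1r.
  have : z / Num.sqrt k.+1%:R <= 1 by rewrite ler_pdivrMr // mul1r.
  by move=> h1 h2; apply/andP; split; lra.
have gap D : measurable D -> `|\int[mu]_(x in D) beta_density k.+1 a x - \int[mu]_(x in D) normal_pdf 0 1 x|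
   <= density_gap k.+1 a.
  move=> mD; rewrite -RintegralB //; last 2 first.
    by apply: (integrableS measurableT) => //; exact: integrable_beta_density.
    by apply: (integrableS measurableT) => //; exact: integrable_normal_pdf.
  apply: (le_trans (le_normr_Rintegral mD (integrable_gap _ _ mD))).
  rewrite Rintegral_mkcond; apply: le_Rintegral => //.
  - rewrite -restrict_EFin; apply: (integrable_restrict _ _ _ _).1 => //.
    by rewrite setTI; exact: (integrable_norm (integrable_gap _ _ mD)).
  - exact: (integrable_norm (integrable_gap _ _ measurableT)).
  move=> x _; rewrite patchE; case: ifP => // _; exact: normr_ge0.
have h1 : `|A - 1| <= density_gap k.+1 a.
  have := gap setT measurableT; rewrite -/A.
  by rewrite [X in A - X](_ : _ = 1) // /Rintegral integral_normal_pdf.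
have h2 : `|F - normal_cdf z| <= density_gap k.+1 a by apply: gap.
have -> : G - normal_cdf z = (F - normal_cdf z) - G * (A - 1) by rewrite -E; ring.
have h3 : `|G * (A - 1)| <= density_gap k.+1 a.
  by rewrite normrM ger0_norm //; apply: le_trans h1; rewrite ler_piMl.
by apply: (le_trans (ler_normB _ _)); lra.
Qed.

(** Apply 1 + t <= exp t at t = -x/(1+x) and invert. *)
Lemma expR_frac_le (x : R) : -1 < x -> expR (x / (1 + x)) <= 1 + x.
Proof.
move=> x1; have x1' : 0 < 1 + x by lra.
rewrite -[leRHS]invrK -[leLHS]invrK lef_pV2 ?posrE ?invr_gt0 ?expR_gt0 // -expRN.
apply: le_trans (expR_ge1Dx _).
by rewrite (_ : 1 - _ = (1 + x)^-1) //; field; rewrite gt_eqF.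
Qed.

(** Group the product as (1 - y^2)^b (1 + y)^m and use 1 + t <= exp t on each factor. *)
Lemma beta_power_ub (y : R) a b m : -1 <= y <= 1 -> (a = b + m)%N ->
  (1 + y) ^+ a * (1 - y) ^+ b <= expR (m%:R * y - b%:R * y ^+ 2).
Proof.
move=> /andP[y1 y2] ->; rewrite exprD mulrAC -exprMn.
have -> : m%:R * y - b%:R * y ^+ 2 = - y ^+ 2 * b%:R + y * m%:R by ring.
rewrite expRD !expRM_natr; apply: ler_pM; rewrite ?exprn_ge0 //; [nra|lra| |].
  rewrite lerXn2r ?nnegrE ?expR_ge0 //; first by nra.
  by apply: le_trans (expR_ge1Dx _); lra.
by rewrite lerXn2r ?nnegrE ?expR_ge0 //; [lra|exact: expR_ge1Dx].
Qed.

Lemma beta_power_lb (y : R) a b m : -1 < y < 1 -> (a = b + m)%N ->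
  expR (m%:R * (y / (1 + y)) - b%:R * (y ^+ 2 / (1 - y ^+ 2))) <= (1 + y) ^+ a * (1 - y) ^+ b.
Proof.
move=> /andP[y1 y2] ->; rewrite (_ : (1 + y) ^+ (b + m) * _ = ((1 + y) * (1 - y)) ^+ b * (1 + y) ^+ m); last first.
  by rewrite exprD exprMn; ring.
have -> : m%:R * (y / (1 + y)) - b%:R * (y ^+ 2 / (1 - y ^+ 2)) =
  (- y ^+ 2 / (1 + - y ^+ 2)) * b%:R + (y / (1 + y)) * m%:R by ring.
have -> : (1 + y) * (1 - y) = 1 + - y ^+ 2 by ring.
rewrite expRD !expRM_natr; apply: ler_pM; rewrite ?exprn_ge0 ?expR_ge0 //.
  by rewrite lerXn2r ?nnegrE ?expR_ge0 //; [nra|apply: expR_frac_le; nra].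
by rewrite lerXn2r ?nnegrE ?expR_ge0 //; [lra|apply: expR_frac_le].
Qed.

Variables (a m : nat -> nat).
Hypothesis am : forall k, (16 <= k)%N -> ((a k < k) && ((a k).*2.+1 == k + m k))%N.
Hypothesis mk : forall k, (16 <= k)%N -> (m k ^ 2 <= k)%N.
Hypothesis m0 : (m k)%:R / Num.sqrt k%:R @[k --> \oo] --> (0 : R).

Let b k := (k.-1 - a k)%N.
Let abm k : (16 <= k)%N -> (a k = b k + m k)%N.
Proof. by move=> k16; have := am k16; rewrite /b; lia. Qed.
Let bE k : (16 <= k)%N -> (b k)%:R = (k%:R - 1 - (m k)%:R) / 2 :> R.
Proof.
move=> k16; have : (k = (b k).*2 + m k + 1)%N by have := am k16; rewrite /b; lia.
by move/(congr1 (fun i : nat => i%:R : R)); rewrite !natrD -muln2 natrM => ->; field.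
Qed.

Let sqrtk k : (16 <= k)%N -> 4 <= Num.sqrt k%:R :> R.
Proof.
move=> k16; rewrite -[4](_ : Num.sqrt 16%:R = _) ?ler_sqrt ?ler_nat //.
by rewrite (_ : 16%:R = 4 ^+ 2) ?sqrtr_sqr ?ger0_norm //; ring.
Qed.

Let bound := normal_peak 1 * expR 2 / normal_peak 2 : R.

(** Since m <= sqrt k and sqrt k >= 4, the exponent is at most |z| - z^2/4, and |z| <= z^2/8 + 2.
    This leaves 2 - z^2/8: the normal shape of standard deviation 2, with the factor exp 2. *)
Lemma beta_density_dominated k z : (16 <= k)%N ->
  `|beta_density k (a k) z| <= bound * normal_pdf 0 2 z.
Proof.
move=> k16; have sk := sqrtk k16; have p1 : 0 < normal_peak 1 :> R by exact: normal_peak_gt0.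
have p2 : 0 < normal_peak 2 :> R by exact: normal_peak_gt0.
have bnd0 : 0 <= bound by rewrite /bound !mulr_ge0 ?expR_ge0 ?invr_ge0 // ltW.
rewrite /beta_density patchE; case: ifPn => [|_]; last first.
  by rewrite normr0 mulr_ge0 // normal_pdf_ge0.
rewrite mem_setE in_itv /= => /andP[z1 z2].
set s := Num.sqrt k%:R in sk z1 z2 *; have s0 : 0 < s by lra.
have y1 : -1 <= z / s by rewrite ler_pdivlMr // mulN1r.
have y2 : z / s <= 1 by rewrite ler_pdivrMr // mul1r.
rewrite normrM (gtr0_norm p1) /beta_fun_scaled -/s ger0_norm; last first.
  by rewrite mulr_ge0 // exprn_ge0 //; lra.
have -> : bound * normal_pdf 0 2 z = normal_peak 1 * (expR 2 * normal_fun 0 2 z).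
  by rewrite normal_pdfE //= /bound; field; rewrite gt_eqF.
apply: ler_wpM2l; first exact: ltW.
have y12 : -1 <= z / s <= 1 by rewrite y1.
apply: (le_trans (beta_power_ub y12 (abm k16))).
rewrite /normal_fun -expRD ler_expR bE // subr0.
have ks : k%:R = s ^+ 2 by rewrite sqr_sqrtr.
have ms : (m k)%:R <= s.
  by rewrite -(ger0_norm (_ : 0 <= (m k)%:R)) // -sqrtr_sqr ler_sqrt // -natrX ler_nat mk.
set M := (m k)%:R in ms *; have M0 : 0 <= M by [].
have -> : M * (z / s) - (k%:R - 1 - M) / 2 * (z / s) ^+ 2 =
   (M / s) * z - ((s ^+ 2 - 1 - M) / s ^+ 2) * (z ^+ 2 / 2).
  by rewrite ks; field; lra.
have h1 : (M / s) * z <= `|z|.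
  apply: (le_trans (ler_norm _)); rewrite normrM ler_piMl //.
  by rewrite ger0_norm ?divr_ge0 ?(ltW s0) // ler_pdivrMr // mul1r.
have h2 : 2^-1 <= (s ^+ 2 - 1 - M) / s ^+ 2.
  by rewrite ler_pdivlMr ?exprn_gt0 //; nra.
have h3 : 0 <= z ^+ 2 / 2 by rewrite divr_ge0 // sqr_ge0.
have h4 := ler_wpM2r h3 h2.
have h5 : `|z| <= z ^+ 2 / 8 + 2.
  by have := sqr_ge0 (`|z| - 4); rewrite sqrrB real_normK ?num_real //; lra.
by lra.
Qed.

Lemma cvg_inv_sqrt : (Num.sqrt k%:R)^-1 @[k --> \oo] --> (0 : R).
Proof.
have k0 : (k%:R^-1 : R) @[k --> \oo] --> (0 : R).
  apply/gtr0_cvgV0; last exact: cvgr_idn.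
  by near=> k; rewrite ltr0n; near: k; exact: nbhs_infty_gt.
rewrite (_ : (fun k => _) = (fun k : nat => Num.sqrt (k%:R^-1 : R))); last first.
  by apply/funext => k; rewrite sqrtrV.
have := cvg_comp _ _ k0 (@sqrt_continuous R 0); rewrite sqrtr0; exact.
Unshelve. all: by end_near.
Qed.

Lemma beta_density_cvg z : beta_density k (a k) z @[k --> \oo] --> normal_pdf 0 1 z.
Proof.
pose r k : R := (Num.sqrt k%:R)^-1; pose q k : R := (m k)%:R / Num.sqrt k%:R.
have r0 : r k @[k --> \oo] --> 0 by exact: cvg_inv_sqrt.
have q0 : q k @[k --> \oo] --> 0 by exact: m0.
have zr0 : z * r k @[k --> \oo] --> 0.
  by rewrite -(mulr0 z); apply: cvgM => //; exact: cvg_cst.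
have half : (1 - r k ^+ 2 - q k * r k) / 2 @[k --> \oo] --> ((1 - 0 * 0 - 0 * 0) * 2^-1 : R).
  apply: cvgM; last exact: cvg_cst.
  by apply: cvgB; [apply: cvgB; [exact: cvg_cst|exact: cvgM]|exact: cvgM].
pose U k := q k * z - (1 - r k ^+ 2 - q k * r k) / 2 * z ^+ 2.
pose L k := q k * (z / (1 + z * r k)) - (1 - r k ^+ 2 - q k * r k) / 2 * (z ^+ 2 / (1 - (z * r k) ^+ 2)).
have cU : U k @[k --> \oo] --> - z ^+ 2 / 2.
  rewrite (_ : - z ^+ 2 / 2 = 0 * z - (1 - 0 * 0 - 0 * 0) * 2^-1 * z ^+ 2); last by field.
  by apply: cvgB; apply: cvgM => //; exact: cvg_cst.
have cL : L k @[k --> \oo] --> - z ^+ 2 / 2.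
  rewrite (_ : - z ^+ 2 / 2 = 0 * (z / (1 + 0)) - (1 - 0 * 0 - 0 * 0) * 2^-1 * (z ^+ 2 / (1 - 0 * 0))); last by field.
  apply: cvgB; apply: cvgM => //; apply: cvgM; try exact: cvg_cst.
    by apply: cvgV; [rewrite addr0 oner_neq0|apply: cvgD => //; exact: cvg_cst].
  apply: cvgV; first by rewrite mul0r subr0 oner_neq0.
  by apply: cvgB; [exact: cvg_cst|exact: cvgM].
rewrite normal_pdfE // /normal_fun subr0 expr1n.
have cE V : V k @[k --> \oo] --> - z ^+ 2 / 2 -> normal_peak 1 * expR (V k) @[k --> \oo] --> normal_peak 1 * expR (- z ^+ 2 / (1 *+ 2)).
  move=> cV; apply: cvgM; first exact: cvg_cst.
  exact: (cvg_comp _ _ cV (@continuous_expR R _)).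
apply: (squeeze_cvgr _ (cE _ cL) (cE _ cU)).
near=> k.
have k16 : (16 <= k)%N by near: k; exact: nbhs_infty_ge.
have zr : `|z * r k| < 1 by near: k; exact: cvgr0_norm_lt.
have s0 : 0 < Num.sqrt k%:R :> R by have := sqrtk k16; lra.
have zk : `|z| <= Num.sqrt k%:R.
  by move: zr; rewrite normrM [`|r k|]gtr0_norm ?invr_gt0 // ltr_pdivrMr // mul1r => /ltW.
have zr1 : -1 < z * r k < 1 by rewrite -ltr_norml.
have zr2 : -1 <= z * r k <= 1 by case/andP: zr1 => ? ?; rewrite !ltW.
have bk : (b k)%:R = (1 - r k ^+ 2 - q k * r k) / 2 * k%:R.
  have ks : k%:R = Num.sqrt k%:R ^+ 2 :> R by rewrite sqr_sqrtr.
  rewrite bE // /r /q; move: ks s0; set s := Num.sqrt _ => -> s0; field.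
  by rewrite gt_eqF.
have kr : k%:R * r k ^+ 2 = 1.
  by rewrite /r exprVn sqr_sqrtr // mulfV // pnatr_eq0; lia.
have mq : (m k)%:R * r k = q k by [].
rewrite /beta_density patchE ifT; last by rewrite mem_setE in_itv /= -ler_norml.
rewrite /beta_fun_scaled -/(r k); apply/andP; split; apply: ler_wpM2l; rewrite ?normal_peak_ge0 //.
  apply: le_trans (beta_power_lb zr1 (abm k16)).
  rewrite ler_expR /L bk -mq exprMn; set h := _ / 2; set D := (1 - _)^-1.
  have -> : h * k%:R * (z ^+ 2 * r k ^+ 2 * D) = h * (z ^+ 2 * D) * (k%:R * r k ^+ 2) by ring.
  by rewrite kr mulr1 mulrA mulrAC; lra.
apply: (le_trans (beta_power_ub zr2 (abm k16))).
rewrite ler_expR /U bk -mq exprMn; set h := _ / 2.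
have -> : h * k%:R * (z ^+ 2 * r k ^+ 2) = h * z ^+ 2 * (k%:R * r k ^+ 2) by ring.
by rewrite kr; lra.
Unshelve. all: by end_near.
Qed.

Lemma density_gap_cvg : density_gap k (a k) @[k --> \oo] --> (0 : R).
Proof.
rewrite -(cvg_shiftn 16).
have := @dominated_convergence _ _ R mu setT measurableT
  (fun n x => (beta_density (n + 16) (a (n + 16)) x)%:E) (EFin \o normal_pdf 0 1)
  (fun x => (bound * normal_pdf 0 2 x)%:E).
case.
- by move=> n; apply/measurable_EFinP; exact: measurable_beta_density.
- by apply/measurable_EFinP; exact: measurable_normal_pdf.
- apply: aeW => x _; apply: cvg_EFin; first exact: nearW.
  have := @beta_density_cvg x; rewrite -(cvg_shiftn 16); exact.
- exact: (integrableZl measurableT bound (integrable_normal_pdf (0 : R) 2)).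
- apply: aeW => x n _; rewrite lee_fin beta_density_dominated //; exact: leq_addl.
by move=> _ /fine_cvgP[_ + _]; exact.
Qed.

End NormalLimit.

Section WordLimit.
Variable R : realType.
Local Notation mu := (@lebesgue_measure R).

Lemma word_totalE (w : seq bool) :
  word_total R w = (2 * count_mem false w)%:R - (size w)%:R.
Proof.
elim: w => [|b w IHw]; first by rewrite /word_total /word_walk walk0 muln0 subrr.
rewrite total_cons IHw /= -natr1 !natrM natrD.
by case: b => /=; ring.
Qed.

Lemma normal_cdf_itv (z : R) : 0 <= normal_cdf z <= 1.
Proof.
rewrite /normal_cdf /Rintegral; have Pz : (normal_prob 0 1 `]-oo, z] <= 1)%E.
  exact: probability_le1.
have z0 : (0 <= normal_prob 0 1 `]-oo, z])%E by exact: measure_ge0.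
rewrite -/(normal_prob 0 1 `]-oo, z]) fine_ge0 //=.
by rewrite -[1]/(fine 1%E) fine_le // ge0_fin_numE // (le_lt_trans Pz) // ltry.
Qed.

Lemma mean_indicator_itv (p : R) n (b : pred (seq bool)) : 0 <= p <= 1 ->
  0 <= mean p n (fun w => (b w)%:R) <= 1.
Proof.
move=> p01; rewrite mean_ge0 //=; apply: (@le_trans _ _ (mean p n (fun=> 1))).
  by apply: le_mean => // w _; case: (b w).
by rewrite mean_cst.
Qed.

(** A threshold [e k] of smaller order than sqrt k does not change the normal limit. For k < 16 the
    error bound is simply 1. *)
Lemma mean_total_normal (e : nat -> nat) :
  (forall k, (16 <= k)%N -> ((e k).+1 ^ 2 <= k)%N) ->
  ((e k).+1%:R / Num.sqrt k%:R @[k --> \oo] --> (0 : R)) ->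
  exists eps : nat -> R, (eps k @[k --> \oo] --> (0 : R)) /\
    forall k z, `|z| <= Num.sqrt k%:R ->
      `|mean (2^-1 - z / (2 * Num.sqrt k%:R)) k (fun w => ((e k)%:R < word_total R w)%R%:R)
        - normal_cdf z| <= eps k.
Proof.
(* A word of length k has total above [e k] exactly when it has more than [a k] zeros; [m] is the
   resulting asymmetry of the two exponents in the beta integrand. *)
move=> ek e0; pose a k := (k + e k)%N./2; pose m k := ((a k).*2.+1 - k)%N.
have me k : (m k <= (e k).+1)%N by rewrite /m /a; lia.
have am k : (16 <= k)%N -> ((a k < k) && ((a k).*2.+1 == k + m k))%N.
  by move=> k16; have := ek k k16; rewrite /m /a; nia.
have mk k : (16 <= k)%N -> (m k ^ 2 <= k)%N.
  by move=> k16; apply: leq_trans (ek k k16); rewrite leq_exp2r.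
have m0 : (m k)%:R / Num.sqrt k%:R @[k --> \oo] --> (0 : R).
  apply: (squeeze_cvgr _ (cvg_cst 0) e0).
  by apply: nearW => k; rewrite divr_ge0 //= ler_wpM2r ?invr_ge0 ?sqrtr_ge0 // ler_nat.
exists (fun k => if (16 <= k)%N then 2 * density_gap R k (a k) else 1); split.
  have := density_gap_cvg am mk m0 => gap0.
  have c0 : 2 * density_gap R k (a k) @[k --> \oo] --> (0 : R).
    by rewrite -(mulr0 2); apply: cvgM => //; exact: cvg_cst.
  apply: cvg_trans c0; apply: near_eq_cvg; near=> k.
  by rewrite ifT //; near: k; exact: nbhs_infty_ge.
move=> k z zk; have [k16|k16] := leqP 16 k; last first.
  have s0 : 0 <= Num.sqrt k%:R :> R by exact: sqrtr_ge0.
  have p01 : 0 <= 2^-1 - z / (2 * Num.sqrt k%:R) <= 1.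
    have [->|s1] := eqVneq (Num.sqrt k%:R) (0 : R); first by rewrite mulr0 invr0; lra.
    have s2 : 0 < Num.sqrt k%:R :> R by rewrite lt_def s1.
    have -> : z / (2 * Num.sqrt k%:R) = (z / Num.sqrt k%:R) / 2 by field.
    have : `|z / Num.sqrt k%:R| <= 1 by rewrite normrM normfV (ger0_norm s0) ler_pdivrMr // mul1r.
    by rewrite ler_norml => /andP[? ?]; apply/andP; split; lra.
  rewrite ler_distl; have /andP[h1 h2] := normal_cdf_itv z.
  by have /andP[h3 h4] := mean_indicator_itv k (fun w => (e k)%:R < word_total R w) p01; lra.
have s0 : 0 < Num.sqrt k%:R :> R by rewrite sqrtr_gt0 ltr0n; lia.
rewrite (_ : mean _ _ _ = scaled_tail k (a k) z).
  case: k k16 zk {s0} => // k k16 zk; apply: scaled_tail_normal => //.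
  by case/andP: (am _ k16).
rewrite /scaled_tail -mean_binomial_tail (_ : 2^-1 - _ = 1 - (1 + z / Num.sqrt k%:R) / 2); last first.
  by field; rewrite gt_eqF.
apply: eq_mean => w sw; congr (_%:R); congr nat_of_bool.
rewrite word_totalE sw ltrBrDl -natrD ltr_nat /a.
by apply/idP/idP; lia.
Unshelve. all: by end_near.
Qed.

End WordLimit.

(** * Limit of the excess probabilities *)

Lemma integer_root (d : nat) : (0 < d)%N ->
  exists s : nat -> nat, forall n, (s n ^ d <= n < (s n).+1 ^ d)%N.
Proof.
move=> d0; suff /boolp.choice[s Hs] : forall n, exists s, (s ^ d <= n < s.+1 ^ d)%N by exists s.
move=> n.
have ex0 : exists s, (s ^ d <= n)%N by exists 0%N; rewrite exp0n.
have bd s : (s ^ d <= n)%N -> (s <= n)%N.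
  by apply: leq_trans; rewrite -{1}(expn1 s); case: s => [|s]; [rewrite expn1|rewrite leq_pexp2l].
case: (ex_maxnP ex0 bd) => s sn smax; exists s; rewrite sn ltnNge.
by apply/negP => /smax; rewrite ltnn.
Qed.

(** * Averages over word lengths *)

Section Averages.
Variable R : realType.

Lemma average_cvg0 (u : nat -> R) : u k @[k --> \oo] --> (0 : R) ->
  (\sum_(k < n) u k) / n%:R @[n --> \oo] --> (0 : R).
Proof.
move=> u0; rewrite -(cvg_shiftn 1 (fun n => (\sum_(k < n) u k) / n%:R)).
apply: cvg_trans (cesaro u0); apply: near_eq_cvg; apply: nearW => n /=.
by rewrite addn1 /arithmetic_mean /series /= big_mkord mulrC.
Qed.

Lemma inv_sqrt_scale_cvg0 (C : R) : C / Num.sqrt k.+1%:R @[k --> \oo] --> (0 : R).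
Proof.
rewrite -(mulr0 C); apply: cvgM; first exact: cvg_cst.
have := @cvg_inv_sqrt R; rewrite -(cvg_shiftn 1 (fun k => (Num.sqrt k%:R)^-1)) /=.
by under eq_cvg do rewrite addn1.
Qed.

Variable lambda : R.

Definition normal_average n : R :=
  (\sum_(k < n) normal_cdf (lambda * (Num.sqrt k.+1%:R / Num.sqrt n%:R))) / n%:R.

Let p n : R := 2^-1 - lambda / (2 * Num.sqrt n%:R).
Let C := 1 + lambda ^+ 2.

(** Take c to be the square root of the length in [mean_abs_total]. The bias 1 - 2p is lambda/sqrt
    n, so the drift contributes at most the order of the fluctuations; the range beyond n is there
    for words of length n+1. *)
Lemma mean_abs_total_le n k : (0 < n)%N -> (k < n + n)%N -> 0 <= p n <= 1 ->
  k.+1%:R^-1 * mean (p n) k.+1 (fun w => `|word_total R w|) <= C / Num.sqrt k.+1%:R.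
Proof.
move=> n0 kn p01; have s0 : 0 < Num.sqrt k.+1%:R :> R by rewrite sqrtr_gt0.
rewrite ler_pdivrMl ?ltr0n //; apply: (le_trans (mean_abs_total p01 k.+1 s0)).
have n0R : 0 < n%:R :> R by rewrite ltr0n.
have d2 : (1 - 2 * p n) ^+ 2 = lambda ^+ 2 / n%:R.
  rewrite -[X in _ / X](@sqr_sqrtr _ n%:R) // /p; field.
  by rewrite gt_eqF // sqrtr_gt0.
have ks : k.+1%:R = Num.sqrt k.+1%:R ^+ 2 :> R by rewrite sqr_sqrtr.
have kn2 : k.+1%:R * (1 - 2 * p n) ^+ 2 <= 2 * lambda ^+ 2.
  rewrite d2 mulrCA mulrC ler_wpM2r ?sqr_ge0 // ler_pdivrMr //.
  by rewrite -natrM ler_nat; lia.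
move: ks kn2; set s := Num.sqrt _ in s0 *; set d := (1 - 2 * p n) ^+ 2 => -> kn2.
rewrite -subr_ge0 (_ : _ - _ = s * (lambda ^+ 2 - s ^+ 2 * d / 2)); last first.
  by rewrite /C; field; rewrite gt_eqF.
by rewrite mulr_ge0 //; lra.
Qed.

Lemma mean_argmax_sum (q : R) n : 0 <= q <= 1 ->
  mean q n (fun w => (argmax R w)%:R) =
  \sum_(k < n) mean q k.+1 (fun w => (0 < word_total R w)%R%:R).
Proof.
move=> q01; elim: n => [|n IHn]; last by rewrite mean_argmax // IHn big_ord_recr.
rewrite mean0 big_ord0 /argmax.
by have [] := first_near_max_spec (word_walk R [::]) 0 (lexx 0); rewrite leqn0 => /eqP ->.
Qed.

Lemma mean_near_argmax_sum (q K : R) n : 0 <= q <= 1 -> 0 <= K ->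
  \sum_(k < n) mean q k.+1 (fun w => (K < word_total R w)%R%:R) <=
  mean q n (fun w => (near_argmax K w)%:R).
Proof.
move=> q01 K0; elim: n => [|n IHn]; first by rewrite mean0 big_ord0.
by rewrite big_ord_recr /=; apply: le_trans (mean_near_argmax q01 n K0); rewrite lerD2r.
Qed.

Lemma mean_word_max_sum n j : (0 < n)%N -> 0 <= p n <= 1 -> (j <= n)%N ->
  mean (p n) j (@word_max R) <= \sum_(k < j) C / Num.sqrt k.+1%:R.
Proof.
move=> n0 p01; elim: j => [|j IHj] jn.
  rewrite mean0 big_ord0 /word_max /maximum.
  have [] := first_near_max_spec (word_walk R [::]) 0 (lexx 0); rewrite leqn0 => /eqP -> _ _.
  by rewrite /word_walk walk0.
rewrite mean_word_max // big_ord_recr /=; apply: lerD; first exact: IHj (ltnW jn).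
apply: le_trans (mean_abs_total_le n0 _ p01); last by lia.
rewrite ler_wpM2l //; apply: le_mean => // w _.
by case: ifP => _; rewrite ?ler_norm.
Qed.

(** The parameter is tuned to length n; seen from length k+1 it is a normal scaling with the smaller
    argument z. *)
Lemma normal_average_scale n k : (0 < n)%N -> 0 <= p n <= 1 ->
  let z := lambda * (Num.sqrt k.+1%:R / Num.sqrt n%:R) in
  p n = 2^-1 - z / (2 * Num.sqrt k.+1%:R) /\ `|z| <= Num.sqrt k.+1%:R.
Proof.
move=> n0 p01 z; have s0 : 0 < Num.sqrt k.+1%:R :> R by rewrite sqrtr_gt0.
have n0R : 0 < Num.sqrt n%:R :> R by rewrite sqrtr_gt0 ltr0n.
have pz : p n = 2^-1 - z / (2 * Num.sqrt k.+1%:R).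
  by rewrite /p /z; field; rewrite !gt_eqF.
split=> //; have -> : z = (1 - 2 * p n) * Num.sqrt k.+1%:R.
  by rewrite pz; field; rewrite gt_eqF.
rewrite normrM (gtr0_norm s0) ler_piMl ?sqrtr_ge0 //.
by case/andP: p01 => ? ?; rewrite ler_norml; apply/andP; split; lra.
Qed.

Definition outcome_prob n (A : pred (word3 n)) : R :=
  \sum_(w : word3 n | A w) initial_pmf (p n) w.

Lemma outcome_probE n (A : pred (word3 n)) : outcome_prob A =
  \sum_(w' : word2 n) (\prod_(i < n) bernoulli_pmf (p n) (tnth w' i)) * position_prob R A w'.
Proof.
rewrite /outcome_prob /initial_pmf exchange_big /=; apply: eq_bigr => w' _.
rewrite /position_prob mulr_sumr (exchange_big_dep (fun u => A (put1 w' u))) /=; last first.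
  by move=> w u Aw /eqP ->.
apply: eq_bigr => u Au; rewrite (big_pred1 (put1 w' u)) // => w.
by rewrite /= eq_sym; case: eqP => [->|]; rewrite ?Au ?andbF.
Qed.

End Averages.

Section OutcomeLimit.
Variables (R : realType) (lambda : R).
Let p n : R := 2^-1 - lambda / (2 * Num.sqrt n%:R).
Let C := 1 + lambda ^+ 2.

Lemma integer_root_cvg (d : nat) (s : nat -> nat) :
  (forall n, (s n ^ d <= n < (s n).+1 ^ d)%N) -> s n @[n --> \oo] --> \oo.
Proof.
move=> Hs; apply/cvgnyPge => A; near=> n.
have An : (A ^ d <= n)%N by near: n; exact: nbhs_infty_ge.
have /andP[_ h] := Hs n; rewrite leqNgt; apply/negP => sA.
have d0 : (0 < d)%N by case: (d) Hs => // /(_ 1%N); rewrite !expn0.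
by have := leq_ltn_trans An h; rewrite ltn_exp2r // ltnS leqNgt sA.
Unshelve. all: by end_near.
Qed.

Lemma cube_root_cvg0 (e : nat -> nat) : (forall n, (e n ^ 3 <= n < (e n).+1 ^ 3)%N) ->
  (e k).+1%:R / Num.sqrt k%:R @[k --> \oo] --> (0 : R).
Proof.
move=> He; have ey := integer_root_cvg He.
have h0 : 2 * (Num.sqrt (e k)%:R)^-1 @[k --> \oo] --> (0 : R).
  rewrite -(mulr0 2); apply: cvgM; first exact: cvg_cst.
  exact: (cvg_comp _ _ ey (@cvg_inv_sqrt R)).
apply: (squeeze_cvgr _ (cvg_cst 0) h0); near=> k.
have e1 : (0 < e k)%N by near: k; move/cvgnyPgt : ey; apply.
have e0 : 0 < Num.sqrt (e k)%:R :> R by rewrite sqrtr_gt0 ltr0n.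
have /andP[ek _] := He k; have k0 : (0 < k)%N by apply: leq_trans ek; rewrite expn_gt0 e1.
have k0R : 0 < Num.sqrt k%:R :> R by rewrite sqrtr_gt0 ltr0n.
rewrite divr_ge0 //= ler_pdivrMr // mulrAC ler_pdivlMr //.
have h1 : (e k)%:R * Num.sqrt (e k)%:R <= Num.sqrt k%:R :> R.
  rewrite -{1}(ger0_norm (_ : 0 <= (e k)%:R :> R)) // -sqrtr_sqr -sqrtrM ?sqr_ge0 //.
  by rewrite ler_sqrt // -exprSr -natrX ler_nat.
have h2 : (e k).+1%:R <= 2 * (e k)%:R :> R by rewrite -natrM ler_nat; lia.
by apply: (le_trans (ler_wpM2r (ltW e0) h2)); rewrite -mulrA ler_wpM2l.
Unshelve. all: by end_near.
Qed.

Lemma root_inv_cvg0 (d : nat) (s : nat -> nat) :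
  (forall n, (s n ^ d <= n < (s n).+1 ^ d)%N) -> (s n)%:R^-1 @[n --> \oo] --> (0 : R).
Proof.
move=> Hs; apply: (cvg_comp _ (fun k : nat => k%:R^-1 : R) (integer_root_cvg Hs)).
apply/gtr0_cvgV0; last exact: cvgr_idn.
by near=> k; rewrite ltr0n; near: k; exact: nbhs_infty_gt.
Unshelve. all: by end_near.
Qed.

Lemma geometric_cvg0 (K : nat -> nat) : (forall n, (K n ^ 4 <= n < (K n).+1 ^ 4)%N) ->
  n.+1%:R * (3 / 4) ^+ K n @[n --> \oo] --> (0 : R).
Proof.
move=> HK; have Ky := integer_root_cvg HK.
pose B : R := 16 * 120 * 4 ^+ 5.
have h0 : B * (K n)%:R^-1 @[n --> \oo] --> (0 : R).
  by rewrite -(mulr0 B); apply: cvgM; [exact: cvg_cst|exact: root_inv_cvg0 HK].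
apply: (squeeze_cvgr _ (cvg_cst 0) h0); near=> n.
have K1 : (0 < K n)%N by near: n; move/cvgnyPgt : Ky; apply.
have q0 : 0 <= 3 / 4 :> R by lra.
have /andP[_ Kn] := HK n; rewrite mulr_ge0 ?exprn_ge0 //=.
set k := K n in K1 Kn *; have k0 : 0 < k%:R :> R by rewrite ltr0n.
have h1 : n.+1%:R <= 16 * k%:R ^+ 4 :> R.
  rewrite -[16](_ : 2 ^+ 4 = _ :> R); last by ring.
  rewrite -exprMn -natrM -natrX ler_nat; apply: leq_trans Kn _.
  by rewrite leq_exp2r //; lia.
have h2 : (3 / 4) ^+ k <= (expR (k%:R / 4))^-1 :> R.
  rewrite -expRN (_ : - (k%:R / 4) = - 4^-1 * k%:R); last by ring.
  rewrite expRM_natr lerXn2r ?nnegrE ?expR_ge0 //.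
  by apply: le_trans (expR_ge1Dx _); lra.
have h3 : k%:R ^+ 5 / (4 ^+ 5 * 120) <= expR (k%:R / 4) :> R.
  have := @expR_ge1Dxn R (k%:R / 4) 4; rewrite expr_div_n (_ : 5`!%:R = 120); last by rewrite factE.
  move=> /(_ _) h; apply: le_trans (h _); last by rewrite divr_ge0.
  by rewrite invfM mulrA; lra.
(* The quartic growth of n in K loses against the degree five term of the exponential series, which
   leaves B/K. *)
apply: (le_trans (ler_pM _ _ h1 h2)); rewrite ?exprn_ge0 //.
rewrite ler_pdivrMr ?expR_gt0 //.
have B0 : 0 <= B * k%:R^-1 by rewrite mulr_ge0 // ?invr_ge0 // /B !mulr_ge0.
apply: le_trans (ler_wpM2l B0 h3); rewrite le_eqVlt; apply/orP; left; apply/eqP.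
by rewrite /B; field; rewrite gt_eqF.
Unshelve. all: by end_near.
Qed.

Lemma count_below n B : (\sum_(k < n) ((k < B)%N : nat) <= B)%N.
Proof.
suff -> : (\sum_(k < n) ((k < B)%N : nat) = minn n B)%N by exact: geq_minr.
elim: n => [|n IHn]; first by rewrite big_ord0 min0n.
by rewrite big_ord_recr /= IHn; case: ltnP; lia.
Qed.

Variable theta : R.
Hypothesis average : normal_average lambda n @[n --> \oo] --> theta.

Lemma parameter_near : \forall n \near \oo, (0 < n)%N /\ 1 / 4 <= p n <= 3 / 4.
Proof.
have p0 : p n @[n --> \oo] --> (2^-1 - (lambda / 2) * 0 : R).
  rewrite (_ : p = (fun n => 2^-1 - lambda / 2 * (Num.sqrt n%:R)^-1)); last first.
    by apply/funext => n; rewrite /p invfM; ring.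
  by apply: cvgB; [exact: cvg_cst|apply: cvgM; [exact: cvg_cst|exact: cvg_inv_sqrt]].
rewrite mulr0 subr0 in p0.
near=> n; split; first by near: n; exact: nbhs_infty_gt.
have : `|2^-1 - p n| < 1 / 4.
  by near: n; move/cvgrPdist_lt : p0; apply; lra.
by rewrite ltr_norml => /andP[h1 h2]; apply/andP; split; lra.
Unshelve. all: by end_near.
Qed.

Let average_inv_sqrt (c : R) : (\sum_(k < n) c / Num.sqrt k.+1%:R) / n%:R @[n --> \oo] --> (0 : R).
Proof. exact: (average_cvg0 (@inv_sqrt_scale_cvg0 R c)). Qed.

Let inv_sqrt_cvg0 (c : R) : c / Num.sqrt n%:R @[n --> \oo] --> (0 : R).
Proof.
by rewrite -(mulr0 c); apply: cvgM; [exact: cvg_cst|exact: cvg_inv_sqrt].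
Qed.

Lemma mean_abs_total_scaled n : (0 < n)%N -> 0 <= p n <= 1 ->
  mean (p n) n (fun w => `|word_total R w| / n%:R) <= C / Num.sqrt n%:R.
Proof.
move=> n0 p01; rewrite (@eq_mean _ _ _ _ (fun w => n%:R^-1 * `|word_total R w|)); last by move=> w _; rewrite mulrC.
case: n n0 p01 => // n n0 p01; rewrite meanZ.
by apply: mean_abs_total_le => //; lia.
Qed.

Let mean_argmax_average (eps : nat -> R) n : (0 < n)%N -> 0 <= p n <= 1 ->
  (forall k z, `|z| <= Num.sqrt k%:R ->
     `|mean (2^-1 - z / (2 * Num.sqrt k%:R)) k (fun w => (0 < word_total R w)%R%:R) - normal_cdf z| <= eps k) ->
  mean (p n) n (fun w => (argmax R w)%:R / n%:R) <=
  normal_average lambda n + (\sum_(k < n) eps k.+1) / n%:R.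
Proof.
move=> n0 p01 Heps.
rewrite (@eq_mean _ _ _ _ (fun w => n%:R^-1 * (argmax R w)%:R)); last by move=> w _; rewrite mulrC.
rewrite meanZ mean_argmax_sum // /normal_average -mulrDl mulrC ler_wpM2r ?invr_ge0 //.
rewrite -big_split; apply: ler_sum => k _ /=.
have [pz zk] := normal_average_scale k n0 p01.
by have := Heps _ _ zk; rewrite -pz ler_distl => /andP[]; lra.
Qed.

(** For lengths from K^3 on, [e] is at least K, so P(S > K) is at least P(S > e), which is close to
    Phi. The K^3 shorter lengths are given up at cost 1 each. *)
Let mean_near_argmax_average (e : nat -> nat) (eps : nat -> R) (K n : nat) :
  (0 < n)%N -> 0 <= p n <= 1 -> (forall k, (e k ^ 3 <= k < (e k).+1 ^ 3)%N) ->
  (forall k z, `|z| <= Num.sqrt k%:R ->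
     `|mean (2^-1 - z / (2 * Num.sqrt k%:R)) k (fun w => ((e k)%:R < word_total R w)%R%:R) - normal_cdf z| <= eps k) ->
  normal_average lambda n - (\sum_(k < n) eps k.+1) / n%:R - (K ^ 3)%:R / n%:R <=
  mean (p n) n (fun w => (near_argmax (K%:R : R) w)%:R / n%:R).
Proof.
move=> n0 p01 He Heps.
rewrite (@eq_mean _ _ _ _ (fun w => n%:R^-1 * (near_argmax (K%:R : R) w)%:R)); last by move=> w _; rewrite mulrC.
rewrite meanZ [leRHS]mulrC /normal_average -!mulrBl ler_wpM2r ?invr_ge0 //.
apply: le_trans (mean_near_argmax_sum n p01 (ler0n R K)).
apply: (@le_trans _ _ (\sum_(k < n) normal_cdf (lambda * (Num.sqrt k.+1%:R / Num.sqrt n%:R)) -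
   \sum_(k < n) eps k.+1 - (\sum_(k < n) ((k < K ^ 3)%N : nat))%:R)).
  by rewrite lerD2l lerN2 ler_nat count_below.
rewrite natr_sum -!sumrB; apply: ler_sum => k _.
have /= [pz zk] := normal_average_scale k n0 p01.
have /andP[m0 m1] := mean_indicator_itv k.+1 (fun w => (K%:R < word_total R w)) p01.
have /andP[c0 c1] := normal_cdf_itv (lambda * (Num.sqrt k.+1%:R / Num.sqrt n%:R)).
have := Heps _ _ zk; rewrite -pz => hk.
have eps0 : 0 <= eps k.+1 by apply: le_trans hk.
have [kK|kK] := ltnP k (K ^ 3); first by rewrite /=; lra.
rewrite subr0; apply: (@le_trans _ _ (mean (p n) k.+1 (fun w => ((e k.+1)%:R < word_total R w)%R%:R))).
  by move: hk; rewrite ler_distl => /andP[]; lra.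
apply: le_mean => // w _; case: (ltP (e k.+1)%:R _) => [ew|_]; last by [].
rewrite (le_lt_trans _ ew) // ler_nat -ltnS; have /andP[_ h] := He k.+1.
by rewrite -(@ltn_exp2r _ _ 3) //; apply: leq_ltn_trans h; rewrite (leq_trans kK).
Qed.

Lemma outcome_prob_cvg :
  outcome_prob lambda (fun w : word3 n => excess R w == 0) @[n --> \oo] --> theta /\
  outcome_prob lambda (fun w : word3 n => excess R w != 1) @[n --> \oo] --> theta.
Proof.
(* [e] of order k^(1/3) is o(sqrt k). [K] of order n^(1/4) makes K^3/n vanish, while (n+1)(3/4)^K
   still tends to 0. *)
have [e He] := @integer_root 3 isT; have [K HK] := @integer_root 4 isT.
have cst1_cvg : 1%:R / Num.sqrt k%:R @[k --> \oo] --> (0 : R) by exact: inv_sqrt_cvg0.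
have [|//|eps [eps0 Heps]] := @mean_total_normal R (fun=> 0%N); first by move=> k; rewrite exp1n; lia.
have [||eps' [eps'0 Heps']] := @mean_total_normal R e; [|exact: cube_root_cvg0|].
  move=> k k16; have /andP[h1 h2] := He k.
  have e2 : (2 <= e k)%N.
    rewrite leqNgt; apply/negP => ek.
    have : ((e k).+1 ^ 3 <= 2 ^ 3)%N by rewrite leq_exp2r.
    by rewrite (_ : 2 ^ 3 = 8)%N //; lia.
  move: h1 e2; rewrite !expnS expn0 !muln1; move: (e k) => i h1 i2.
  by have [i3|i3] := leqP i 2; nia.
have avg (u : nat -> R) : u k @[k --> \oo] --> (0 : R) -> (\sum_(k < n) u k.+1) / n%:R @[n --> \oo] --> (0 : R).
  move=> u0; apply: (@average_cvg0 R (fun k => u k.+1)).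
  by move: u0; rewrite -(cvg_shiftn 1) /=; under eq_cvg do rewrite addn1.
pose lb n := normal_average lambda n - (\sum_(k < n) eps' k.+1) / n%:R - (K n ^ 3)%:R / n%:R
   - C / Num.sqrt n%:R - C / Num.sqrt n%:R - n.+1%:R * (3 / 4) ^+ K n.
pose ub n := normal_average lambda n + (\sum_(k < n) eps k.+1) / n%:R
   + (\sum_(k < n) C / Num.sqrt k.+1%:R) / n%:R + C / Num.sqrt n%:R + 4 * (C / Num.sqrt n.+1%:R).
have lb_cvg : lb n @[n --> \oo] --> theta.
  rewrite -[theta](_ : theta - 0 - 0 - 0 - 0 - 0 = _); last by ring.
  apply: cvgB; last exact: geometric_cvg0.
  apply: cvgB; last exact: inv_sqrt_cvg0.
  apply: cvgB; last exact: inv_sqrt_cvg0.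
  apply: cvgB; last first.
    apply: (squeeze_cvgr _ (cvg_cst 0) (root_inv_cvg0 HK)); near=> n.
    have K1 : (0 < K n)%N.
      by near: n; move/cvgnyPgt : (integer_root_cvg HK); apply.
    have /andP[Kn _] := HK n; have n0 : (0 < n)%N by apply: leq_trans Kn; rewrite expn_gt0 K1.
    rewrite divr_ge0 //= ler_pdivrMr ?ltr0n // mulrC ler_pdivlMr ?ltr0n //.
    by rewrite -natrM ler_nat -expnSr.
  by apply: cvgB => //; exact: avg.
have ub_cvg : ub n @[n --> \oo] --> theta.
  rewrite -[theta](_ : theta + 0 + 0 + 0 + 4 * 0 = _); last by ring.
  apply: cvgD; last by apply: cvgM; [exact: cvg_cst|exact: inv_sqrt_scale_cvg0].
  apply: cvgD; last exact: inv_sqrt_cvg0.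
  apply: cvgD; last exact: average_inv_sqrt.
  by apply: cvgD => //; exact: avg.
have wt_ge0 n (w : word2 n) : 0 <= p n <= 1 -> 0 <= \prod_(i < n) bernoulli_pmf (p n) (tnth w i).
  by move=> p01; apply: prodr_ge0 => i _; exact: bernoulli_pmf_ge0.
have lbP : \forall n \near \oo, lb n <= outcome_prob lambda (fun w : word3 n => excess R w == 0).
  near=> n; have [n0 p34] : (0 < n)%N /\ 1 / 4 <= p n <= 3 / 4 by near: n; exact: parameter_near.
  have p01 : 0 <= p n <= 1 by case/andP: p34 => ? ?; apply/andP; split; lra.
  pose G (w : seq bool) : R := (near_argmax ((K n)%:R : R) w)%:R / n%:R + ((-1) * (`|word_total R w| / n%:R)
     + ((-1) * (argmax R w == n)%:R + (-1) * \sum_(t < n.+1) (gapless (K n) 0 (drop t w))%:R)).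
  apply: (@le_trans _ _ (mean (p n) n G)); last first.
    rewrite outcome_probE; apply: ler_sum => w _; apply: ler_wpM2l; first exact: wt_ge0.
    by apply: le_trans (position_prob_excess0 R w (K n) n0); rewrite /G; lra.
  rewrite !meanD !meanZ mean_sum.
  have h1 := mean_near_argmax_average (K n) n0 p01 He Heps'.
  have h2 := mean_abs_total_scaled n0 p01.
  have h3 : mean (p n) n (fun w => (argmax R w == n)%:R) <= C / Num.sqrt n%:R.
    case: (n) n0 p01 => // n' n0 p01; apply: (le_trans (mean_argmax_last p01 n')).
    by apply: mean_abs_total_le => //; lia.
  (* Each suffix is again a Bernoulli word, so [mean_gapless] applies with p <= 3/4. *)
  have h4 : \sum_(t < n.+1) mean (p n) n (fun w => (gapless (K n) 0 (drop t w))%:R) <= n.+1%:R * (3 / 4) ^+ K n.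
    rewrite mulr_natl -[n.+1 in leRHS]card_ord -sumr_const; apply: ler_sum => t _.
    rewrite -[X in mean _ X _](subnKC (_ : t <= n)%N) -1?ltnS //.
    rewrite (@mean_drop _ _ t (n - t) (fun w => (gapless (K n) 0 w)%:R)).
    apply: (le_trans (mean_gapless _ _ _ p01)).
    have q0 : 0 <= 3 / 4 :> R by lra.
    by case/andP: p34 => _ p2; case/andP: p01 => p0 _; rewrite lerXn2r ?nnegrE.
  by rewrite /lb; lra.
have ubP : \forall n \near \oo, outcome_prob lambda (fun w : word3 n => excess R w != 1) <= ub n.
  near=> n; have [n0 p34] : (0 < n)%N /\ 1 / 4 <= p n <= 3 / 4 by near: n; exact: parameter_near.
  have p01 : 0 <= p n <= 1 by case/andP: p34 => ? ?; apply/andP; split; lra.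
  pose G (w : seq bool) : R := (argmax R w)%:R / n%:R + (n%:R^-1 * word_max R w
     + (`|word_total R w| / n%:R + (word_max R w <= 0)%R%:R)).
  apply: (@le_trans _ _ (mean (p n) n G)).
    rewrite outcome_probE; apply: ler_sum => w _; apply: ler_wpM2l; first exact: wt_ge0.
    by apply: (le_trans (position_prob_excess1 R w n0)); rewrite /G; lra.
  rewrite !meanD meanZ.
  have h1 := mean_argmax_average n0 p01 Heps.
  have h2 := mean_abs_total_scaled n0 p01.
  have h3 : n%:R^-1 * mean (p n) n (@word_max R) <= (\sum_(k < n) C / Num.sqrt k.+1%:R) / n%:R.
    by rewrite mulrC ler_wpM2r ?invr_ge0 // mean_word_max_sum.
  have h4 : mean (p n) n (fun w => (word_max R w <= 0)%R%:R) <= 4 * (C / Num.sqrt n.+1%:R).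
    have h5 := mean_word_max_le0 p01 n.
    have h6 : n.+1%:R^-1 * mean (p n) n.+1 (fun w => `|word_total R w|) <= C / Num.sqrt n.+1%:R.
      by apply: mean_abs_total_le => //; lia.
    have h7 : 0 <= mean (p n) n (fun w => (word_max R w <= 0)%R%:R) by apply: mean_ge0.
    case/andP: p34 => p1 _; have h8 := ler_wpM2r h7 p1.
    by have := le_trans h5 h6; lra.
  by rewrite /ub; lra.
have le01 : \forall n \near \oo, outcome_prob lambda (fun w : word3 n => excess R w == 0) <=
    outcome_prob lambda (fun w : word3 n => excess R w != 1).
  near=> n; have [n0 p34] : (0 < n)%N /\ 1 / 4 <= p n <= 3 / 4 by near: n; exact: parameter_near.
  have p01 : 0 <= p n <= 1 by case/andP: p34 => ? ?; apply/andP; split; lra.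
  rewrite !outcome_probE; apply: ler_sum => w _; apply: ler_wpM2l; first exact: wt_ge0.
  rewrite /position_prob big_mkcond [leRHS]big_mkcond /=; apply: ler_sum => u _.
  case: eqP => [->|_]; last by case: ifP => // _; exact: position_pmf_ge0.
  by rewrite eq_sym oner_eq0 /=.
split.
  apply: (squeeze_cvgr _ lb_cvg ub_cvg); near=> n; apply/andP; split; first by near: n.
  by apply: (@le_trans _ _ (outcome_prob lambda (fun w : word3 n => excess R w != 1))); near: n.
apply: (squeeze_cvgr _ lb_cvg ub_cvg); near=> n; apply/andP; split; last by near: n.
by apply: (@le_trans _ _ (outcome_prob lambda (fun w : word3 n => excess R w == 0))); near: n.
Unshelve. all: by end_near.
Qed.

End OutcomeLimit.

(** * The maximizer of a path on a grid *)

Section Argmax.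
Variable R : realType.
Implicit Types (f : R -> R) (s u a : R).

Lemma continuous_halfline f a (e : R) : {within `[0, +oo[, continuous f} -> 0 <= a -> 0 < e ->
  exists2 d : R, 0 < d & forall s, 0 <= s -> `|s - a| < d -> `|f s - f a| < e.
Proof.
move=> /continuous_within_itvcyP[cf c0] a0 e0.
have [->|an] := eqVneq a 0.
  move/cvgrPdist_lt : c0 => /(_ e e0)[d /= d0 Hd]; exists d => // s s0 sd.
  have [->|sn] := eqVneq s 0; first by rewrite subrr normr0.
  rewrite distrC; apply: Hd; last by rewrite lt_def sn.
  by rewrite /ball_ /= distrC.
have a0' : a \in `]0, +oo[ by rewrite in_itv /= andbT lt_def an.
have /cvgrPdist_lt/(_ e e0)[d /= d0 Hd] := cf a a0'.
by exists d => // s _ sd; rewrite distrC; apply: Hd; rewrite /ball_ /= distrC.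
Qed.

Lemma continuous_segment01 f : {within `[0, +oo[, continuous f} -> {within `[0, 1], continuous f}.
Proof. by apply: continuous_subspaceW; apply: subset_itvl. Qed.

Lemma argmax01P f : {within `[0, +oo[, continuous f} ->
  0 <= argmax01 f <= 1 /\ forall u, 0 <= u <= 1 -> f u <= f (argmax01 f).
Proof.
move=> cf; have [c] := EVT_max (@ler01 R) (continuous_segment01 cf).
rewrite in_itv /= => c01 cmax.
set S := [set s | 0 <= s <= 1 /\ forall u, 0 <= u <= 1 -> f u <= f s].
have Sc : S c by split=> // u u01; apply: cmax; rewrite in_itv.
have S0 : has_lbound S by exists 0 => s [/andP[]].
have Sn : S !=set0 by exists c.
have a0 : 0 <= argmax01 f by apply: lb_le_inf => // s [/andP[]].
have ac : argmax01 f <= c by exact: ge_inf.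
have a01 : 0 <= argmax01 f <= 1 by rewrite a0 (le_trans ac) //; case/andP: c01.
split=> // u u01; rewrite leNgt; apply/negP => fu.
have fc : 0 < f u - f (argmax01 f) by rewrite subr_gt0.
have [d d0 Hd] := continuous_halfline cf a0 fc.
have [s Ss] := inf_adherent d0 (conj Sn S0); rewrite -/(argmax01 f) => sd.
have sa : argmax01 f <= s by exact: ge_inf.
have [/andP[s0 _] smax] := Ss.
have := Hd s s0; rewrite ger0_norm ?subr_ge0 // ltrBlDl => /(_ sd).
by have := smax u u01; have := ler_norm (f s - f (argmax01 f)); lra.
Qed.

Lemma argmax01_leftmost f u : {within `[0, +oo[, continuous f} ->
  0 <= u -> u < argmax01 f -> f u < f (argmax01 f).
Proof.
move=> cf u0 ua; have [/andP[a0 a1] amax] := argmax01P cf.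
have u01 : 0 <= u <= 1 by rewrite u0 ltW // (lt_le_trans ua).
rewrite lt_neqAle amax // andbT; apply: contraTneq ua => fu; rewrite -leNgt.
apply: ge_inf; first by exists 0 => s [/andP[]].
by split=> // t t01; rewrite fu; exact: amax.
Qed.

(** The index is capped so that every pair of natural numbers names a point of [0, 1]; events can
    then be written as countable unions and intersections without side conditions. *)
Definition grid n i : R := (minn i n.+1)%:R / n.+1%:R.

Lemma grid_itv n i : 0 <= grid n i <= 1.
Proof. by rewrite /grid divr_ge0 //= ler_pdivrMr ?ltr0n // mul1r ler_nat geq_minr. Qed.

Lemma grid_approx n u : 0 <= u <= 1 -> exists2 i, (i <= n.+1)%N & u - n.+1%:R^-1 < grid n i <= u.
Proof.
move=> /andP[u0 u1]; have n0 : 0 < n.+1%:R :> R by [].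
have := truncn_itv (_ : 0 <= u * n.+1%:R); rewrite mulr_ge0 // => /(_ isT).
set i := Num.truncn _ => /andP[h1 h2].
have iN : (i <= n.+1)%N.
  by rewrite -(ler_nat R); apply: le_trans h1 _; rewrite ler_piMl.
exists i => //; rewrite /grid (minn_idPl iN) ler_pdivrMr // h1 andbT.
by rewrite ltr_pdivlMr // mulrBl mulVf ?gt_eqF // ltrBlDr natr1.
Qed.

Lemma cvgn_inv_small (e : R) : 0 < e -> \forall n \near \oo, n.+1%:R^-1 < e.
Proof.
by move=> e0; have /cvgrPdist_lt/(_ e e0) := @cvg_harmonic R; apply: filterS => n;
  rewrite sub0r normrN ger0_norm ?invr_ge0.
Qed.

(** The leftmost maximizer exceeds a exactly when the maximum over [0, a] is strictly smaller than
    the maximum over [0, 1]. By continuity the strict gap is seen on rational points with a margin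
    1/(n+1), which makes the event measurable. *)
Lemma argmax01_gtP f a : {within `[0, +oo[, continuous f} -> 0 <= a -> a < 1 ->
  a < argmax01 f <-> exists n i, forall m j, f (a * grid m j) + n.+1%:R^-1 <= f (grid n i).
Proof.
move=> cf a0 a1; have [/andP[A0 A1] Amax] := argmax01P cf; split=> [aA|[n [i H]]].
  have ca : {within `[0, a], continuous f}.
    by apply: continuous_subspaceW cf; apply: subset_itvl.
  have [c] := EVT_max a0 ca; rewrite in_itv /= => /andP[c0 ca'] cmax.
  have fc := argmax01_leftmost cf c0 (le_lt_trans ca' aA).
  pose e : R := (f (argmax01 f) - f c) / 2; have e0 : 0 < e by rewrite divr_gt0 // subr_gt0.
  have [d d0 Hd] := continuous_halfline cf A0 e0.
  have [n [nd ne]] : exists n, n.+1%:R^-1 < d /\ n.+1%:R^-1 < e.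
    have [n1 _ H1] := cvgn_inv_small d0; have [n2 _ H2] := cvgn_inv_small e0.
    by exists (maxn n1 n2); split; [apply: H1; exact: leq_maxl|apply: H2; exact: leq_maxr].
  have A01 : 0 <= argmax01 f <= 1 by rewrite A0.
  have [i iN /andP[g1 g2]] := grid_approx n A01.
  exists n, i => m j.
  have Hg : `|f (grid n i) - f (argmax01 f)| < e.
    apply: Hd; first by case/andP: (grid_itv n i).
    rewrite ler0_norm ?subr_le0 // opprB; apply: lt_trans nd.
    by rewrite ltrBlDr addrC -ltrBlDr.
  have fj : f (a * grid m j) <= f c.
    have /andP[h0 h1] := grid_itv m j.
    by apply: cmax; rewrite in_itv /= mulr_ge0 //= ler_piMr.
  move: Hg; rewrite ltr_norml => /andP[Hg _].
  have fce : f c + e + e = f (argmax01 f) :> R by rewrite /e; field.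
  have aux (x y z t b r : R) : r < b -> x <= y -> y + b + b = t -> - b < z - t -> x + r <= z by lra.
  exact: (aux _ _ _ _ _ _ ne fj fce Hg).
rewrite ltNge; apply/negP => Aa.
have e0 : 0 < n.+1%:R^-1 :> R by rewrite invr_gt0.
have [d d0 Hd] := continuous_halfline cf A0 e0.
(* The grid on [0, a] is a dilation by a, which degenerates here. *)
have [an|an] := eqVneq a 0.
  have A00 : argmax01 f = 0 by apply/eqP; rewrite eq_le A0 -an Aa.
  have := H 0%N 0%N; rewrite an mul0r -A00.
  have aux (x y r : R) : 0 < r -> x + r <= y -> y <= x -> False by lra.
  by move=> /(aux _ _ _ e0); apply; exact: Amax (grid_itv n i).
have ap : 0 < a by rewrite lt_def an.
have u01 : 0 <= argmax01 f / a <= 1 by rewrite divr_ge0 //= ler_pdivrMr // mul1r.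
have da : 0 < d / a by rewrite divr_gt0.
have [m _ Hm] := cvgn_inv_small da.
have [j _ /andP[g1 g2]] := grid_approx m u01.
have /andP[h0 h1] := grid_itv m j.
have := Hd (a * grid m j) (mulr_ge0 a0 h0).
rewrite ler0_norm ?subr_le0; last by rewrite mulrC -ler_pdivlMr.
have g3 : argmax01 f / a - d / a < grid m j by apply: lt_trans g1; rewrite ltrD2l ltrN2; exact: (Hm m (leqnn m)).
rewrite -mulrBl ltr_pdivrMr // mulrC in g3.
rewrite opprB ltrBlDr => Hf; have := Hf.
have gd : argmax01 f < d + a * grid m j by rewrite addrC -ltrBlDr.
move=> /(_ gd); rewrite ltr_norml => /andP[Hg _].
have aux (x y t r : R) : x + r <= y -> y <= t -> - r < x - t -> False by lra.
exact: (aux _ _ _ _ (H m j) (Amax _ (grid_itv n i)) Hg).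
Qed.

(** Let m be the grid maximizer for drift lambda and A the maximizer for lambda + delta. Optimality
    of A gives delta (m - A) <= f(A) - f(m), with f the path of drift lambda; optimality of m
    against a grid point near A bounds the right side by eta. Uniqueness of maximizers is never
    invoked. *)
Lemma grid_argmax_limit (w : R -> R) (lambda delta eta : R) :
  {within `[0, +oo[, continuous w} -> 0 < eta ->
  \forall n \near \oo, delta * ((first_near_max 0 (fun j => w (j%:R / n.+1%:R) + lambda * (j%:R / n.+1%:R)) n.+1)%:R / n.+1%:R
     - argmax01 (fun s => w s + (lambda + delta) * s)) <= eta.
Proof.
move=> cw eta0; set f := fun s => w s + (lambda + delta) * s.
have cdrift c : {within `[0, +oo[, continuous (fun s => w s + c * s)}.
  move=> s; apply: cvgD; first exact: cw.
  apply: continuous_subspaceT => t; apply: cvgM; [exact: cvg_cst|exact: cvg_id].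
have cf : {within `[0, +oo[, continuous f} by exact: cdrift.
have [A01 Amax] := argmax01P cf; set A := argmax01 f in A01 Amax *.
have /andP[A0 A1] := A01.
have [d d0 Hd] := continuous_halfline (cdrift lambda) A0 eta0.
near=> n.
have [i iN /andP[g1 g2]] := grid_approx n A01.
have nd : n.+1%:R^-1 < d by near: n; exact: cvgn_inv_small.
set g := fun j : nat => _; have [mn mmax _] := first_near_max_spec g n.+1 (lexx 0).
set m := first_near_max _ _ _ in mn mmax *.
have gi : grid n i = i%:R / n.+1%:R by rewrite /grid (minn_idPl iN).
have m01 : 0 <= (m%:R / n.+1%:R : R) <= 1.
  by rewrite divr_ge0 //= ler_pdivrMr ?ltr0n // mul1r ler_nat.
have h1 := mmax i iN; rewrite addr0 /g -gi in h1.
have h2 := Amax _ m01; rewrite /f in h2.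
have /andP[gr0 _] := grid_itv n i.
have h3 : `|w (grid n i) + lambda * grid n i - (w A + lambda * A)| < eta.
  apply: Hd => //; rewrite ler0_norm ?subr_le0 // opprB; apply: lt_trans nd.
  by rewrite ltrBlDr addrC -ltrBlDr.
have aux (wg wx wA y x A' : R) : wg + lambda * y <= wx + lambda * x ->
    wx + (lambda + delta) * x <= wA + (lambda + delta) * A' ->
    - eta < wg + lambda * y - (wA + lambda * A') -> delta * (x - A') <= eta by lra.
by move: h3; rewrite ltr_norml => /andP[h3 _]; exact: (aux _ _ _ _ _ _ h1 h2 h3).
Unshelve. all: by end_near.
Qed.

End Argmax.

(** * Walks with exchangeable increments *)

Section Exchangeable.
Context d (T : measurableType d) (R : realType) (P : probability T R) (k : nat).
Variables (D : 'I_k -> T -> R) (nu : set R -> R).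
Hypothesis mD : forall i, measurable_fun setT (D i).
Hypothesis product_law : forall A : 'I_k -> set R, (forall i, measurable (A i)) ->
  P (\bigcap_i (D i @^-1` A i)) = (\prod_i nu (A i))%:E.

Definition permuted (s : {perm 'I_k}) (t : T) : k.-tuple R := [tuple D (s i) t | i < k].

Lemma measurable_permuted s : measurable_fun setT (permuted s).
Proof.
apply/measurable_fun_tnthP => i; apply: (eq_measurable_fun (D (s i))) => //.
by move=> t _ /=; rewrite tnth_mktuple.
Qed.

Definition boxes : set (set (k.-tuple R)) :=
  [set B | exists A : 'I_k -> set R, (forall i, measurable (A i)) /\
     B = [set x | forall i, A i (tnth x i)]].

Lemma measurable_boxes : @measurable _ (k.-tuple R) = <<s boxes >>.
Proof.
apply/seteqP; split=> B.
  apply: smallest_sub => {B}; first exact: smallest_sigma_algebra.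
  move=> B; have bigU (F : 'I_k -> set (set (k.-tuple R))) x :
      (\big[setU/set0]_(i < k) F i) x -> exists i, F i x.
    by elim/big_rec: _ => // i X _ IH [h|/IH //]; exists i.
  move=> /bigU[i [A mA <-]].
  apply: sub_sigma_algebra; exists (fun j => if j == i then A else setT); split.
    by move=> j; case: ifP.
  apply/seteqP; split=> x /= => [[_ Ax] j|/(_ i)]; first by case: eqP => // ->.
  by rewrite eqxx; split.
apply: smallest_sub => {B}; first exact: sigma_algebra_measurable.
move=> _ [A [mA ->]].
have -> : [set x : k.-tuple R | forall i, A i (tnth x i)] =
    \bigcap_i ((fun x : k.-tuple R => tnth x i) @^-1` A i).
  by apply/seteqP; split=> x /= h i; [move=> _|]; exact: h.
apply: fin_bigcap_measurable => // i _; rewrite -[X in measurable X]setTI.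
exact: measurable_tnth.
Qed.

Lemma boxes_setI : setI_closed boxes.
Proof.
move=> _ _ [A [mA ->]] [B [mB ->]]; exists (fun i => A i `&` B i); split.
  by move=> i; exact: measurableI.
by apply/seteqP; split=> x /= => [[h1 h2] i|h]; [split|split=> i; have [] := h i].
Qed.

(** All factors of the product law are the same [nu], so boxes have the same probability after a
    permutation; boxes form a pi-system generating the product sigma-algebra. *)
Lemma permuted_law s (B : set (k.-tuple R)) : measurable B ->
  P (permuted s @^-1` B) = P (permuted 1%g @^-1` B).
Proof.
move=> mB.
have box s' (A : 'I_k -> set R) : (forall i, measurable (A i)) ->
    P (permuted s' @^-1` [set x | forall i, A i (tnth x i)]) = (\prod_i nu (A i))%:E.
  move=> mA; rewrite (reindex_perm (s'^-1)%g) /=.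
  rewrite -product_law //; congr (P _); apply/seteqP; split=> t /=.
    by move=> h i _ /=; have := h (s'^-1 i)%g; rewrite tnth_mktuple permKV.
  by move=> h i; have /= := h (s' i) I; rewrite tnth_mktuple permK.
have mP s' := measurable_permuted s'.
pose m s' : {measure set (k.-tuple R) -> \bar R} :=
  measure_function_pushforward__canonical__measure_function_Measure P (mP s').
apply: (@measure_unique _ R _ boxes (fun=> setT) measurable_boxes boxes_setI _ _ (m s) (m 1%g)) => //.
- by move=> _; exists (fun=> setT); split=> //; apply/seteqP; split.
- by apply/seteqP; split=> // x _; exists 0%N.
- by move=> _ [A [mA ->]]; rewrite /m /= /pushforward !box.
by move=> _; rewrite /m /= /pushforward preimage_setT probability_setT ltry.
Qed.

Lemma integral_permuted s (F : k.-tuple R -> \bar R) : measurable_fun setT F ->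
  (forall x, 0 <= F x)%E ->
  (\int[P]_t F (permuted s t) = \int[P]_t F (permuted 1%g t))%E.
Proof.
move=> mF F0; have mP s' := measurable_permuted s'.
have E s' : (\int[P]_t F (permuted s' t) = \int[pushforward P (permuted s')]_x F x)%E.
  by rewrite ge0_integral_pushforward // preimage_setT.
rewrite !E; pose m s' : {measure set (k.-tuple R) -> \bar R} :=
  measure_function_pushforward__canonical__measure_function_Measure P (mP s').
apply: (@eq_measure_integral _ _ _ _ (m 1%g) (m s)) => A mA _.
exact: permuted_law.
Qed.

End Exchangeable.

Lemma first_near_max_rec (R : realDomainType) (f : nat -> R) n :
  first_near_max 0 f n.+1 = if maximum f n < f n.+1 then n.+1 else first_near_max 0 f n.
Proof.
have [an Ha mina] := first_near_max_spec f n (lexx 0).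
have Hm i : (i <= n)%N -> f i <= maximum f n by exact: maximum_ge.
have [h|h] := ltP (maximum f n) (f n.+1); apply: first_near_max_uniq => //.
- move=> i; rewrite addr0 leq_eqVlt => /predU1P[-> //|/Hm h1].
  by apply: le_trans h1 (ltW h).
- by move=> j jn; exists n.+1 => //; rewrite addr0; apply: le_lt_trans h; exact: Hm.
- exact: leqW.
- by move=> i; rewrite addr0 leq_eqVlt => /predU1P[-> //|/Hm].
by move=> j /mina[i lin hi]; exists i => //; exact: leqW.
Qed.

Lemma measurable_first_near_max d (T : measurableType d) (R : realType) (f : nat -> T -> R) n : (forall i, measurable_fun setT (f i)) ->
  measurable_fun setT (fun t => (first_near_max 0 (f^~ t) n)%:R : R) /\
  measurable_fun setT (fun t => maximum (f^~ t) n).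
Proof.
move=> mf; elim: n => [|n [IH1 IH2]].
  have E t : first_near_max 0 (f^~ t) 0 = 0%N.
    by have [] := first_near_max_spec (f^~ t) 0 (lexx 0); rewrite leqn0 => /eqP.
  split; last by rewrite /maximum; under eq_fun do rewrite E; exact: mf.
  by under eq_fun do rewrite E; exact: measurable_cst.
have mlt : measurable_fun setT (fun t => maximum (f^~ t) n < f n.+1 t) by exact: measurable_fun_ltr.
split.
  under eq_fun do rewrite first_near_max_rec (fun_if (fun i : nat => i%:R : R)).
  exact: measurable_fun_ifT.
rewrite /maximum; under eq_fun do rewrite first_near_max_rec (fun_if (f^~ _)).
exact: measurable_fun_ifT.
Qed.

(** * Mean argmax of a walk with independent, identically distributed increments *)

Section ArgmaxMean.
Context d (T : measurableType d) (R : realType).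
Variables (P : probability T R) (D : nat -> T -> R) (nu : set R -> R) (c : R).
Hypothesis mD : forall i, measurable_fun setT (D i).
Hypothesis product_law : forall k (A : 'I_k -> set R), (forall i, measurable (A i)) ->
  P (\bigcap_(i in [set: 'I_k]) (D i @^-1` A i)) = (\prod_i nu (A i))%:E.

Definition increments_walk t j : R := walk (fun i => D i t + c) j.

Lemma measurable_increments_walk j : measurable_fun setT (increments_walk ^~ j).
Proof.
rewrite /increments_walk /walk; apply: measurable_sum => i.
by apply: measurable_funD => //; exact: measurable_cst.
Qed.

Let tuple_walk k (x : k.-tuple R) j : R := walk (fun i => nth 0 x i + c) j.

Let measurable_tuple_walk k j : measurable_fun setT (fun x : k.-tuple R => tuple_walk x j).
Proof.
rewrite /tuple_walk /walk; apply: measurable_sum => i; apply: measurable_funD => //.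
have [ik|ki] := ltnP i k; last first.
  by under eq_fun do rewrite nth_default ?size_tuple //; exact: measurable_cst.
apply: (eq_measurable_fun (fun x : k.-tuple R => tnth x (Ordinal ik))).
  by move=> x _; rewrite (tnth_nth 0).
exact: measurable_tnth.
Qed.

Lemma integral_first_near_maxS k :
  (\int[P]_t (first_near_max 0 (increments_walk t) k.+1)%:R%:E =
   \int[P]_t (first_near_max 0 (increments_walk t) k)%:R%:E +
   P [set t | (0 < increments_walk t k.+1)%R])%E.
Proof.
pose a (f : nat -> R) j : R := (first_near_max 0 f j)%:R.
pose G (x : k.+1.-tuple R) : R := a (tuple_walk x) k.+1 - a (tuple_walk x) k.
have G0 x : (0 <= (G x)%:E)%E by rewrite lee_fin subr_ge0 ler_nat first_near_max_le.
have mG : measurable_fun setT (fun x => (G x)%:E).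
  apply/measurable_EFinP; apply: measurable_funB.
    by have [] := measurable_first_near_max k.+1 (@measurable_tuple_walk k.+1).
  by have [] := measurable_first_near_max k (@measurable_tuple_walk k.+1).
pose Dk (i : 'I_k.+1) := D i.
(* Addition in ['I_k.+1] is modulo k+1, so this is the cyclic rotation of the increments. *)
have rotI (r : 'I_k.+1) : injective (fun i : 'I_k.+1 => r + i)%R by move=> i j /addrI.
pose rotp r := perm (rotI r).
pose X t i := D (i %% k.+1)%N t + c.
have walkX t r j : (r < k.+1)%N -> (j <= k.+1)%N ->
   tuple_walk (permuted Dk (rotp (inord r)) t) j = walk (steps_from (X t) r) j.
  move=> rk jk; apply: (eq_walk (n := k.+1)) => // i ik; rewrite /steps_from /X; congr (_ + c).
  rewrite /permuted (nth_mktuple _ _ (Ordinal ik)) /Dk /rotp permE /=.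
  by rewrite inordK.
have X_period t i : X t (i + k.+1)%N = X t i by rewrite /X modnDr.
have walk1 t j : (j <= k.+1)%N -> tuple_walk (permuted Dk 1%g t) j = increments_walk t j.
  move=> jk; apply: (eq_walk (n := k.+1)) => // i ik; congr (_ + c).
  by rewrite /permuted (nth_mktuple _ _ (Ordinal ik)) /Dk perm1.
have walkX0 t : walk (X t) k.+1 = increments_walk t k.+1.
  by apply: (eq_walk (n := k.+1)) => // i ik; rewrite /X modn_small.
have sumG t : \sum_(r < k.+1) G (permuted Dk (rotp r) t) =
    k.+1%:R * (0 < increments_walk t k.+1)%R%:R.
  have := rotation_argmax (X_period t); rewrite walkX0 => rot.
  transitivity (\sum_(r < k.+1) (first_near_max 0 (walk (steps_from (X t) r)) k.+1)%:R -
     \sum_(r < k.+1) (first_near_max 0 (walk (steps_from (X t) r)) k)%:R : R).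
    rewrite -sumrB; apply: eq_bigr => r _; rewrite /G /a; congr (_%:R - _%:R).
      by apply: eq_first_near_max => // j jk; rewrite -walkX // inord_val.
    by apply: eq_first_near_max => // j jk; rewrite -walkX ?inord_val // ltnW.
  by rewrite rot addrC addKr; case: ifP => _; rewrite ?mulr1 ?mulr0.
have mDk i : measurable_fun setT (Dk i) := mD i.
have IG s : (\int[P]_t (G (permuted Dk s t))%:E = \int[P]_t (G (permuted Dk 1%g t))%:E)%E.
  exact: (integral_permuted mDk (@product_law k.+1) s mG G0).
have mb : measurable_fun setT (fun t => (0 < increments_walk t k.+1)%R).
  by apply: measurable_fun_ltr => //; exact: measurable_increments_walk.
have mS : measurable [set t | 0 < increments_walk t k.+1].
  by have := mb measurableT [set true] I; rewrite setTI; congr measurable;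
    apply/seteqP; split=> t /=.
have mGs s : measurable_fun setT (fun t => (G (permuted Dk s t))%:E).
  by apply: (measurableT_comp mG); exact: measurable_permuted.
(* All rotations give [G] the same mean, and pointwise their sum is k+1 times the indicator of a
   positive endpoint. *)
have E1 : (k.+1%:R%:E * \int[P]_t (G (permuted Dk 1%g t))%:E =
    k.+1%:R%:E * P [set t | (0 < increments_walk t k.+1)%R])%E.
  transitivity (\sum_(r < k.+1) \int[P]_t (G (permuted Dk (rotp r) t))%:E)%E.
    rewrite (eq_bigr (fun=> \int[P]_t (G (permuted Dk 1%g t))%:E)%E) //.
    set x := (\int[P]_t _)%E; elim: k.+1 => [|m IHm]; first by rewrite big_ord0 mul0e.
    by rewrite big_ord_recr /= -IHm -natr1 EFinD ge0_muleDl ?lee_fin // mul1e.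
  rewrite -ge0_integral_sum //.
  under eq_integral do rewrite sumEFin sumG EFinM.
  rewrite ge0_integralZl //.
    congr (_ * _)%E; rewrite -[in RHS](setIT [set t | _]) -integral_indic //.
    apply: eq_integral => t _; rewrite indicE; congr ((nat_of_bool _)%:R%:E).
    by apply/idP/idP => [|/set_mem//]; exact: mem_set.
  apply/measurable_EFinP.
  apply: (eq_measurable_fun (fun t => if (0 < increments_walk t k.+1)%R then 1 else 0 : R)).
    by move=> t _; case: ifP.
  exact: measurable_fun_ifT.
have {}E1 : (\int[P]_t (G (permuted Dk 1%g t))%:E = P [set t | (0 < increments_walk t k.+1)%R])%E.
  have k0 : (k.+1%:R : R) != 0 by rewrite pnatr_eq0.
  by move/eqP: E1; rewrite -eqe_pdivrMl // muleA -EFinM mulVf // mul1e => /eqP.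
rewrite -E1 -ge0_integralD //.
- apply: eq_integral => t _; rewrite /G /a -EFinD.
  have E j : (j <= k.+1)%N -> first_near_max 0 (tuple_walk (permuted Dk 1%g t)) j =
      first_near_max 0 (increments_walk t) j.
    by move=> jk; apply: eq_first_near_max => // i ij; rewrite walk1 // (leq_trans ij).
  by rewrite !E // subrKC.
- apply/measurable_EFinP.
  by have [] := measurable_first_near_max k measurable_increments_walk.
Qed.

Lemma integral_first_near_max n :
  (\int[P]_t (first_near_max 0 (increments_walk t) n)%:R%:E =
   \sum_(k < n) P [set t | (0 < increments_walk t k.+1)%R])%E.
Proof.
elim: n => [|n IHn]; last by rewrite integral_first_near_maxS IHn big_ord_recr.
rewrite big_ord0 integral0_eq // => t _.
by have [] := first_near_max_spec (increments_walk t) 0 (lexx 0); rewrite leqn0 => /eqP ->.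
Qed.

End ArgmaxMean.

(** * The maximizer of Brownian motion with drift *)

Section NormalScaling.
Variable R : realType.
Local Notation mu := (@lebesgue_measure R).
Implicit Types (a b sigma z : R).

Lemma normal_cdfE z : (normal_cdf z)%:E = normal_prob 0 1 `]-oo, z].
Proof.
rewrite /normal_cdf /Rintegral -/(normal_prob 0 1 `]-oo, z]) fineK //.
exact: fin_num_measure.
Qed.

Lemma normal_peak_scale sigma : 0 < sigma -> normal_peak sigma = sigma^-1 * normal_peak 1.
Proof.
move=> s0; have peakE s : 0 < s -> normal_peak s = s^-1 * (Num.sqrt (pi *+ 2))^-1 :> R.
  by move=> ?; rewrite /normal_peak -mulrnAr sqrtrM ?sqr_ge0 // sqrtr_sqr gtr0_norm // invfM.
by rewrite !peakE // invr1 mul1r.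
Qed.

Lemma normal_pdf_scale sigma x : 0 < sigma ->
  normal_pdf 0 1 (- sigma^-1 * x) * sigma^-1 = normal_pdf 0 sigma x.
Proof.
move=> s0; rewrite !normal_pdfE ?oner_neq0 ?gt_eqF // [in RHS]normal_peak_scale //.
rewrite mulrC mulrA; congr (_ * expR _); rewrite !subr0.
by field; rewrite gt_eqF.
Qed.

Lemma normal_prob_upper_tail sigma a : 0 < sigma ->
  normal_prob 0 sigma `]a, +oo[ = (normal_cdf (- a / sigma))%:E.
Proof.
move=> s0; rewrite normal_cdfE /normal_prob.
have s1 : - sigma^-1 < 0 :> R by rewrite oppr_lt0 invr_gt0.
pose F : R -> R := fun x => - sigma^-1 * x.
have F' : derive1 F = cst (- sigma^-1).
  apply/funext => x; rewrite derive1E /F.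
  have -> : (fun x : R => - sigma^-1 * x) = (- sigma^-1) \*: (@id R) by [].
  by rewrite deriveZ //= derive_id /GRing.scale /= mulr1.
have -> : - a / sigma = F a by rewrite /F !mulNr mulrC.
rewrite (@decreasing_ge0_integration_by_substitutiony _ F (normal_pdf 0 1) a).
- rewrite integral_itv_obnd_cbnd.
    apply: eq_integral => x _; rewrite F'.
    by rewrite -normal_pdf_scale // -[X in _ * X]opprK.
  apply/measurable_EFinP; apply: measurable_funTS; exact: measurable_normal_pdf.
- by move=> x y _ _ xy; rewrite /F ltr_nM2l.
- by rewrite F' => x _; exact: cst_continuous.
- by rewrite F'; exact: is_cvg_cst.
- by rewrite F'; exact: is_cvg_cst.
- split; first by move=> x _; exact: derivableZ.
  apply: cvg_at_right_filter; rewrite /F; apply: cvgM; [exact: cvg_cst|exact: cvg_id].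
- by apply/cvgrNyPle => A; near=> x; rewrite /F mulNr lerNl ler_pdivlMl //; near: x; exact: nbhs_pinfty_ge.
- apply: continuous_subspaceT; apply: continuous_normal_pdf; exact: oner_neq0.
- by move=> x _; exact: normal_pdf_ge0.
Unshelve. all: by end_near.
Qed.

Lemma normal_cdf_lipschitz a b : a <= b ->
  0 <= normal_cdf b - normal_cdf a <= normal_peak 1 * (b - a).
Proof.
move=> ab; have int1 D : measurable D -> mu.-integrable D (EFin \o normal_pdf 0 1).
  by move=> mD; apply: (integrableS measurableT mD _ (integrable_normal_pdf (0 : R) 1)); exact: subsetT.
rewrite /normal_cdf Rintegral_itvB ?int1 //; apply/andP; split.
  by apply: Rintegral_ge0 => x _; exact: normal_pdf_ge0.
apply: (le_trans (le_Rintegral (f2 := cst (normal_peak 1)) _ _ _ _)) => //.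
- exact: int1.
- apply: measurable_bounded_integrable => //.
    by rewrite /= lebesgue_measure_itv /=; case: ifP => _; rewrite ?ltry // -EFinD ltry.
  by exists (normal_peak 1); split=> [|M Mn]; [exact: num_real|move=> x _ /=]; rewrite ger0_norm ?normal_peak_ge0 // ltW.
- by move=> x _; apply: normal_pdf_ub; exact: oner_neq0.
rewrite Rintegral_cst //= lebesgue_measure_itv /= lte_fin; case: ltP => //= _.
by rewrite mulr0 mulr_ge0 ?normal_peak_ge0 ?subr_ge0.
Qed.

End NormalScaling.

(** * Brownian motion sampled on a mesh *)

Section BrownianAverage.
Context d (T : measurableType d) (R : realType) (P : probability T R).
Variables (W : R -> T -> R) (hW : standard_brownian P W) (lambda : R).

Lemma brownian_positive s : 0 < s ->
  P [set t | (0 < W s t + lambda * s)%R] = (normal_cdf (lambda * Num.sqrt s))%:E.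
Proof.
move=> s0; have ss0 : 0 < Num.sqrt s by rewrite sqrtr_gt0.
have -> : lambda * Num.sqrt s = - (- (lambda * s)) / Num.sqrt (s - 0).
  by rewrite subr0 opprK -{2}(sqr_sqrtr (ltW s0)) expr2 mulrA mulfK // gt_eqF.
rewrite -normal_prob_upper_tail ?subr0 // -[in RHS](subr0 s).
rewrite -(brownian_gaussian hW (lexx 0) s0) //; congr (P _).
apply/seteqP; split=> t /=; rewrite in_itv /= andbT (brownian_start hW) subr0; lra.
Qed.

Let mesh n i : R := i%:R / n%:R.

Definition sampled_walk n t j : R := W (mesh n j) t + lambda * mesh n j.

Lemma measurable_brownian_argmax n :
  measurable_fun setT (fun t => (first_near_max 0 (sampled_walk n t) n)%:R : R).
Proof.
have mf j : measurable_fun setT (fun t => sampled_walk n t j).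
  apply: measurable_funD; last exact: measurable_cst.
  by apply: (brownian_measurable hW); rewrite /mesh divr_ge0.
by have [] := measurable_first_near_max n mf.
Qed.

(** No approximation occurs: the mesh increments are independent with one common normal law, and the
    probability that the path is positive at k/n is exactly the normal value in [normal_average]. *)
Lemma integral_sampled_argmax n : (0 < n)%N ->
  (\int[P]_t ((first_near_max 0 (sampled_walk n t) n)%:R / n%:R)%:E =
   (normal_average lambda n)%:E)%E.
Proof.
move=> n0; have n0R : 0 < n%:R :> R by rewrite ltr0n.
pose D i t := W (mesh n i.+1) t - W (mesh n i) t.
pose nu A := fine (normal_prob 0 (Num.sqrt n%:R^-1) A : \bar R).
have mesh_ge0 i : 0 <= mesh n i by rewrite /mesh divr_ge0.
have meshS i : mesh n i.+1 - mesh n i = n%:R^-1 by rewrite /mesh -natr1; field; rewrite gt_eqF.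
have mesh_lt i : mesh n i < mesh n i.+1 by rewrite -subr_gt0 meshS invr_gt0.
have mD i : measurable_fun setT (D i).
  by apply: measurable_funB; exact: (brownian_measurable hW).
have law k (A : 'I_k -> set R) : (forall i, measurable (A i)) ->
    P (\bigcap_(i in [set: 'I_k]) (D i @^-1` A i)) = (\prod_i nu (A i))%:E.
  move=> mA; rewrite (brownian_independent hW (s := mesh n)) //; last by move=> i; exact: ltW.
  congr (_%:E); apply: eq_bigr => i _; congr fine.
  by rewrite -(meshS i); exact: (brownian_gaussian hW (mesh_ge0 i) (mesh_lt i) (mA i)).
have walkE t j : increments_walk D (lambda / n%:R) t j = sampled_walk n t j.
  rewrite /increments_walk /walk /sampled_walk big_split /= sumr_const card_ord.
  rewrite -(big_mkord xpredT (fun i => D i t)) telescope_sumr // /mesh mul0r (brownian_start hW).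
  by rewrite subr0 -mulr_natr; congr (_ + _); ring.
under eq_integral => t _.
  rewrite mulrC EFinM -(@eq_first_near_max _ _ (increments_walk D (lambda / n%:R) t)) //.
  over.
rewrite ge0_integralZl //; last first.
  apply/measurable_EFinP.
  by have [] := measurable_first_near_max n (measurable_increments_walk (lambda / n%:R) mD).
rewrite (integral_first_near_max _ mD law) /normal_average.
rewrite (eq_bigr (fun k : 'I_n => (normal_cdf (lambda * (Num.sqrt k.+1%:R / Num.sqrt n%:R)))%:E)).
  by rewrite sumEFin -EFinM mulrC.
move=> k _; under eq_set do rewrite walkE.
by rewrite brownian_positive ?sqrtrM ?sqrtrV // divr_gt0.
Qed.

End BrownianAverage.

(** * From the mesh to the continuous maximizer *)

Section BrownianArgmax.
Context d (T : measurableType d) (R : realType) (P : probability T R).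
Variables (W : R -> T -> R) (hW : standard_brownian P W).
Implicit Types l : R.

Lemma continuous_with_drift l t :
  {within `[0, +oo[, continuous (fun s => with_drift l W s t)}.
Proof.
move=> s; apply: cvgD; first exact: (brownian_continuous hW).
apply: continuous_subspaceT => u; apply: cvgM; [exact: cvg_cst|exact: cvg_id].
Qed.

Definition drift_argmax l t : R := argmax01 (fun s => with_drift l W s t).

Lemma drift_argmax_itv l t : 0 <= drift_argmax l t <= 1.
Proof. by have [] := argmax01P (@continuous_with_drift l t). Qed.

Lemma measurable_drift_argmax l : measurable_fun setT (drift_argmax l).
Proof.
apply: (measurability _ (RGenOInfty.measurableE R)) => //.
move=> /= _ [_ [a ->] <-]; rewrite setTI.
have -> : drift_argmax l @^-1` `]a, +oo[ = [set t | a < drift_argmax l t].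
  by apply/seteqP; split=> t /=; rewrite in_itv /= andbT.
have [a0|a0] := ltP a 0.
  rewrite (_ : [set t | _] = setT) //; apply/seteqP; split=> t // _.
  by apply: lt_le_trans a0 _; have /andP[] := drift_argmax_itv l t.
have [a1|a1] := ltP a 1; last first.
  rewrite (_ : [set t | _] = set0) //; apply/seteqP; split=> t //=.
  by rewrite ltNge; have /andP[_ h] := drift_argmax_itv l t; rewrite (le_trans h).
have mX s : 0 <= s -> measurable_fun setT (with_drift l W s).
  move=> s0; apply: measurable_funD; last exact: measurable_cst.
  exact: (brownian_measurable hW).
rewrite (_ : [set t | _] = \bigcup_n \bigcup_i \bigcap_m \bigcap_j
   [set t | with_drift l W (a * grid R m j) t + n.+1%:R^-1 <= with_drift l W (grid R n i) t]).
  apply: bigcupT_measurable => n; apply: bigcupT_measurable => i.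
  apply: bigcapT_measurable => m; apply: bigcapT_measurable => j.
  have /andP[g0 _] := grid_itv R m j; have /andP[g0' _] := grid_itv R n i.
  rewrite -[X in measurable X]setTI; apply: measurable_fun_le => //; last exact: mX.
  by apply: measurable_funD; [apply: mX; rewrite mulr_ge0|exact: measurable_cst].
apply/seteqP; split=> t /=.
  move=> /(argmax01_gtP (@continuous_with_drift l t) a0 a1)[n [i H]].
  by exists n => //; exists i => // m _ j _; exact: H.
move=> [n _ [i _ H]]; apply/(argmax01_gtP (@continuous_with_drift l t) a0 a1).
by exists n, i => m j; exact: (H m I j I).
Qed.

Lemma bounded_integrable (f : T -> R) (M : R) : measurable_fun setT f -> (forall t, `|f t| <= M) ->
  P.-integrable setT (EFin \o f).
Proof.
move=> mf fM; apply: measurable_bounded_integrable => //.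
  by rewrite -ge0_fin_numE //; exact: fin_num_measure.
by exists M; split=> [|N MN t _ /=]; [exact: num_real|exact: le_trans (fM t) (ltW MN)].
Qed.

Definition mean_argmax01 l : R := \int[P]_t drift_argmax l t.

Lemma integrable_drift_argmax l : P.-integrable setT (EFin \o drift_argmax l).
Proof.
apply: (@bounded_integrable _ 1); first exact: measurable_drift_argmax.
by move=> t; have /andP[? ?] := drift_argmax_itv l t; rewrite ger0_norm.
Qed.

Lemma mean_argmax01E l : ('E_P[drift_argmax l])%E = (mean_argmax01 l)%:E.
Proof.
rewrite unlock /mean_argmax01 /Rintegral fineK //.
by apply: integrable_fin_num => //; exact: integrable_drift_argmax.
Qed.

Lemma mean_argmax01_itv l : 0 <= mean_argmax01 l <= 1.
Proof.
apply/andP; split; first by apply: Rintegral_ge0 => t _; have /andP[] := drift_argmax_itv l t.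
have -> : 1 = \int[P]_t (cst 1 t : R) by rewrite Rintegral_cst // -[X in fine X]/(P setT) probability_setT mul1r.
apply: le_Rintegral => //; first exact: integrable_drift_argmax.
  exact: finite_measure_integrable_cst.
by move=> t _; have /andP[] := drift_argmax_itv l t.
Qed.

Let g l n t : R := (first_near_max 0 (sampled_walk W l n.+1 t) n.+1)%:R / n.+1%:R.

Let g_itv l n t : 0 <= g l n t <= 1.
Proof.
rewrite /g; have [an _ _] := first_near_max_spec (sampled_walk W l n.+1 t) n.+1 (lexx 0).
by rewrite divr_ge0 //= ler_pdivrMr ?ltr0n // mul1r ler_nat.
Qed.

Let measurable_g l n : measurable_fun setT (g l n).
Proof.
by apply: measurable_funM; [exact: (measurable_brownian_argmax hW)|exact: measurable_cst].
Qed.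

Let integrable_g l n : P.-integrable setT (EFin \o g l n).
Proof.
apply: (@bounded_integrable _ 1) => // t.
by have /andP[? ?] := g_itv l n t; rewrite ger0_norm.
Qed.

Let mean_g l n : \int[P]_t g l n t = normal_average l n.+1.
Proof. by rewrite /Rintegral (integral_sampled_argmax hW l (ltn0Sn n)). Qed.

Lemma normal_average_drift l delta : exists eps : nat -> R,
  (eps n @[n --> \oo] --> (0 : R)) /\
  forall n, delta * (normal_average l n.+1 - mean_argmax01 (l + delta)) <= eps n.
Proof.
(* The pathwise bound is one-sided, so the positive part is what tends to 0; it is dominated by
   |delta|. *)
pose h n t : R := Num.max 0 (delta * (g l n t - drift_argmax (l + delta) t)).
have md n : measurable_fun setT (fun t => delta * (g l n t - drift_argmax (l + delta) t)).
  apply: measurable_funM; first exact: measurable_cst.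
  by apply: measurable_funB => //; exact: measurable_drift_argmax.
have mh n : measurable_fun setT (h n) by apply: measurable_maxr => //; exact: measurable_cst.
have hb n t : `|h n t| <= `|delta|.
  have /andP[g0 g1] := g_itv l n t; have /andP[a0 a1] := drift_argmax_itv (l + delta) t.
  have dl : `|delta * (g l n t - drift_argmax (l + delta) t)| <= `|delta|.
    rewrite normrM ler_piMr // ler_norml; apply/andP; split; lra.
  rewrite /h; case: (leP 0 (delta * _)) => // _; by rewrite normr0.
have h0 t : h n t @[n --> \oo] --> (0 : R).
  apply/cvgrPdist_le => e e0.
  have cW : {within `[0, +oo[, continuous (fun s => W s t)} by exact: (brownian_continuous hW).
  have := grid_argmax_limit l delta cW e0; apply: filterS => n Hn.
  have hn0 : 0 <= h n t by rewrite /h le_max lexx.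
  by rewrite sub0r normrN ger0_norm // /h ge_max (ltW e0).
have h0' t : (h n t)%:E @[n --> \oo] --> 0%E.
  by apply: cvg_EFin; [exact: nearW|exact: h0].
exists (fun n => \int[P]_t h n t); split.
  have := @dominated_cvg _ T R P setT measurableT (fun n t => (h n t)%:E) (cst 0%E)
     (fun=> `|delta|%:E) (fun n => (measurable_EFinP _ _).2 (mh n))
     (fun t _ => h0' t).
  rewrite integral0 => H; apply: fine_cvg; apply: H => //.
  - exact: (finite_measure_integrable_cst P).
  - by move=> n t _; rewrite lee_fin; exact: hb.
move=> n; rewrite -mean_g /mean_argmax01 -RintegralB //; last exact: integrable_drift_argmax.
have ig : P.-integrable setT (EFin \o (fun t => g l n t - drift_argmax (l + delta) t)).
  have := integrableB measurableT (integrable_g l n) (integrable_drift_argmax (l + delta)).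
  by apply: eq_integrable => // t _ /=; rewrite EFinB.
rewrite -RintegralZl //; apply: le_Rintegral => //.
- have := integrableZl measurableT delta ig.
  by apply: eq_integrable => // t _ /=; rewrite EFinM.
- exact: (@bounded_integrable _ `|delta|).
by move=> t _; rewrite /h le_max lexx orbT.
Qed.

(** The averages at drift l - delta are asymptotically at most the target and those at l + delta at
    least the target, by [normal_average_drift] with both signs. Both lie within a multiple of delta
    of the average at l. *)
Lemma normal_average_cvg l : normal_average l n @[n --> \oo] --> mean_argmax01 l.
Proof.
rewrite -(cvg_shiftn 1 (normal_average l)) /=; under eq_cvg do rewrite addn1.
have lip l1 l2 n : l1 <= l2 ->
    0 <= normal_average l2 n.+1 - normal_average l1 n.+1 <= normal_peak 1 * (l2 - l1).
  move=> l12; rewrite /normal_average -mulrBl -sumrB.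
  pose x k : R := Num.sqrt k.+1%:R / Num.sqrt n.+1%:R.
  have x01 (k : 'I_n.+1) : 0 <= x k <= 1.
    rewrite /x divr_ge0 ?sqrtr_ge0 //= ler_pdivrMr ?sqrtr_gt0 // mul1r.
    by rewrite ler_sqrt ?ler0n // ler_nat.
  have H (k : 'I_n.+1) := normal_cdf_lipschitz (ler_wpM2r (proj1 (andP (x01 k))) l12).
  apply/andP; split.
    by rewrite divr_ge0 // sumr_ge0 // => k _; have /andP[] := H k.
  rewrite ler_pdivrMr ?ltr0n //.
  have -> : normal_peak 1 * (l2 - l1) * n.+1%:R = \sum_(k < n.+1) normal_peak 1 * (l2 - l1).
    by rewrite sumr_const card_ord mulr_natr.
  apply: ler_sum => k _; have /andP[_ h] := H k; apply: le_trans h _.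
  have /andP[x0 x1] := x01 k.
  by rewrite -mulrBl mulrA ler_piMr // mulr_ge0 ?normal_peak_ge0 ?subr_ge0.
apply/cvgrPdist_le => e e0.
(* The Lipschitz error is then at most e/2; the limits are used with tolerance e delta/2, which
   becomes e/2 after dividing by delta. *)
pose delta : R := e / (2 * (normal_peak 1 + 1)).
have pk0 : 0 <= normal_peak 1 :> R := normal_peak_ge0 _.
have d0 : 0 < delta by rewrite divr_gt0 // mulr_gt0 // ltr_wpDl.
have de : normal_peak 1 * delta <= e / 2.
  rewrite /delta; set k := normal_peak 1 in pk0 *.
  by rewrite mulrA ler_pdivrMr ?mulr_gt0 ?ltr_wpDl // ; nra.
clearbody delta.
have [ep [ep0 Hp]] := normal_average_drift (l - delta) delta.
have [em [em0 Hm]] := normal_average_drift (l + delta) (- delta).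
have ed0 : 0 < e * delta / 2 by rewrite divr_gt0 // mulr_gt0.
near=> n.
have h1 : ep n <= e * delta / 2.
  by near: n; move/cvgrPdist_le : ep0 => /(_ _ ed0); apply: filterS => n; rewrite sub0r normrN => /ler_normlW.
have h2 : em n <= e * delta / 2.
  by near: n; move/cvgrPdist_le : em0 => /(_ _ ed0); apply: filterS => n; rewrite sub0r normrN => /ler_normlW.
have := Hp n; have := Hm n; rewrite subrK addrK => hm hp.
have ld : l - delta <= l by rewrite lerBlDr lerDl ltW.
have ld' : l <= l + delta by rewrite lerDl ltW.
have /andP[_ l1] := lip _ _ n ld; have /andP[_ l2] := lip _ _ n ld'.
have E1 : l - (l - delta) = delta by ring.
have E2 : l + delta - l = delta by ring.
rewrite E1 in l1; rewrite E2 in l2.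
set J := normal_average l n.+1 in l1 l2 *; set m := mean_argmax01 l in hm hp *.
set Jm := normal_average (l - delta) n.+1 in l1 hp.
set Jp := normal_average (l + delta) n.+1 in l2 hm.
have hp' : Jm - m <= e / 2.
  by rewrite -(ler_pM2l d0); apply: le_trans hp _; apply: le_trans h1 _; rewrite mulrA [delta * e]mulrC.
have hm' : m - Jp <= e / 2.
  rewrite -(ler_pM2l d0) -opprB mulrN -mulNr; apply: le_trans hm _; apply: le_trans h2 _.
  by rewrite mulrA [delta * e]mulrC.
by rewrite ler_norml; apply/andP; split; lra.
Unshelve. all: by end_near.
Qed.

End BrownianArgmax.

(** * Convergence in distribution *)

Lemma probability_outcome (R : realType) n (p : R) d (T : measurableType d)
    (P : probability T R) (omega : T -> word3 n) (A : pred (word3 n)) :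
  bernoulli_initial p P omega ->
  P [set t | A (omega t)] = (\sum_(w | A w) initial_pmf p w)%:E.
Proof.
move=> init.
have H (s : seq (word3 n)) : uniq s -> measurable [set t | omega t \in s] /\
    P [set t | omega t \in s] = (\sum_(w <- s) initial_pmf p w)%:E.
  elim: s => [_|w s IHs /= /andP[ws /IHs[ms Ps]]].
    have -> : [set t | omega t \in [::]] = set0 by apply/seteqP; split.
    by rewrite big_nil measure0; split.
  have [mw Pw] := init w.
  have -> : [set t | omega t \in w :: s] = (omega @^-1` [set w]) `|` [set t | omega t \in s].
    apply/seteqP; split=> t /=; rewrite inE; first by move=> /predU1P.
    by move=> /predU1P.
  split; first exact: measurableU.
  rewrite measureU //; first by rewrite big_cons EFinD -Pw -Ps.
  by apply/seteqP; split=> t //= [-> wt]; rewrite wt in ws.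
have [_] := H (enum A) (enum_uniq _).
rewrite big_enum /= => <-; congr (P _).
by apply/seteqP; split=> t /=; rewrite mem_enum.
Qed.

Section Outcome.
Variables (R : realType) (lambda : R).
Let p n : R := 2^-1 - lambda / (2 * Num.sqrt n%:R).

Lemma initial_pmf_ge0 n (q : R) (w : word3 n) : 0 <= q <= 1 -> 0 <= initial_pmf q w.
Proof.
move=> q01; apply: sumr_ge0 => w' _; apply: sumr_ge0 => u _; rewrite mulr_ge0 //.
  by apply: prodr_ge0 => i _; exact: bernoulli_pmf_ge0.
by rewrite /position_pmf; case: ifP => // _; rewrite divr_ge0.
Qed.

Lemma le_outcome_prob n (A B : pred (word3 n)) : 0 <= p n <= 1 -> subpred A B ->
  outcome_prob lambda A <= outcome_prob lambda B.
Proof.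
move=> p01 AB; rewrite /outcome_prob big_mkcond [leRHS]big_mkcond; apply: ler_sum => w _.
case: ifP => [/AB -> //|_]; case: ifP => // _; exact: initial_pmf_ge0.
Qed.

Lemma outcome_probC n (A : pred (word3 n)) :
  outcome_prob lambda (predC A) =
  outcome_prob lambda (@predT (word3 n)) - outcome_prob lambda A.
Proof. by rewrite /outcome_prob [in RHS](bigID A) /= addrAC subrr add0r. Qed.

End Outcome.

Lemma bernoulli_prob_preimage (R : realType) (q : R) (A : set bool) : 0 <= q <= 1 ->
  bernoulli_prob q A = (q * (true \in A)%:R + (1 - q) * (false \in A)%:R)%:E.
Proof. by move=> q01; rewrite bernoulli_probE // EFinD !EFinM !diracE. Qed.

Unset Implicit Arguments.

Theorem theorem1p3 (R : realType) (lambda : R) (p : nat -> R)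
  (hp : forall n, p n = 2^-1 - lambda / (2 * Num.sqrt n%:R))
  (d_ : nat -> measure_display) (T_ : forall n, measurableType (d_ n))
  (P_ : forall n, probability (T_ n) R) (omega : forall n, T_ n -> word3 n)
  (homega : forall n, (0 < n)%N -> 0 <= p n <= 1 ->
     bernoulli_initial (p n) (P_ n) (omega n))
  (dW : measure_display) (TW : measurableType dW) (PW : probability TW R)
  (W : R -> TW -> R) (hW : standard_brownian PW W) :
  exists (d : measure_display) (T : measurableType d) (P : probability T R)
    (X : {RV P >-> R}),
    [/\ P [set t | X t = 0] = (1 - P [set t | X t = 1%R])%E,
        (1 - P [set t | X t = 1%R])%E =
          ('E_PW[fun t => argmax01 (fun s => with_drift lambda W s t)])%E
      & cvg_in_distribution P_ (fun n t => excess R (omega n t)) X].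
Proof.
pose theta := mean_argmax01 PW W lambda.
have theta01 : 0 <= theta <= 1 := mean_argmax01_itv hW lambda.
have q01 : 0 <= 1 - theta <= 1 by case/andP: theta01 => ? ?; apply/andP; split; lra.
have qK : 1 - (1 - theta) = theta by rewrite opprB addrC subrK.
(* The limit variable lives on the two point space, with [true] read as 1. *)
pose P : probability bool R := bernoulli_prob (1 - theta).
pose f (b : bool) : R := b%:R.
have mf : measurable_fun setT f by [].
pose X : {RV P >-> R} := mfun_Sub (mem_set mf).
have PE (A : set bool) : P A = ((1 - theta) * (true \in A)%:R + theta * (false \in A)%:R)%:E.
  by rewrite -[X in X * (false \in A)%:R]qK; exact: bernoulli_prob_preimage.
have P1 : P [set t | X t = 1%R] = (1 - theta)%:E.
  rewrite PE mem_set // memNset; first by rewrite mulr1 mulr0 addr0.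
  by move=> /= /eqP; rewrite eq_sym oner_eq0.
have P0 : P [set t | X t = 0%R] = theta%:E.
  rewrite PE memNset; first by rewrite mem_set // mulr1 mulr0 add0r.
  by move=> /= /eqP; rewrite oner_eq0.
have cdfE x : cdf X x = (if x < 0 then 0 else if x < 1 then theta else 1)%:E.
  have -> : cdf X x = P [set b | f b <= x] by [].
  have memE b : (b \in [set b | f b <= x]) = (f b <= x).
    by apply/idP/idP => [/set_mem|/mem_set].
  rewrite PE !memE /f /=.
  have [x0|x0] := ltP x 0; last have [x1|x1] := ltP x 1.
  - by rewrite lt_geF ?(lt_trans x0) // !mulr0 addr0.
  - by rewrite mulr0 add0r mulr1.
  - by rewrite !mulr1 subrK.
exists _, bool, P, X; split.
- by rewrite P0 P1 -EFinB qK.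
- by rewrite P1 -EFinB qK -mean_argmax01E.
move=> x _; rewrite cdfE.
have average : normal_average lambda n @[n --> \oo] --> theta by exact: normal_average_cvg.
have [out0 out1] := outcome_prob_cvg average.
have diff0 : outcome_prob lambda (fun w : word3 n => excess R w != 1) -
    outcome_prob lambda (fun w : word3 n => excess R w == 0) @[n --> \oo] --> (0 : R).
  by rewrite -[X in _ --> X](subrr theta); apply: cvgB.
have parameter : \forall n \near \oo, [/\ (0 < n)%N, 0 <= p n <= 1 &
    bernoulli_initial (p n) (P_ n) (omega n)].
  apply: filterS (parameter_near lambda) => n [n0 /andP[h1 h2]].
  have p01 : 0 <= p n <= 1 by rewrite hp; apply/andP; split; lra.
  by split=> //; exact: homega.
have cdfnE : \forall n \near \oo, (outcome_prob lambda (fun w : word3 n => excess R w <= x))%:E =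
    P_ n [set t | excess R (omega n t) <= x].
  apply: filterS parameter => n [n0 p01 init].
  by rewrite (probability_outcome (fun w => excess R w <= x) init) /outcome_prob hp.
apply: (cvg_trans (near_eq_cvg cdfnE)); apply: cvg_EFin; first exact: nearW.
rewrite /comp /=.
have parameter' : \forall n \near \oo, 0 <= 2^-1 - lambda / (2 * Num.sqrt n%:R) <= 1 /\
    outcome_prob lambda (@predT (word3 n)) = 1.
  apply: filterS parameter => n [n0 p01 init]; rewrite -hp; split=> //.
  have := probability_outcome predT init; rewrite (_ : [set t | _] = setT) ?probability_setT.
    by rewrite /outcome_prob -hp => -[].
  by apply/seteqP; split.
(* Excess 0 and excess different from 1 have the same limiting probability, so this difference event
   is negligible. *)
pose other n (w : word3 n) := (excess R w != 0) && (excess R w != 1).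
have otherE n : outcome_prob lambda (@other n) =
    outcome_prob lambda (fun w : word3 n => excess R w != 1) -
    outcome_prob lambda (fun w : word3 n => excess R w == 0).
  rewrite /outcome_prob [X in _ = X - _](bigID (fun w => excess R w == 0)) /=.
  have -> : \sum_(w : word3 n | (excess R w != 1) && (excess R w == 0)) initial_pmf (2^-1 - lambda / (2 * Num.sqrt n%:R)) w
      = \sum_(w : word3 n | excess R w == 0) initial_pmf (2^-1 - lambda / (2 * Num.sqrt n%:R)) w.
    by apply: eq_bigl => w; rewrite andbC; case: eqP => //= ->; rewrite eq_sym oner_eq0.
  rewrite addrAC subrr add0r; apply: eq_bigl => w; exact: andbC.
have other0 : outcome_prob lambda (@other n) @[n --> \oo] --> (0 : R).
  by under eq_cvg do rewrite otherE.
(* For x < 0 the event E <= x lies inside [other]; for x in [0, 1) it lies between E = 0 and E <> 1;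
   for x >= 1 its complement lies inside [other]. *)
have [x0|x0] := ltP x 0; last have [x1|x1] := ltP x 1.
- apply: (squeeze_cvgr _ (cvg_cst 0) other0).
  apply: filterS parameter' => n [p01 _]; apply/andP; split.
    by apply: sumr_ge0 => w _; exact: initial_pmf_ge0.
  apply: le_outcome_prob => // w wx; apply/andP; split; apply: contraTneq wx => ->.
    by rewrite -ltNge.
  by rewrite -ltNge; lra.
- apply: (squeeze_cvgr _ out0 out1); apply: filterS parameter' => n [p01 _]; apply/andP; split.
    by apply: le_outcome_prob => // w /eqP ->.
  by apply: le_outcome_prob => // w; apply: contraTneq => ->; rewrite -ltNge.
have one_other : 1 - outcome_prob lambda (@other n) @[n --> \oo] --> (1 : R).
  by rewrite -[X in _ --> X]subr0; apply: cvgB => //; exact: cvg_cst.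
apply: (squeeze_cvgr _ one_other (cvg_cst (1 : R))).
apply: filterS parameter' => n [p01 oT]; rewrite -oT -outcome_probC; apply/andP; split.
  apply: le_outcome_prob => // w; rewrite /other /= negb_and !negbK.
  by case/orP=> /eqP ->.
exact: le_outcome_prob.
Qed.
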